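(* Let $n\ge 1$, $d\ge1$, $\mathbb{N}_n=\{1,\dots,n\}$. On a probability space $(\Omega,\mathscr F,\mathbb P)$ let $W^0=(W^0_1,\dots,W^0_d)$ be an $n$-parameter $\mathbb R^d$-valued Brownian sheet with $W^0(\mathbf t)=0$ for $\mathbf t\in\partial\mathbb R_+^n$, let $W^x=W^0+x$ for $x\in\mathbb R^d$, and let $B^{(1)},\dots,B^{(n)}$ be independent standard one-dimensional Brownian motions started at $0$, independent of $W^0$. Define the Brownian-time Brownian sheet $$\mathbb W^x(\mathbf t)=W^x\big(|B^{(1)}(t_1)|,\dots,|B^{(n)}(t_n)|\big),\qquad \mathbf t=(t_1,\dots,t_n)\in\mathbb R_+^n.$$ Let $f:\mathbb R^d\to\mathbb R$ be bounded and measurable such that all second order partial derivatives $\partial^2_{kl}f$ ($1\le k,l\le d$) are bounded and Hölder continuous with some exponent $0<\alpha\le1$. For $(\mathbf t,x)\in\mathbb R_+^n\times\mathbb R^d$ set $$u(\mathbf t,x)=\mathbb E\big[f(\mathbb W^x(\mathbf t))\big],\qquad \mathscr U^{(j)}(\mathbf t,x)=\mathbb E\Big[\Big(\prod_{i\in\mathbb N_n\setminus\{j\}}|B^{(i)}(t_i)|\Big)^2 f(\mathbb W^x(\mathbf t))\Big],\quad j\in\mathbb N_n.$$ Then the family $\{u,\mathscr U^{(1)},\dots,\mathscr U^{(n)}\}$ solves: (i) the linear system, for every $j\in\mathbb N_n$: (a) $\displaystyle \frac{\partial u}{\partial t_j}(\mathbf t,x)=\sqrt{\frac{\prod_{i\in\mathbb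 N_n\setminus\{j\}}t_i}{2^{4-n}\pi^n t_j}}\,\Delta_x f(x)+\frac18\Delta_x^2\mathscr U^{(j)}(\mathbf t,x)$ for $\mathbf t$ in the interior of $\mathbb R_+^n$, $x\in\mathbb R^d$; (b) $u(\mathbf t,x)=f(x)$ for $\mathbf t\in\partial\mathbb R_+^n$, $x\in\mathbb R^d$; (c) $\mathscr U^{(j)}(\mathbf t,x)=0$ whenever $\mathbf t_{\not j}\in\partial\mathbb R_+^{n-1}$, $x\in\mathbb R^d$; (d) $\mathscr U^{(j)}(\mathbf t,x)=\big[\prod_{i\in\mathbb N_n\setminus\{j\}}t_i\big]f(x)$ whenever $t_j=0$, $x\in\mathbb R^d$; (ii) the nonlinear fourth order interacting PDE $$\prod_{j\in\mathbb N_n}\frac{\partial u}{\partial t_j}=\sqrt{\frac{(t_1\cdots t_n)^{n-2}}{2^{4n-n^2}\pi^{n^2}}}\,(\Delta_xf(x))^n+\frac1{8^n}\prod_{j\in\mathbb N_n}\Delta_x^2\mathscr U^{(j)}+\sum_{(k_1,\dots,k_n)\in\mathbb S_n}\prod_{j\in\mathbb N_n}T_{k_j,j}(\mathbf t,x)$$ for $\mathbf t$ in the interior of $\mathbb R_+^n$, $x\in\mathbb R^d$, together with the boundary conditions (b), (c), (d) above, where $T_{1,j}(\mathbf t,x)=\sqrt{\frac{\prod_{i\in\mathbb N_n\setminus\{j\}}t_i}{2^{4-n}\pi^n t_j}}\,\Delta_xf(x)$, $T_{2,j}(\mathbf t,x)=\frac18\Delta_x^2\mathscr U^{(j)}(\mathbf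 t,x)$, and $\mathbb S_n=\{(k_1,\dots,k_n)\in\{1,2\}^n: n+1\le\sum_j k_j\le 2n-1\}$ (for $n\ge2$; for $n=1$ this set is empty and the sum is $0$).
   Context: An $n$-parameter $\mathbb R^d$-valued Brownian sheet $W^0$ is a centered Gaussian random field indexed by $\mathbb R_+^n$ whose $d$ coordinates are independent, each with covariance $\mathbb E[W^0_k(\mathbf s)W^0_k(\mathbf t)]=\prod_{i=1}^n\min(s_i,t_i)$. For $\mathbf t=(t_1,\dots,t_n)$, $\mathbf t_{\not j}\in\mathbb R_+^{n-1}$ denotes the tuple obtained by deleting $t_j$. $\Delta_x$ is the Laplacian in $x$ and $\Delta_x^2$ its square. An empty product equals $1$. *)

(* Defs.v *)
From HB Require Import structures.
From mathcomp Require Import all_boot all_order all_algebra.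
From mathcomp Require Import all_classical all_reals all_analysis.
Import Order.TTheory GRing.Theory Num.Theory numFieldNormedType.Exports.

Set Implicit Arguments.
Unset Strict Implicit.
Unset Printing Implicit Defensive.

Local Open Scope classical_set_scope.
Local Open Scope ring_scope.

Definition orthant {R : realType} (n : nat) : set 'rV[R]_n :=
  [set t | forall i : 'I_n, 0 <= t ord0 i].
Arguments orthant {R} n.

Definition orthant_interior {R : realType} (n : nat) : set 'rV[R]_n :=
  [set t | forall i : 'I_n, 0 < t ord0 i].
Arguments orthant_interior {R} n.

Definition orthant_boundary {R : realType} (n : nat) : set 'rV[R]_n :=
  [set t | orthant n t /\ exists i : 'I_n, t ord0 i = 0].
Arguments orthant_boundary {R} n.

Definition evec {R : realType} (m : nat) (i : 'I_m) : 'rV[R]_m := delta_mx 0 i.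

(** the pi-system of cylinder events generated by a real process X on
    the index set D : events of the form \bigcap_{t in s} {X t \in A t},
    s a finite list of indices in D, A t Borel *)
Definition cyl_events {disp} {T : measurableType disp} {R : realType}
  {S : eqType} (D : set S) (X : S -> T -> R) : set (set T) :=
  [set E | exists (s : seq S) (A : S -> set R),
     [set` s] `<=` D /\ (forall t, measurable (A t)) /\
     E = \bigcap_(t in [set` s]) (X t @^-1` A t)].

Definition mutually_independent {disp} {T : measurableType disp} {R : realType}
  (P : probability T R) (I : finType) (G : I -> set (set T)) : Prop :=
  forall (J : {set I}) (A : I -> set T),
    (forall i, i \in J -> G i (A i)) ->
    P (\bigcap_(i in [set i | i \in J]) A i) = (\prod_(i in J) P (A i))%E.

Definition centered_gaussian_process {disp} {T : measurableType disp}
  {R : realType} (P : probability T R) {S : eqType} (D : set S)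
  (K : S -> S -> R) (X : S -> T -> R) : Prop :=
  (forall t, D t -> measurable_fun setT (X t)) /\
  forall (s : seq S) (c : S -> R), [set` s] `<=` D ->
    forall A : set R, measurable A ->
      P ((fun w => \sum_(t <- s) c t * X t w) @^-1` A) =
      (let v := \sum_(t <- s) \sum_(t' <- s) c t * c t' * K t t' in
       if v == 0 then \d_(0 : R) A else normal_prob 0 (Num.sqrt v) A).

Definition brownian_sheet1 {disp} {T : measurableType disp} {R : realType}
  (P : probability T R) (n : nat) (X : 'rV[R]_n -> T -> R) : Prop :=
  centered_gaussian_process P (orthant n)
    (fun s t => \prod_(i < n) Order.min (s ord0 i) (t ord0 i)) X /\
  forall w, {within orthant n, continuous (fun t => X t w)}.

Definition brownian_motion {disp} {T : measurableType disp} {R : realType}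
  (P : probability T R) (X : R -> T -> R) : Prop :=
  centered_gaussian_process P [set t | 0 <= t]
    (fun s t => Order.min s t) X /\
  (forall w, {within [set t : R | 0 <= t], continuous (fun t => X t w)}) /\
  (forall w, X 0 w = 0).

Definition sheet_motions_independent {disp} {T : measurableType disp}
  {R : realType} (P : probability T R) (n d : nat)
  (W : 'I_d -> 'rV[R]_n -> T -> R) (B : 'I_n -> R -> T -> R) : Prop :=
  mutually_independent P
    (fun a : ('I_d + 'I_n)%type => match a with
       | inl k => cyl_events (orthant n) (W k)
       | inr i => cyl_events [set t : R | 0 <= t] (B i) end).

Definition BTBS {T : Type} {R : realType} (n d : nat)
  (W : 'I_d -> 'rV[R]_n -> T -> R) (B : 'I_n -> R -> T -> R)
  (x : 'rV[R]_d) (t : 'rV[R]_n) (w : T) : 'rV[R]_d :=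
  \row_(k < d) W k (\row_(i < n) `|B i (t ord0 i) w|) w + x.

Definition u_fun {disp} {T : measurableType disp} {R : realType}
  (P : probability T R) (n d : nat) (W : 'I_d -> 'rV[R]_n -> T -> R)
  (B : 'I_n -> R -> T -> R) (f : 'rV[R]_d -> R)
  (t : 'rV[R]_n) (x : 'rV[R]_d) : R :=
  fine ('E_P[fun w => f (BTBS W B x t w)]).

Definition U_fun {disp} {T : measurableType disp} {R : realType}
  (P : probability T R) (n d : nat) (W : 'I_d -> 'rV[R]_n -> T -> R)
  (B : 'I_n -> R -> T -> R) (f : 'rV[R]_d -> R) (j : 'I_n)
  (t : 'rV[R]_n) (x : 'rV[R]_d) : R :=
  fine ('E_P[fun w => (\prod_(i < n | i != j) `|B i (t ord0 i) w|) ^+ 2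
                       * f (BTBS W B x t w)]).

Definition partial {R : realType} (m : nat) (k : 'I_m) (g : 'rV[R]_m -> R)
  (x : 'rV[R]_m) : R := 'D_(evec k) g x.

Definition laplacian {R : realType} (m : nat) (g : 'rV[R]_m -> R)
  (x : 'rV[R]_m) : R := \sum_(k < m) partial k (partial k g) x.

Definition bilaplacian {R : realType} (m : nat) (g : 'rV[R]_m -> R) :
  'rV[R]_m -> R := laplacian (laplacian g).

Definition bilaplacian_exists {R : realType} (m : nat) (g : 'rV[R]_m -> R) :=
  forall (k : 'I_m) (x : 'rV[R]_m),
    derivable g x (evec k) /\ derivable (partial k g) x (evec k) /\
    derivable (laplacian g) x (evec k) /\
    derivable (partial k (laplacian g)) x (evec k).

Definition borel_measurable_rV {R : realType} (m : nat) (f : 'rV[R]_m -> R) :=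
  forall A : set R, measurable A ->
    <<s [set U : set 'rV[R]_m | open U] >> (f @^-1` A).

Definition bounded_fun_rV {R : realType} (m : nat) (g : 'rV[R]_m -> R) :=
  exists M : R, forall x, `|g x| <= M.

Definition holder {R : realType} (m : nat) (alpha : R) (g : 'rV[R]_m -> R) :=
  exists C : R, forall x y, `|g x - g y| <= C * `|x - y| `^ alpha.

Definition T1 {R : realType} (n d : nat) (f : 'rV[R]_d -> R) (j : 'I_n)
  (t : 'rV[R]_n) (x : 'rV[R]_d) : R :=
  Num.sqrt ((\prod_(i < n | i != j) t ord0 i) /
            ((2 : R) `^ (4 - n%:R) * pi ^+ n * t ord0 j)) * laplacian f x.

Definition T2 {R : realType} (n d : nat) (U : 'I_n -> 'rV[R]_n -> 'rV[R]_d -> R)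
  (j : 'I_n) (t : 'rV[R]_n) (x : 'rV[R]_d) : R :=
  8^-1 * bilaplacian (U j t) x.

(* Main.v *)
(** Given the random times |B^(i)(t_i)|, the sheet evaluated at them is a
    centred Gaussian vector of variance rho = prod_i sqrt(t_i) |b_i|, so that
      u(t,x) = E f(x + sqrt(rho) z),
      U^(j)(t,x) = E [rho^2 / (t_j b_j^2) f(x + sqrt(rho) z)]
    with z_1, ..., z_d, b_1, ..., b_n i.i.d. standard normal; this is checked on
    times rounded to a finite grid, where independence applies directly, and
    passes to the limit by path continuity.  Write h for the Laplacian of f.

    Differentiating in t_j and integrating by parts in z (Stein's identity),
      d_j u = (4 t_j)^-1 E [rho h(x + sqrt(rho) z)].
    Putting two space derivatives on f and two on the Gaussian kernel,
      bilap U^(j) = t_j^-1 E [rho b_j^-2 (h(x + sqrt(rho) z) - h(x)) (|z|^2 - d)],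
    where the Hoelder continuity of h compensates the singularity b_j^-2.
    The term h(x) E[rho] is T_1, and what remains is the identity
      E [rho h~] = 1/2 E [rho b_j^-2 h~ (|z|^2 - d)],
      h~ = h(x + sqrt(rho) z) - h(x).
    After substituting z for sqrt(rho) z, the difference of the two sides, as a
    function of y = |b_j|, is a multiple of the derivative of
    exp(-y^2/2) y^(-d/2) exp(-A/y) with A > 0, which vanishes at 0 and at
    infinity. *)

Require Import Defs.
From HB Require Import structures.
From mathcomp Require Import all_boot all_order all_algebra.
From mathcomp Require Import all_classical all_reals all_analysis.
From mathcomp Require Import measurable_realfun ring lra zify.
Import Order.TTheory GRing.Theory Num.Theory numFieldNormedType.Exports.
Set Implicit Arguments.
Unset Strict Implicit.
Unset Printing Implicit Defensive.
Local Open Scope classical_set_scope.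
Local Open Scope ring_scope.

(** * Directional derivatives on row vectors *)

(** The singularity is borderline. Two derivatives on the kernel cost a factor [1 / rho] and leave
    [rho b_j^-2], of order [|b_j|^-1] near 0, just beyond integrability. The Hoelder bound
    contributes [rho^(alpha/2)] and raises the exponent to [-1 + alpha/2]. Subtracting [h(x)] is
    free because [z_k^2 - 1] has mean 0, and it is this subtraction that separates the term [h(x)
    E[rho]] from the bilaplacian. The product Gaussian law is not built by hand: it is the law of
    the sheets and motions at times all equal to 1, where every variance is 1. One-dimensional
    calculations reach it through a single device: redrawing one coordinate independently leaves the
    law unchanged, so that each coordinate can be integrated out alone with the others frozen. The
    derivatives of [f] are given along the coordinate axes only, whereas a change of time moves the
    argument of [f] along the whole random vector [z]; the derivative in that direction is built
    from Lipschitz partial derivatives. *)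

Section line_derivative.
Context {R : realType} {m : nat}.
Implicit Types (g : 'rV[R]_m -> R) (x v : 'rV[R]_m).

Lemma derive_quot_line g x v (e0 : R) :
  (fun h : R => h^-1 *: ((g \o shift (x + e0 *: v)) (h *: v) - g (x + e0 *: v))) =
  (fun h : R => h^-1 *: (((fun e : R => g (x + e *: v)) \o shift e0) (h *: (1 : R))
                    - g (x + e0 *: v))).
Proof.
apply/funext => h /=; congr (_ *: (g _ - _)).
by rewrite [h *: 1]mulr1 scalerDl addrCA.
Qed.

Lemma derivable_lineE g x v (e0 : R) :
  derivable g (x + e0 *: v) v = derivable (fun e : R => g (x + e *: v)) e0 1.
Proof. by rewrite /derivable derive_quot_line. Qed.

Lemma derive_lineE g x v (e0 : R) :
  'D_v g (x + e0 *: v) = 'D_1 (fun e : R => g (x + e *: v)) e0.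
Proof. by rewrite /derive derive_quot_line. Qed.

Lemma is_derive_line g x v (e0 : R) l :
  is_derive (x + e0 *: v) v g l <-> is_derive e0 1 (fun e : R => g (x + e *: v)) l.
Proof.
split=> -[dg gl]; split.
- by rewrite -derivable_lineE.
- by rewrite -derive_lineE.
- by rewrite derivable_lineE.
- by rewrite derive_lineE.
Qed.

Lemma is_derive_line0 g x v l :
  is_derive x v g l <-> is_derive (0 : R) 1 (fun e : R => g (x + e *: v)) l.
Proof. by rewrite -is_derive_line scale0r addr0. Qed.

Lemma is_derive_partial g x k :
  derivable g x (evec k) -> is_derive x (evec k) g (partial k g x).
Proof. by move=> dg; split. Qed.

(** The sign of [c] is free: the mean value theorem is applied on [[c, 0]] or [[0, c]], and the
    bound on [th] is what the remainder estimates retain. *)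
Lemma MVT_line g x k (c : R) :
  (forall y, derivable g y (evec k)) ->
  exists2 th : R, `|th| <= `|c| &
    g (x + c *: evec k) - g x = partial k g (x + th *: evec k) * c.
Proof.
move=> dg.
pose p (e : R) := g (x + e *: evec k).
have dp (e : R) : is_derive e 1 p (partial k g (x + e *: evec k)).
  exact/is_derive_line/is_derive_partial.
have cp a b : {within `[a, b], continuous p}.
  by apply: derivable_within_continuous => e _; exact: (@ex_derive _ _ _ _ _ _ _ (dp e)).
have gp : g x = p 0 by rewrite /p scale0r addr0.
have [c0|c0|->] := ltrgtP c 0.
- have [th] := MVT c0 (fun e _ => dp e) (cp _ _).
  rewrite in_itv/= => /andP[cth th0] pE.
  exists th; first by rewrite !ltr0_norm// lerN2 ltW.
  by apply/eqP; rewrite gp -/(p c) -eqr_opp opprB pE sub0r mulrN.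
- have [th] := MVT c0 (fun e _ => dp e) (cp _ _).
  rewrite in_itv/= => /andP[th0 thc] pE.
  exists th; first by rewrite !gtr0_norm// ltW.
  by rewrite gp -/(p c) pE subr0.
- by exists 0 => //; rewrite !scale0r addr0 subrr mulr0.
Qed.

(** Keeps the coordinates of [v] listed in [l], so that [x + v] is reached from [x] by moving one
    coordinate at a time. *)
Definition rowpart (l : seq 'I_m) v : 'rV[R]_m := \sum_(k <- l) v 0 k *: evec k.

Lemma rowpart_enum v : rowpart (enum 'I_m) v = v.
Proof. by rewrite /rowpart big_enum/= -row_sum_delta. Qed.

Lemma rV_norm_leP v (c : R) : 0 <= c -> (forall k, `|v 0 k| <= c) -> `|v| <= c.
Proof.
move=> c0 vc; rewrite [leLHS]mx_normrE.
by apply: bigmax_le => // -[i j] _ /=; rewrite ord1.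
Qed.

Lemma norm_coord_le v k : `|v 0 k| <= `|v|.
Proof.
rewrite [leRHS]mx_normrE.
by have := @le_bigmax _ _ _ (0 : R) (fun ij : 'I_1 * 'I_m => `|v ij.1 ij.2|) (0, k).
Qed.

Lemma norm_evec_le1 (k : 'I_m) : `|evec k : 'rV[R]_m| <= 1.
Proof.
apply: rV_norm_leP => // j.
by rewrite mxE eqxx /=; case: eqP => _ /=; rewrite ?normr1 ?normr0.
Qed.

Lemma norm_rowpart l v : `|rowpart l v| <= (size l)%:R * `|v|.
Proof.
elim: l => [|k l ih]; first by rewrite /rowpart big_nil normr0 mul0r.
rewrite /rowpart big_cons -/(rowpart l v) /= -natr1 mulrDl mul1r [leRHS]addrC.
rewrite (le_trans (ler_normD _ _))// lerD// normrZ.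
by rewrite -[leRHS]mulr1 ler_pM// ?norm_coord_le// norm_evec_le1.
Qed.

Section lipschitz.
Variables (g : 'rV[R]_m -> R) (M : R).
Hypothesis dg : forall k y, derivable g y (evec k).
Hypothesis gM : forall k y, `|partial k g y| <= M.

Let lip_part l x v : `|g (x + rowpart l v) - g x| <= (size l)%:R * M * `|v|.
Proof.
elim: l => [|k l ih].
  by rewrite /rowpart big_nil addr0 subrr normr0 !mul0r.
rewrite /rowpart big_cons -/(rowpart l v) addrCA [v 0 k *: _ + _]addrC.
rewrite -(subrKA (g (x + rowpart l v))).
rewrite (le_trans (ler_normD _ _))//= -natr1 !mulrDl mul1r [leRHS]addrC lerD//.
have [th _ ->] := MVT_line (x + rowpart l v) (v 0 k) (@dg k).
by rewrite normrM ler_pM// norm_coord_le.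
Qed.

(** Each of the [m] coordinate moves is bounded by the mean value theorem, and in the max norm no
    coordinate exceeds the norm of the whole step. *)
Lemma lipschitz_of_partials x y : `|g y - g x| <= m%:R * M * `|y - x|.
Proof.
have := lip_part (enum 'I_m) x (y - x).
by rewrite rowpart_enum (addrC x) subrK size_enum_ord.
Qed.

End lipschitz.

Section quadratic_remainder.
Variables (g : 'rV[R]_m -> R) (L : R).
Hypothesis dg : forall k y, derivable g y (evec k).
Hypothesis lip : forall k x y, `|partial k g y - partial k g x| <= L * `|y - x|.

Let rem_part l x v :
  `|g (x + rowpart l v) - g x - \sum_(k <- l) v 0 k * partial k g x|
    <= (size l)%:R ^+ 2 * L * `|v| ^+ 2.
Proof.
(* A nonzero [v] is what allows [0 <= L] to be read off from [lip]. *)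
have [->|/eqP v0] := eqVneq v 0.
  rewrite (_ : rowpart l 0 = 0); last first.
    by rewrite /rowpart big1// => i _; rewrite mxE scale0r.
  rewrite addr0 subrr sub0r normrN normr0 expr0n mulr0 big1 ?normr0// => i _.
  by rewrite mxE mul0r.
elim: l => [|k l ih].
  by rewrite /rowpart !big_nil addr0 subrr subr0 normr0 expr0n !mul0r.
have L0 : 0 <= L.
  have := lip k 0 v; rewrite subr0 => /(le_trans (normr_ge0 _)).
  by rewrite pmulr_lge0// normr_gt0; exact/eqP.
rewrite /rowpart !big_cons -/(rowpart l v) addrCA [v 0 k *: _ + _]addrC.
have [th thv E] := MVT_line (x + rowpart l v) (v 0 k) (@dg k).
rewrite mulrC in E.
rewrite (_ : _ - _ - _ = (g (x + rowpart l v) - g x -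
    \sum_(k <- l) v 0 k * partial k g x) +
  v 0 k * (partial k g (x + rowpart l v + th *: evec k) - partial k g x)); last first.
  rewrite mulrBr -E.
  move: (g (_ + _ + _)) (g (_ + _)) (g x) (v 0 k * _) (\sum_(_ <- _) _) => a1 a2 a3 a4 a5.
  by rewrite opprD; lra.
rewrite (le_trans (ler_normD _ _))//.
(* The new coordinate costs at most [(k + 1) L |v|^2] with [k = size l], and
   [k^2 + k + 1 <= (k + 1)^2] closes the induction. *)
rewrite (@le_trans _ _ ((size l)%:R ^+ 2 * L * `|v| ^+ 2
   + `|v| * (L * ((size l).+1%:R * `|v|))))//.
  rewrite lerD// normrM ler_pM// ?norm_coord_le//.
  rewrite (le_trans (lip _ _ _))// ler_wpM2l//.
  rewrite -(addrA x) [x + _]addrC addrK (le_trans (ler_normD _ _))//.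
  rewrite -natr1 mulrDl mul1r lerD// ?norm_rowpart//.
  rewrite normrZ -[leRHS]mulr1 ler_pM// ?norm_evec_le1//.
  by rewrite (le_trans thv)// norm_coord_le.
rewrite (_ : _ + _ = ((size l)%:R ^+ 2 + (size l).+1%:R) * (L * `|v| ^+ 2)); last first.
  by move: `|v| => w; ring.
rewrite -mulrA ler_wpM2r ?mulr_ge0 ?exprn_ge0//=.
rewrite -natrX -natrX -natrD ler_nat.
by nia.
Qed.

Lemma quadratic_remainder x v :
  `|g (x + v) - g x - \sum_k v 0 k * partial k g x| <= m%:R ^+ 2 * L * `|v| ^+ 2.
Proof.
have := rem_part (enum 'I_m) x v.
by rewrite rowpart_enum big_enum/= size_enum_ord.
Qed.

(** The quadratic remainder, divided by the step, tends to 0; this turns partial derivatives into a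
    derivative in an arbitrary direction. *)
Lemma is_derive_along_line x v (e0 : R) :
  is_derive e0 1 (fun e : R => g (x + e *: v))
    (\sum_k v 0 k * partial k g (x + e0 *: v)).
Proof.
suff H : forall y, (h^-1 *: (g (y + h *: v) - g y)) @[h --> (0:R)^'] -->
    (\sum_k v 0 k * partial k g y).
  apply/is_derive_line; have := H (x + e0 *: v) => {}H.
  have E : (fun h : R => h^-1 *: ((g \o shift (x + e0 *: v)) (h *: v) - g (x + e0 *: v)))
     = (fun h : R => h^-1 *: (g (x + e0 *: v + h *: v) - g (x + e0 *: v))).
    by apply/funext => h /=; rewrite (addrC (h *: v)).
  split; first by rewrite /derivable E; apply/cvg_ex; eexists; exact: H.
  by rewrite /derive E; exact/cvg_lim.
move=> y; apply/cvgrPdist_le => /= eps eps0.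
pose C := m%:R ^+ 2 * `|L| * `|v| ^+ 2 + 1.
have C0 : 0 < C by rewrite ltr_wpDl// !mulr_ge0// ?exprn_ge0.
near=> h.
have h0 : h != 0 by near: h; exact: nbhs_dnbhs_neq.
rewrite distrC.
rewrite (_ : _ - _ = h^-1 * (g (y + h *: v) - g y -
   \sum_k (h *: v) 0 k * partial k g y)); last first.
  rewrite [_ *: _]mulrC mulrBr [h^-1 * (_ - _)]mulrC; congr (_ - _).
  rewrite mulr_sumr; apply: eq_bigr => k _.
  by rewrite mxE mulrA mulrA mulVf// mul1r.
rewrite normrM normfV mulrC ler_pdivrMr ?normr_gt0//.
rewrite (le_trans (quadratic_remainder _ _))//.
rewrite normrZ exprMn.
rewrite (@le_trans _ _ (C * `|h| ^+ 2))//.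
  rewrite [leLHS]mulrCA [leRHS]mulrC ler_wpM2l ?exprn_ge0// /C.
  rewrite -[leLHS]addr0 lerD// ler_wpM2r ?exprn_ge0//.
  by rewrite ler_wpM2l ?exprn_ge0// ler_norm.
rewrite expr2 mulrA ler_wpM2r// -ler_pdivlMl// mulrC.
near: h; apply: dnbhs0_le; rewrite divr_gt0//.
Unshelve. all: by end_near. Qed.

End quadratic_remainder.
End line_derivative.

(** * The standard Gaussian measure *)

Section lebesgue_affine.
Context {R : realType}.
Local Notation mu := (@lebesgue_measure R).
Variables (a b : R).
Hypothesis a0 : a != 0.

Let aff (x : R) : R := a * x + b.

Let maff : measurable_fun [set: R] aff.
Proof. by apply: measurable_funD => //; exact: measurable_funM. Qed.

Let aff_ocitv l r : mu (aff @^-1` `]l, r]) = (`|a|^-1%:E * mu `]l, r])%E.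
Proof.
rewrite lebesgue_measure_itv/= lte_fin.
have [ap|an|ae] := ltrgtP 0 a; last by move: a0; rewrite -ae eqxx.
- rewrite (_ : aff @^-1` _ = `](l - b) / a, (r - b) / a]%classic); last first.
    apply/seteqP; split => x /=; rewrite !in_itv/= /aff.
      by rewrite ltr_pdivrMr// ler_pdivlMr// ltrBlDr lerBrDr (mulrC x).
    by rewrite ltr_pdivrMr// ler_pdivlMr// ltrBlDr lerBrDr (mulrC x).
  rewrite lebesgue_measure_itv/= lte_fin ltr_pM2r ?invr_gt0// ltrD2r.
  case: ifPn => lr; last by rewrite mule0.
  by rewrite -!EFinB -EFinM gtr0_norm//; congr (_%:E); field.
- rewrite (_ : aff @^-1` _ = `[(r - b) / a, (l - b) / a[%classic); last first.
    apply/seteqP; split => x /=; rewrite !in_itv/= /aff.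
      by rewrite ltr_ndivlMr// ler_ndivrMr// ltrBlDr lerBrDr (mulrC x) andbC.
    by rewrite ltr_ndivlMr// ler_ndivrMr// ltrBlDr lerBrDr (mulrC x) andbC.
  rewrite lebesgue_measure_itv/= lte_fin ltr_nM2r ?invr_lt0// ltrD2r.
  case: ifPn => lr; last by rewrite mule0.
  by rewrite -!EFinB -EFinM ltr0_norm//; congr (_%:E); field.
Qed.

Let maff' : measurable_fun [set: measurableTypeR R]
  (aff : measurableTypeR R -> measurableTypeR R).
Proof. exact: maff. Qed.

Let affm : {measure set (measurableTypeR R) -> \bar R} :=
  measure_function_pushforward__canonical__measure_function_Measure mu maff'.

Let aff_measure A : measurable A ->
  mu A = mscale (NngNum (normr_ge0 a)) affm A.
Proof.
apply: lebesgue_measure_unique => X [[l r] /= _ <-].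
rewrite /mscale/= /pushforward aff_ocitv muleA -EFinM.
by rewrite divff ?normr_eq0// mul1e.
Qed.

(** The image of Lebesgue measure under the affine map, multiplied by [|a|], agrees with Lebesgue
    measure on half-open intervals, which determine it. *)
Lemma ge0_integral_affine (g : R -> \bar R) : measurable_fun setT g ->
  (forall x, 0 <= g x)%E ->
  (\int[mu]_x g x = `|a|%:E * \int[mu]_x g (a * x + b)%R)%E.
Proof.
move=> mg g0.
rewrite (eq_measure_integral (mscale (NngNum (normr_ge0 a)) affm)); last first.
  by move=> A mA _; exact: aff_measure.
by rewrite ge0_integral_mscale//= ge0_integral_pushforward.
Qed.

End lebesgue_affine.

Section gaussian_density.
Context {R : realType}.
Local Notation mu := (@lebesgue_measure R).

(** The Radon-Nikodym derivative of the normal law and the normal density have the same integral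
    over every measurable set, hence agree almost everywhere. *)
Lemma ge0_integral_normal_prob (m s : R) (g : R -> \bar R) :
  measurable_fun setT g -> (forall x, 0 <= g x)%E ->
  (\int[normal_prob m s]_x g x = \int[mu]_x (g x * (normal_pdf m s x)%:E))%E.
Proof.
move=> mg g0.
have dom := normal_prob_dominates m s.
rewrite -(Radon_Nikodym_SigmaFinite.change_of_variables dom)//=.
apply: ae_eq_integral => //.
- apply: emeasurable_funM => //; apply: (measurable_int mu).
  exact: Radon_Nikodym_SigmaFinite.f_integrable.
- apply: emeasurable_funM => //; apply/measurable_EFinP.
  exact: measurable_normal_pdf.
- apply: ae_eqe_mul2l => /=.
  apply: integral_ae_eq => //=.
  + exact: Radon_Nikodym_SigmaFinite.f_integrable.
  + by apply/measurable_EFinP; exact: measurable_normal_pdf.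
  + by move=> E _ mE; rewrite -Radon_Nikodym_SigmaFinite.f_integral.
Qed.

Definition gauss_pdf (x : R) : R := normal_peak 1 * expR (- x ^+ 2 / 2).

Definition gauss : probability (measurableTypeR R) R := normal_prob (0 : R) 1.
Arguments gauss : simpl never.

Lemma gauss_pdfE : normal_pdf 0 1 = gauss_pdf.
Proof.
rewrite normal_pdfE ?oner_neq0//; apply/funext => x.
by rewrite /normal_fun subr0 expr1n.
Qed.

Lemma gauss_pdf_gt0 x : 0 < gauss_pdf x.
Proof. by rewrite mulr_gt0 ?expR_gt0// normal_peak_gt0// oner_neq0. Qed.

Lemma gauss_pdf_ge0 x : 0 <= gauss_pdf x. Proof. exact/ltW/gauss_pdf_gt0. Qed.

Lemma measurable_gauss_pdf : measurable_fun setT gauss_pdf.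
Proof. by rewrite -gauss_pdfE; exact: measurable_normal_pdf. Qed.

Lemma ge0_integral_gauss (g : R -> \bar R) :
  measurable_fun setT g -> (forall x, 0 <= g x)%E ->
  (\int[gauss]_x g x = \int[mu]_x (g x * (gauss_pdf x)%:E))%E.
Proof. by move=> mg g0; rewrite -gauss_pdfE -ge0_integral_normal_prob. Qed.

Lemma integral_gauss (f : R -> R) : measurable_fun setT f ->
  (\int[gauss]_x (f x)%:E = \int[mu]_x (f x * gauss_pdf x)%:E)%E.
Proof.
move=> mf; rewrite integralE [RHS]integralE.
rewrite ge0_integral_gauss//; last first.
  by apply: measurable_funepos; exact/measurable_EFinP.
rewrite ge0_integral_gauss//; last first.
  by apply: measurable_funeneg; exact/measurable_EFinP.
congr (_ - _)%E; apply: eq_integral => x _.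
  by rewrite !funeposE -!EFin_max -EFinM maxr_pMl ?gauss_pdf_ge0// mul0r.
by rewrite !funenegE -!EFin_max -EFinM maxr_pMl ?gauss_pdf_ge0// mul0r mulNr.
Qed.

Lemma integrable_gauss (f : R -> R) : measurable_fun setT f ->
  gauss.-integrable setT (EFin \o f) <->
  mu.-integrable setT (EFin \o (fun x => f x * gauss_pdf x)).
Proof.
move=> mf; split => /integrableP[_ fi]; apply/integrableP; split => //.
- apply/measurable_EFinP; apply: measurable_funM => //; exact: measurable_gauss_pdf.
- move: fi; rewrite ge0_integral_gauss//; last first.
    by apply: measurableT_comp => //; exact/measurable_EFinP.
  congr (_ < _)%E; apply: eq_integral => x _ /=.
  by rewrite -EFinM normrM (ger0_norm (gauss_pdf_ge0 x)).
- exact/measurable_EFinP.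
- rewrite ge0_integral_gauss//; last first.
    by apply: measurableT_comp => //; exact/measurable_EFinP.
  move: fi; congr (_ < _)%E; apply: eq_integral => x _ /=.
  by rewrite -EFinM normrM (ger0_norm (gauss_pdf_ge0 x)).
Qed.

Lemma Rintegral_gauss (f : R -> R) : measurable_fun setT f ->
  \int[gauss]_x f x = \int[mu]_x (f x * gauss_pdf x).
Proof. by move=> mf; rewrite /Rintegral integral_gauss. Qed.

End gaussian_density.

(** * Differentiation under the integral sign *)

Lemma is_derive_under_integral {R : realType} (dsp : measure_display)
    (Y : measurableType dsp) (mu : {measure set Y -> \bar R})
    (f f' : R -> Y -> R) (a r : R) (G : Y -> R) : 0 < r ->
  (forall x, `|x - a| < r -> mu.-integrable setT (EFin \o f x)) ->
  (forall x y, `|x - a| < r -> is_derive x 1 (f ^~ y) (f' x y)) ->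
  mu.-integrable setT (EFin \o G) ->
  (forall x y, `|x - a| < r -> `|f' x y| <= G y) ->
  is_derive a 1 (fun x => \int[mu]_y f x y) (\int[mu]_y f' a y).
Proof.
move=> r0 fi fd Gi fG.
have aI : `]a - r, a + r[%classic a by rewrite /= in_itv/= ltrBlDr ltrDl r0.
have inI x : `]a - r, a + r[%classic x -> `|x - a| < r.
  by rewrite /= in_itv/= => /andP[h1 h2]; rewrite ltr_norml; apply/andP; split; lra.
have G0 y : 0 <= G y.
  by rewrite (le_trans (normr_ge0 (f' a y)))// fG// subrr normr0.
have H1 x : `]a - r, a + r[%classic x -> mu.-integrable setT (EFin \o f x).
  by move=> /inI; exact: fi.
have H2 x y : `]a - r, a + r[%classic x -> setT y -> derivable (f ^~ y) x 1.
  by move=> /inI xr _; exact: (@ex_derive _ _ _ _ _ _ _ (fd x y xr)).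
have E x y : `]a - r, a + r[%classic x -> partial1of2 f x y = f' x y.
  move=> /inI xr; rewrite partial1of2E.
  exact: (@derive_val _ _ _ _ _ _ _ (fd x y xr)).
have H3 x y : `]a - r, a + r[%classic x -> setT y -> `|partial1of2 f x y| <= G y.
  by move=> xr _; rewrite E//; apply: fG; exact: inI.
apply: DeriveDef.
  exact: (derivable_under_integral measurableT aI H1 H2 G0 Gi H3).
rewrite -derive1E (differentiation_under_integral measurableT aI H1 H2 G0 Gi H3).
by apply: eq_Rintegral => y _; exact: E.
Qed.

Section is_derive_pointwise.
Context {R : realType}.
Implicit Types (f g : R -> R) (x : R).

Lemma is_derive1M f g x df dg : is_derive x 1 f df -> is_derive x 1 g dg ->
  is_derive x 1 (fun y => f y * g y) (f x * dg + g x * df).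
Proof. exact: is_deriveM. Qed.

Lemma is_derive1Z k f x df : is_derive x 1 f df ->
  is_derive x 1 (fun y => k * f y) (k * df).
Proof. exact: is_deriveZ. Qed.

Lemma is_derive1_affine (a b x : R) : is_derive x 1 (fun y => a * y + b) a.
Proof.
apply: (@is_derive_eq _ _ _ _ _ _ _ (a * 1 + 0)); last by rewrite mulr1 addr0.
Qed.

Lemma is_derive1_eq f g x df : is_derive x 1 f df -> f =1 g -> is_derive x 1 g df.
Proof. by move=> fdf /funext <-. Qed.

End is_derive_pointwise.

Section lebesgue_translation.
Context {R : realType}.
Local Notation mu := (@lebesgue_measure R).

Lemma Rintegral_isometry (g : R -> R) (a b : R) : `|a| = 1 ->
  measurable_fun setT g -> \int[mu]_x g (a * x + b) = \int[mu]_x g x.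
Proof.
move=> a1 mg; rewrite /Rintegral; congr fine.
have a0 : a != 0 by rewrite -normr_eq0 a1 oner_neq0.
rewrite integralE [RHS]integralE; congr (_ - _)%E.
  rewrite (ge0_integral_affine b a0 (g := (fun x => (g x)%:E)^\+%E))//; last first.
    by apply: measurable_funepos; exact/measurable_EFinP.
  by rewrite a1 mul1e; apply: eq_integral => x _; rewrite !funeposE.
rewrite (ge0_integral_affine b a0 (g := (fun x => (g x)%:E)^\-%E))//; last first.
  by apply: measurable_funeneg; exact/measurable_EFinP.
by rewrite a1 mul1e; apply: eq_integral => x _; rewrite !funenegE.
Qed.

Lemma Rintegral_translation (g : R -> R) (b : R) : measurable_fun setT g ->
  \int[mu]_x g (x + b) = \int[mu]_x g x.
Proof.
move=> mg; rewrite -(@Rintegral_isometry g 1 b)// ?normr1//.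
by apply: eq_Rintegral => x _; rewrite mul1r.
Qed.

End lebesgue_translation.

(** * Gaussian envelopes *)

Section gauss_bounds.
Context {R : realType}.
Local Notation mu := (@lebesgue_measure R).
Implicit Types v y a : R.

(** A common bound for the density and its first two derivatives, with room for every polynomial
    factor of degree at most 4. *)
Definition gauss_env (v : R) : R := (1 + v ^+ 2) ^+ 2 * gauss_pdf v.

(** The constants come from [1 + v^2 <= (16/3) (1 + 3 v^2 / 16) <= (16/3) exp(3 v^2 / 16)]. Squaring
    spends 3/8 of the exponent 1/2 and leaves 1/8. *)
Lemma gauss_env_le v :
  gauss_env v <= normal_peak 1 * (16 / 3) ^+ 2 * expR (- v ^+ 2 / 8).
Proof.
rewrite /gauss_env /gauss_pdf mulrCA -[leRHS]mulrA ler_wpM2l ?normal_peak_ge0//.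
rewrite (_ : - v ^+ 2 / 2 = 2%:R * - (3 / 16 * v ^+ 2) + - v ^+ 2 / 8); last first.
  by field.
rewrite expRD mulrA ler_wpM2r ?expR_ge0//.
rewrite expRM_natl -exprMn lerXn2r ?nnegrE//.
- by rewrite mulr_ge0 ?expR_ge0// addr_ge0// sqr_ge0.
rewrite expRN ler_pdivrMr ?expR_gt0//.
rewrite (@le_trans _ _ (16 / 3 * (1 + 3 / 16 * v ^+ 2)))//.
  by have := sqr_ge0 v; move: (v ^+ 2) => w; lra.
by rewrite ler_wpM2l// expR_ge1Dx.
Qed.

Lemma integrable_expR_sqr (a c : R) : 0 < c ->
  mu.-integrable setT (EFin \o (fun y : R => expR (- (y - a) ^+ 2 / c))).
Proof.
move=> c0.
have s0 : Num.sqrt (c / 2) != 0 by rewrite gt_eqF// sqrtr_gt0 divr_gt0.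
have /(integrableZl (measurableT) (normal_peak (Num.sqrt (c / 2)))^-1) :=
  integrable_normal_pdf a (Num.sqrt (c / 2)).
apply: eq_integrable => // y _ /=.
rewrite normal_pdfE// -EFinM mulrA mulVf ?mul1r; last first.
  by rewrite gt_eqF// normal_peak_gt0.
by rewrite /normal_fun sqr_sqrtr ?divr_ge0 ?ltW// -mulr_natr divfK.
Qed.

Lemma integrable_gauss_env a : mu.-integrable setT (EFin \o (fun y : R => gauss_env (y - a))).
Proof.
have := integrable_expR_sqr a (ltr0n R 8).
move=> /(integrableZl (measurableT) (normal_peak 1 * (16 / 3) ^+ 2)).
apply: le_integrable => //.
  apply/measurable_EFinP; apply: measurable_funM.
    apply: measurable_funX; apply: measurable_funD => //.
    by apply: measurable_funX; exact: measurable_funB.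
  apply: measurableT_comp; first exact: measurable_gauss_pdf.
  exact: measurable_funB.
move=> y _ /=; rewrite -?EFinM lee_fin ger0_norm; last first.
  by rewrite mulr_ge0 ?gauss_pdf_ge0// exprn_ge0// addr_ge0// sqr_ge0.
by rewrite (le_trans (gauss_env_le _))// ler_norm.
Qed.

(** One dominating function serves all centres [x] within 1 of [a], since
    [(y - a)^2 <= 2 (y - x)^2 + 2 (x - a)^2]; the last term accounts for [exp(1/8)]. *)
Lemma gauss_env_window a y x : `|x - a| < 1 ->
  gauss_env (y - x) <=
    normal_peak 1 * (16 / 3) ^+ 2 * expR 8^-1 * expR (- (y - a) ^+ 2 / 16).
Proof.
move=> xa; rewrite (le_trans (gauss_env_le _))//.
rewrite -[leRHS]mulrA ler_wpM2l ?mulr_ge0 ?normal_peak_ge0 ?exprn_ge0//.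
rewrite -expRD ler_expR.
have : (x - a) ^+ 2 <= 1.
  by rewrite -real_normK ?num_real// expr_le1// ltW.
have : 0 <= ((y - x) - (x - a)) ^+ 2 by exact: sqr_ge0.
by rewrite !expr2; nra.
Qed.

Lemma integrable_gauss_poly (f : R -> R) (C : R) : measurable_fun setT f ->
  (forall v, `|f v| <= C * (1 + v ^+ 2) ^+ 2) ->
  gauss.-integrable setT (EFin \o f).
Proof.
move=> mf fC; apply/integrable_gauss => //.
have := integrable_gauss_env 0 => /(integrableZl (measurableT) C).
apply: le_integrable => //.
  apply/measurable_EFinP; apply: measurable_funM => //; exact: measurable_gauss_pdf.
move=> y _ /=; rewrite -?EFinM lee_fin subr0 (le_trans _ (ler_norm _))//.
rewrite normrM [`|gauss_pdf y|]ger0_norm ?gauss_pdf_ge0// /gauss_env [leRHS]mulrA.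
by rewrite ler_wpM2r ?gauss_pdf_ge0.
Qed.

End gauss_bounds.

Lemma is_derive_gauss_pdf {R : realType} (v : R) :
  is_derive v 1 (@gauss_pdf R) (- (v * gauss_pdf v)).
Proof.
have d1 : is_derive v 1 (fun v : R => - v ^+ 2 / 2) (- v).
  apply: (@is_derive1_eq _ (fun v => - 2^-1 * (v * v))); last first.
    by move=> w; rewrite expr2; field.
  apply: (@is_derive_eq _ _ _ _ _ _ _ (- 2^-1 * (v * 1 + v * 1))); last by field.
apply: (@is_derive_eq _ _ _ _ _ _ _ (normal_peak 1 * (expR (- v ^+ 2 / 2) * - v))).
rewrite /gauss_pdf; ring.
Qed.

(** * Smoothing by the Gaussian kernel *)

Section gauss_smoothing.
Context {R : realType}.
Local Notation mu := (@lebesgue_measure R).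
Variables (H : R -> R) (M : R).
Hypothesis mH : measurable_fun setT H.
Hypothesis HM : forall y, `|H y| <= M.

Let M0 : 0 <= M. Proof. exact: le_trans (HM 0). Qed.

(** The parameter sits in the kernel and not in [H], so a bounded measurable [H] suffices for
    differentiability. *)
Let smoothing_kernel (q q' : R -> R) (a : R) :
  measurable_fun setT q ->
  (forall v : R, is_derive v 1 q (q' v)) ->
  (forall v, `|q v| <= gauss_env v) -> (forall v, `|q' v| <= gauss_env v) ->
  is_derive a 1 (fun a => \int[mu]_y (H y * q (y - a)))
    (\int[mu]_y (H y * - q' (y - a))).
Proof.
move=> mq dq qe qe'.
have mqa (b : R) : measurable_fun setT (fun y : R => q (y - b)).
  by apply: measurableT_comp => //; exact: measurable_funB.
apply: (@is_derive_under_integral _ _ _ mu (fun a y => H y * q (y - a))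
   (fun a y => H y * - q' (y - a)) a 1
   (fun y => M * (normal_peak 1 * (16 / 3) ^+ 2 * expR 8^-1 * expR (- (y - a) ^+ 2 / 16)))) => //.
- move=> x xa.
  have := integrable_gauss_env x => /(integrableZl (measurableT) M).
  apply: le_integrable => //.
    by apply/measurable_EFinP; apply: measurable_funM => //; exact: mqa.
  move=> y _ /=; rewrite -?EFinM lee_fin normrM.
  by rewrite (le_trans _ (ler_norm _))// ler_pM.
- move=> x y xa.
  apply: is_derive1Z.
  have d1 : is_derive x 1 (fun a : R => -1 * a + y) (-1) by exact: is_derive1_affine.
  rewrite -mulrN1; apply: (@is_derive1_eq _ (q \o (fun a : R => -1 * a + y))).
    by apply: is_derive1_comp; rewrite mulN1r addrC; exact: dq.
  by move=> b /=; rewrite mulN1r addrC.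
- have := integrable_expR_sqr a (ltr0n R 16).
  move=> /(integrableZl (measurableT) (M * (normal_peak 1 * (16 / 3) ^+ 2 * expR 8^-1))).
  by apply: eq_integrable => // y _ /=; rewrite -?EFinM !mulrA.
- move=> x y xa; rewrite normrM normrN ler_pM//.
  by rewrite (le_trans (qe' _))// gauss_env_window.
Qed.

Let shift_kernel (q : R -> R) a : measurable_fun setT q ->
  \int[mu]_y (H y * (q (y - a) * gauss_pdf (y - a))) = \int[gauss]_z (H (a + z) * q z).
Proof.
move=> mq; rewrite Rintegral_gauss; last first.
  apply: measurable_funM => //; apply: measurableT_comp => //.
  exact: measurable_funD.
rewrite -[RHS](Rintegral_translation (- a))//.
  by apply: eq_Rintegral => y _; rewrite (addrC a) subrK mulrA.
apply: measurable_funM; last exact: measurable_gauss_pdf.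
by apply: measurable_funM => //; apply: measurableT_comp => //; exact: measurable_funD.
Qed.

Lemma is_derive_smoothing0 (a : R) :
  is_derive a 1 (fun a => \int[gauss]_z H (a + z)) (\int[gauss]_z (H (a + z) * z)).
Proof.
have := @smoothing_kernel gauss_pdf (fun v => - (v * gauss_pdf v)) a
  measurable_gauss_pdf (@is_derive_gauss_pdf R) _ _.
have sq v : 1 <= (1 + v ^+ 2) ^+ 2 :> R.
  by have := sqr_ge0 v; move: (v ^+ 2) => w; rewrite expr2; nra.
move=> /(_ _ _)/wrap[].
- move=> v; rewrite ger0_norm ?gauss_pdf_ge0//.
  by rewrite ler_peMl ?gauss_pdf_ge0.
- move=> v; rewrite normrN normrM (ger0_norm (gauss_pdf_ge0 v)).
  rewrite ler_wpM2r ?gauss_pdf_ge0//.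
  have := sqr_ge0 v; rewrite -(real_normK (num_real v)).
  move: (normr_ge0 v); move: `|v| => w; rewrite !expr2; nra.
move=> D.
have E (b : R) : \int[mu]_y (H y * gauss_pdf (y - b)) = \int[gauss]_z H (b + z).
  transitivity (\int[gauss]_z (H (b + z) * 1)).
    rewrite -(@shift_kernel (cst 1) b)//.
    by apply: eq_Rintegral => y _; rewrite mul1r.
  by apply: eq_Rintegral => y _; rewrite mulr1.
apply: (@is_derive1_eq _ (fun a => \int[mu]_y (H y * gauss_pdf (y - a)))) => //.
apply: (is_derive_eq D); rewrite -(@shift_kernel id a)//.
by apply: eq_Rintegral => y _; rewrite opprK.
Qed.

Lemma is_derive_smoothing1 (a : R) :
  is_derive a 1 (fun a => \int[gauss]_z (H (a + z) * z))
    (\int[gauss]_z (H (a + z) * (z ^+ 2 - 1))).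
Proof.
have dq (v : R) : is_derive v 1 (fun v : R => v * gauss_pdf v)
    (- ((v ^+ 2 - 1) * gauss_pdf v)).
  apply: (@is_derive_eq _ _ _ _ _ _ _ (v * (- (v * gauss_pdf v)) + gauss_pdf v * 1)).
    by apply: is_derive1M => //; exact: is_derive_gauss_pdf.
  by move: (gauss_pdf v) => p; ring.
have mq : measurable_fun setT (fun v : R => v * gauss_pdf v).
  by apply: measurable_funM => //; exact: measurable_gauss_pdf.
have := @smoothing_kernel (fun v => v * gauss_pdf v) _ a mq dq _ _.
move=> /(_ _ _)/wrap[].
- move=> v; rewrite normrM (ger0_norm (gauss_pdf_ge0 v)).
  rewrite ler_wpM2r ?gauss_pdf_ge0//.
  have := sqr_ge0 v; rewrite -(real_normK (num_real v)).
  move: (normr_ge0 v); move: `|v| => w; rewrite !expr2; nra.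
- move=> v; rewrite normrN normrM (ger0_norm (gauss_pdf_ge0 v)).
  rewrite ler_wpM2r ?gauss_pdf_ge0// (le_trans (ler_normB _ _))// normr1.
  rewrite ger0_norm ?sqr_ge0//.
  by have := sqr_ge0 v; move: (v ^+ 2) => w; rewrite !expr2; nra.
move=> D.
apply: (@is_derive1_eq _ (fun a => \int[mu]_y (H y * ((y - a) * gauss_pdf (y - a))))).
  apply: (is_derive_eq D); rewrite -(@shift_kernel (fun z => z ^+ 2 - 1) a)//.
    by apply: eq_Rintegral => y _; rewrite opprK.
  by apply: measurable_funB => //; exact: measurable_funX.
by move=> b; rewrite -(@shift_kernel id b).
Qed.

End gauss_smoothing.

(** * The fundamental theorem of calculus on the half-line *)

Section half_line_FTC.
Context {R : realType}.
Local Notation mu := (@lebesgue_measure R).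
Variables (F F' : R -> R).
Hypothesis dF : forall y : R, 0 < y -> is_derive y 1 F (F' y).
Hypothesis cF' : forall y : R, 0 < y -> {for y, continuous F'}.

Lemma FTC_pos (a b : R) : 0 < a -> a < b ->
  (\int[mu]_(x in `[a, b]) (F' x)%:E = (F b - F a)%:E)%E.
Proof.
move=> a0 ab; rewrite (@continuous_FTC2 _ _ F)//.
- apply: continuous_in_subspaceT => x; rewrite inE/= in_itv/= => /andP[ax _].
  exact/cF'/(lt_le_trans a0).
- split.
  + move=> x; rewrite in_itv/= => /andP[ax _].
    exact: (@ex_derive _ _ _ _ _ _ _ (dF (lt_trans a0 ax))).
  + apply: cvg_at_right_filter; apply: differentiable_continuous.
    exact/derivable1_diffP/(@ex_derive _ _ _ _ _ _ _ (dF a0)).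
  + apply: cvg_at_left_filter; apply: differentiable_continuous.
    exact/derivable1_diffP/(@ex_derive _ _ _ _ _ _ _ (dF (lt_trans a0 ab))).
- move=> x; rewrite in_itv/= => /andP[ax _]; rewrite derive1E.
  exact: (@derive_val _ _ _ _ _ _ _ (dF (lt_trans a0 ax))).
Qed.

(** The offset 2 keeps the lower end below the upper one already for [m = 0]. *)
Let seg (m : nat) : set R := `[m.+2%:R^-1, m.+2%:R]%classic.

Let invn_lt m : m.+2%:R^-1 < m.+2%:R :> R.
Proof. by rewrite (@lt_trans _ _ 1)// ?ltr1n// invf_lt1// ltr1n. Qed.

Let mF' : measurable_fun (`]0%R, +oo[%classic : set R) F'.
Proof.
apply: open_continuous_measurable_fun => // x; rewrite inE/= in_itv/= andbT => x0.
exact: cF'.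
Qed.

(** Over each segment the integral is a difference of two values of [F], both tending to 0;
    integrability lets dominated convergence pass to the half-line. *)
Lemma integral_pos_eq0 :
  F m.+2%:R @[m --> \oo] --> 0 -> F m.+2%:R^-1 @[m --> \oo] --> 0 ->
  mu.-integrable (`]0%R, +oo[%classic : set R) (EFin \o F') ->
  (\int[mu]_(x in `]0%R, +oo[) (F' x)%:E = 0)%E.
Proof.
move=> Fy F0 iF'.
have mEF' : measurable_fun (`]0%R, +oo[%classic : set R) (EFin \o F').
  exact/measurable_EFinP.
have segE m : (\int[mu]_(x in `]0%R, +oo[) ((EFin \o F') \_ (seg m)) x =
    (F m.+2%:R - F m.+2%:R^-1)%:E)%E.
  rewrite -integral_mkcondr setIidr; last first.
    move=> x; rewrite /seg /= !in_itv/= andbT => /andP[+ _].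
    by apply: lt_le_trans; rewrite invr_gt0.
  by rewrite FTC_pos// invr_gt0.
have : (\int[mu]_(x in `]0%R, +oo[) ((EFin \o F') \_ (seg m)) x @[m --> \oo] -->
   \int[mu]_(x in `]0%R, +oo[) (F' x)%:E)%E.
  apply: (@dominated_cvg _ _ _ mu _ _ _ _ (abse \o (EFin \o F'))) => //.
  - move=> m; apply/measurable_restrict => //.
      exact: measurable_itv.
    exact: (measurable_funS (measurable_itv _) (@subIsetl _ _ _) mEF').
  - move=> x /=; rewrite in_itv/= andbT => x0.
    apply: cvg_near_cst; near=> m; rewrite patchE ifT//.
    have mm : m%:R <= m.+2%:R :> R by rewrite ler_nat !leqW.
    rewrite inE /seg/= in_itv/=; apply/andP; split.
      rewrite invf_ple ?posrE//; apply: le_trans mm.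
      by near: m; exact: nbhs_infty_ger.
    apply: le_trans mm.
    by near: m; exact: nbhs_infty_ger.
  - exact: integrable_abse.
  - move=> m x _ /=; rewrite patchE; case: ifP => //= _.
    by rewrite ?normr0 ?abse0 ?lee_fin.
under eq_cvg do rewrite segE.
move=> /cvg_unique; apply => //; apply: cvg_EFin; first exact: nearW.
by rewrite /comp/= -[X in _ --> X](subrr 0); exact: cvgB.
Unshelve. all: by end_near. Qed.

End half_line_FTC.

Lemma negligible_eq_Rintegral {R : realType} (dsp : measure_display)
    (T : measurableType dsp) (mu : {measure set T -> \bar R}) (N : set T)
    (f g : T -> R) :
  measurable_fun setT f -> measurable_fun setT g -> mu.-negligible N ->
  (forall x, ~ N x -> f x = g x) -> \int[mu]_x f x = \int[mu]_x g x.
Proof.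
move=> mf mg N0 fg; rewrite /Rintegral; congr fine.
apply: ae_eq_integral => //; [exact/measurable_EFinP|exact/measurable_EFinP|].
apply: negligibleS N0 => x /=; apply: contra_notP => Nx _.
by rewrite /= fg.
Qed.

Section even_integral.
Context {R : realType}.
Local Notation mu := (@lebesgue_measure R).
Let pos : set R := `]0, +oo[%classic.

Lemma Rintegral_even (g : R -> R) : measurable_fun setT (fun y : R => g `|y|) ->
  mu.-integrable setT (EFin \o (fun y : R => g `|y|)) ->
  \int[mu]_y g `|y| = 2 * \int[mu]_(y in pos) g y.
Proof.
move=> mg ig.
have mpos : measurable pos by exact: measurable_itv.
have gE : {in pos, (fun y : R => g `|y|) =1 g}.
  by move=> y; rewrite inE /pos/= in_itv/= andbT => y0; rewrite gtr0_norm.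
(* At 0 both restrictions vanish while [g 0] may not, so the identity is claimed off a null set. *)
have indE (y : R) : y != 0 -> g `|y| = ((fun y : R => g `|y|) \_ pos) y
                       + ((fun y : R => g `|y|) \_ pos) (-1 * y + 0).
  move=> y0; rewrite !patchE.
  rewrite mulN1r addr0 normrN.
  have [yn|yp|ye] := ltrgtP y 0; last by rewrite ye eqxx in y0.
  - rewrite ifF; last by apply/negbTE; rewrite notin_setE /pos/= in_itv/= ltNge ltW.
    by rewrite add0r ifT// inE /pos/= in_itv/= oppr_gt0 yn.
  - rewrite ifT; last by rewrite inE /pos/= in_itv/= yp.
    rewrite ifF ?addr0//.
    by apply/negbTE; rewrite notin_setE /pos/= in_itv/= oppr_gt0 ltNge ltW.
have mr : measurable_fun setT ((fun y : R => g `|y|) \_ pos).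
  by apply/(measurable_restrictT _ mpos); exact: measurable_funTS.
have ir : mu.-integrable setT (EFin \o ((fun y : R => g `|y|) \_ pos)).
  rewrite -restrict_EFin; apply/integrable_restrict => //.
  by rewrite setTI; apply: integrableS ig.
have ir' : mu.-integrable setT (EFin \o (fun y : R => ((fun y : R => g `|y|) \_ pos) (-1 * y + 0))).
  apply/integrableP; split.
    apply/measurable_EFinP; apply: measurableT_comp => //.
    by apply: measurable_funD => //; exact: measurable_funM.
  have /integrableP[_] := ir.
  rewrite (@ge0_integral_affine _ (-1) 0 _ (abse \o (EFin \o ((fun y : R => g `|y|) \_ pos))))//.
  - by rewrite normrN normr1 mul1e.
  - by apply: measurableT_comp => //; exact/measurable_EFinP.
  - by move=> x /=.
transitivity (\int[mu]_y (((fun y : R => g `|y|) \_ pos) y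
                       + ((fun y : R => g `|y|) \_ pos) (-1 * y + 0))).
  apply: (@negligible_eq_Rintegral _ _ _ mu [set 0]) => //.
  - by apply: measurable_funD => //; have /integrableP[/measurable_EFinP] := ir'.
  - by apply/negligibleP; [exact: measurable_set1|exact: lebesgue_measure_set1].
  - by move=> y /eqP; exact: indE.
rewrite RintegralD// (@Rintegral_isometry _ _ (-1) 0) ?normrN ?normr1//.
rewrite -Rintegral_mkcond.
have -> : \int[mu]_(y in pos) g y = \int[mu]_(y in pos) g `|y|.
  by apply: eq_Rintegral => y yp; rewrite (gE _ yp).
by rewrite mulr_natl mulr2n.
Qed.

End even_integral.

(** * Moments of the standard normal law *)

Section gauss_moments.
Context {R : realType}.
Local Notation mu := (@lebesgue_measure R).

Lemma Rintegral_even_eq0 (F F' : R -> R) :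
  (forall y : R, 0 < y -> is_derive y 1 F (F' y)) ->
  (forall y : R, 0 < y -> {for y, continuous F'}) ->
  F m.+2%:R @[m --> \oo] --> 0 -> F m.+2%:R^-1 @[m --> \oo] --> 0 ->
  mu.-integrable setT (EFin \o (fun y : R => F' `|y|)) ->
  \int[mu]_y F' `|y| = 0.
Proof.
move=> dF cF' Fy F0 iF'.
have mF' : measurable_fun setT (fun y : R => F' `|y|).
  by have /integrableP[/measurable_EFinP] := iF'.
rewrite Rintegral_even// /Rintegral (integral_pos_eq0 dF)// ?mulr0//.
have : mu.-integrable (`]0%R, +oo[%classic : set R) (EFin \o (fun y : R => F' `|y|)).
  by apply: integrableS iF' => //; exact: measurable_itv.
apply: eq_integrable; first exact: measurable_itv.
by move=> y; rewrite inE/= in_itv/= andbT => y0; rewrite gtr0_norm.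
Qed.

Lemma gauss_pdf_norm (y : R) : gauss_pdf `|y| = gauss_pdf y.
Proof. by rewrite /gauss_pdf real_normK// num_real. Qed.

Lemma continuous_gauss_pdf : continuous (@gauss_pdf R).
Proof. by rewrite -gauss_pdfE; apply: continuous_normal_pdf; exact: oner_neq0. Qed.

Lemma gauss_pdf_cvg0 : gauss_pdf x @[x --> +oo] --> (0 : R).
Proof.
rewrite -(mulr0 (normal_peak 1)); apply: cvgM; first exact: cvg_cst.
apply: (squeeze_cvgr _ (cvg_cst 0) (@cvgr_expR R)).
near=> x; rewrite expR_ge0/= ler_expR mulNr lerN2.
rewrite ler_pdivlMr// expr2 ler_wpM2l//.
Unshelve. all: by end_near. Qed.

Lemma sqr_ge_norm (v : R) : `|v| <= (1 + v ^+ 2) ^+ 2.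
Proof.
rewrite -(real_normK (num_real v)); move: (normr_ge0 v); move: `|v| => w.
by rewrite !expr2; nra.
Qed.

Lemma integrable_gauss_norm : gauss.-integrable setT (EFin \o (fun v : R => `|v|)).
Proof.
apply: (@integrable_gauss_poly _ _ 1); first exact: measurableT_comp.
by move=> v; rewrite normr_id mul1r sqr_ge_norm.
Qed.

(** On the half-line [- gauss_pdf] is a primitive of [y * gauss_pdf y], so the value is twice the
    peak of the density. *)
Lemma Rintegral_gauss_norm : \int[@gauss R]_z `|z| = Num.sqrt (2 / pi).
Proof.
rewrite Rintegral_gauss; last exact: normr_measurable.
transitivity (\int[mu]_y ((fun y : R => y * gauss_pdf y) `|y|)).
  by apply: eq_Rintegral => y _ /=; rewrite gauss_pdf_norm.
have ig : mu.-integrable setT (EFin \o (fun y : R => (fun y : R => y * gauss_pdf y) `|y|)).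
  have mn : measurable_fun setT (fun v : R => `|v|) by exact: measurableT_comp.
  have := (integrable_gauss mn).1 integrable_gauss_norm.
  by apply: eq_integrable => // y _ /=; rewrite gauss_pdf_norm.
rewrite (@Rintegral_even _ (fun y : R => y * gauss_pdf y))//; last first.
  by have /integrableP[/measurable_EFinP] := ig.
rewrite Rintegral_itv_obnd_cbnd; last first.
  have : mu.-integrable (`]0%R, +oo[%classic : set R)
      (EFin \o (fun y : R => (fun y : R => y * gauss_pdf y) `|y|)).
    by apply: integrableS ig => //; exact: measurable_itv.
  apply: eq_integrable; first exact: measurable_itv.
  by move=> y; rewrite inE/= in_itv/= andbT => y0; rewrite gtr0_norm.
rewrite (@Rintegral_ge0_continuous_FTC2y _ (fun y => y * gauss_pdf y) (fun y => - gauss_pdf y) 0 0).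
- rewrite /gauss_pdf expr0n oppr0 mul0r expR0 mulr1 opprK add0r.
  rewrite /normal_peak expr1n mul1r -sqrtrV ?(mulrn_wge0 2 (pi_ge0 R))//.
  transitivity (Num.sqrt (2 ^+ 2) * Num.sqrt ((pi *+ 2)^-1) : R).
    by rewrite sqrtr_sqr ger0_norm.
  rewrite -sqrtrM ?sqr_ge0// -(mulr_natr pi).
  have pi0 : pi != 0 :> R by rewrite gt_eqF ?pi_gt0.
  by congr (Num.sqrt _); move: pi pi0 => p p0; field.
- by move=> x x0; rewrite mulr_ge0 ?gauss_pdf_ge0.
- apply: continuous_subspaceT => x; apply: cvgM => //; exact: continuous_gauss_pdf.
- by rewrite -oppr0; apply: cvgN; exact: gauss_pdf_cvg0.
- move=> x _; apply: derivableN.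
  exact: (@ex_derive _ _ _ _ _ _ _ (is_derive_gauss_pdf x)).
- by apply: cvg_at_right_filter; apply: cvgN; exact: continuous_gauss_pdf.
- move=> x _; rewrite derive1E deriveN.
    by rewrite (@derive_val _ _ _ _ _ _ _ (is_derive_gauss_pdf x)) opprK.
  exact: (@ex_derive _ _ _ _ _ _ _ (is_derive_gauss_pdf x)).
Qed.

End gauss_moments.

(** * Negative powers of a normal variable *)

Section gauss_negative_powers.
Context {R : realType}.
Local Notation mu := (@lebesgue_measure R).
Variable p : R.
Hypothesis p1 : -1 < p.

Let q0 : 0 < p + 1. Proof. by rewrite -ltrBlDr sub0r. Qed.

Let powR_seg (m : nat) :
  (\int[mu]_(y in `[(m.+2%:R^-1)%R, 1%R]) (y `^ p)%:E <= (p + 1)^-1%:E)%E.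
Proof.
have dF (y : R) : 0 < y -> is_derive y 1 (fun y => (p + 1)^-1 * y `^ (p + 1)) (y `^ p).
  move=> y0; apply: (@is_derive_eq _ _ _ _ _ _ _
      ((p + 1)^-1 * ((p + 1) * y `^ (p + 1 - 1)))).
    exact/is_derive1Z/is_derive1_powR.
  by rewrite mulrA mulVf ?gt_eqF// mul1r addrK.
rewrite (FTC_pos dF).
- by rewrite lee_fin powR1 mulr1 lerBlDr lerDl mulr_ge0 ?powR_ge0// invr_ge0 ltW.
- move=> y y0; apply: differentiable_continuous; apply/derivable1_diffP.
  exact: (@ex_derive _ _ _ _ _ _ _ (is_derive1_powR p y0)).
- by rewrite invr_gt0.
- by rewrite invf_lt1// ltr1n.
Qed.

Let powR_oc : (\int[mu]_(y in `]0%R, 1%R]) (y `^ p)%:E < +oo)%E.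
Proof.
pose F (m : nat) : set R := `[m.+2%:R^-1, 1]%classic.
have FE : `]0, 1]%classic = \bigcup_m F m :> set R.
  rewrite eqEsubset; split => y.
    rewrite /= in_itv/= => /andP[y0 y1].
    near \oo => m; exists m => //; rewrite /F/= in_itv/= y1 andbT.
    rewrite invf_ple ?posrE//.
    have mm : m%:R <= m.+2%:R :> R by rewrite ler_nat !leqW.
    by apply: le_trans mm; near: m; exact: nbhs_infty_ger.
  move=> [m _]; rewrite /F/= !in_itv/= => /andP[my ->]; rewrite andbT.
  by apply: lt_le_trans my; rewrite invr_gt0.
have mp (D : set R) : measurable_fun D (fun y : R => (y `^ p)%:E).
  by apply/measurable_EFinP/measurable_funTS; exact: measurable_powR.
rewrite FE (@le_lt_trans _ _ (p + 1)^-1%:E) ?ltry//.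
have ndF : nondecreasing_seq F.
  move=> m n mn; apply/subsetPset => y; rewrite /F/= !in_itv/= => /andP[my ->].
  rewrite andbT; apply: le_trans my.
  by rewrite lef_pV2 ?posrE// ler_nat.
have cv : (\int[mu]_(x in F i) (x `^ p)%:E @[i --> \oo] -->
    \int[mu]_(x in \bigcup_i F i) (x `^ p)%:E)%E.
  apply: ge0_nondecreasing_set_cvg_integral => //.
  - by move=> i; exact: measurable_itv.
  - by move=> i; exact: mp.
  - by move=> i x _; rewrite lee_fin powR_ge0.
rewrite -(cvg_lim _ cv)//; apply: lime_le.
  by apply/cvg_ex; eexists; exact: cv.
by apply: nearW => m; exact: powR_seg.
Unshelve. all: by end_near. Qed.

Let r : R -> R := (fun y : R => y `^ p) \_ (`]0, 1]%classic : set R).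

Let r_ge0 y : 0 <= r y.
Proof. by rewrite /r patchE; case: ifP => // _; exact: powR_ge0. Qed.

Let mr : measurable_fun setT r.
Proof.
apply/(measurable_restrictT _ (measurable_itv _)).
by apply: measurable_funTS; exact: measurable_powR.
Qed.

Let ir : mu.-integrable setT (EFin \o r).
Proof.
apply/integrableP; split; first exact/measurable_EFinP.
apply: le_lt_trans powR_oc; rewrite [leRHS]integral_mkcond.
rewrite le_eqVlt; apply/orP; left; apply/eqP; apply: eq_integral => y _ /=.
rewrite ger0_norm// /r !patchE; by case: ifP.
Qed.

Let ir' : mu.-integrable setT (EFin \o (fun y : R => r (-1 * y + 0))).
Proof.
apply/integrableP; split.
  apply/measurable_EFinP; apply: measurableT_comp => //.
  by apply: measurable_funD => //; exact: measurable_funM.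
have /integrableP[_] := ir.
rewrite (@ge0_integral_affine _ (-1) 0 _ (abse \o (EFin \o r)))//.
- by rewrite normrN normr1 mul1e.
- by apply: measurableT_comp => //; exact/measurable_EFinP.
- by move=> x /=.
Qed.

(** For [0 < |y| < 1] the power itself, times the peak of the density, dominates and is integrable
    because [p > -1]; beyond 1 the bound [p <= 2] puts it below [gauss_env]. *)
Lemma integrable_gauss_powR : p <= 2 ->
  gauss.-integrable setT (EFin \o (fun y : R => `|y| `^ p)).
Proof.
move=> p2.
have mp : measurable_fun setT (fun y : R => `|y| `^ p).
  rewrite [X in measurable_fun _ X](_ : _ = (@powR R ^~ p) \o Num.norm)//.
  by apply: measurableT_comp.
apply/integrable_gauss => //.
have : mu.-integrable setT (fun y : R => ((normal_peak 1)%:E * ((r y)%:E + (r (-1 * y + 0))%:E) +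
    (gauss_env (y - 0))%:E)%E).
  apply: integrableD => //; last exact: integrable_gauss_env.
  by apply: integrableZl => //; apply: integrableD.
apply: le_integrable => //.
  by apply/measurable_EFinP; apply: measurable_funM => //; exact: measurable_gauss_pdf.
move=> y _ /=; rewrite lee_fin.
have e0 : 0 <= gauss_env y.
  by rewrite mulr_ge0 ?gauss_pdf_ge0// exprn_ge0// addr_ge0// sqr_ge0.
rewrite [leLHS]ger0_norm ?mulr_ge0 ?powR_ge0 ?gauss_pdf_ge0//.
have r0 : 0 <= normal_peak 1 * (r y + r (-1 * y + 0)).
  by rewrite mulr_ge0 ?addr_ge0 ?normal_peak_ge0.
rewrite subr0 [leRHS]ger0_norm; last exact: addr_ge0.
have [y1|y1] := leP 1 `|y|.
  rewrite ler_wpDl// ler_wpM2r ?gauss_pdf_ge0//.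
  rewrite (@le_trans _ _ (`|y| `^ 2))//; first exact: ler_powR.
  rewrite powR_mulrn// real_normK ?num_real//.
  by have := sqr_ge0 y; move: (y ^+ 2) => w; rewrite expr2; nra.
(* At 0 the power is 1 if [p = 0] and 0 otherwise; the envelope covers both values. *)
move: r0; have [->|y0] := eqVneq y 0 => r0.
  rewrite ler_wpDl// ler_wpM2r ?gauss_pdf_ge0//.
  rewrite expr0n addr0 expr1n normr0.
  by rewrite /powR eqxx; case: eqP.
have rr : `|y| `^ p <= r y + r (-1 * y + 0).
  have [yn|yp] := ltrP y 0.
    rewrite ler_wpDl// /r patchE ifT mulN1r addr0 ?ltr0_norm//.
    by rewrite inE/= in_itv/= oppr_gt0 yn/= -ltr0_norm// ltW.
  rewrite ler_wpDr// /r patchE ifT ?ger0_norm//.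
  by rewrite inE/= in_itv/= lt_neqAle eq_sym y0 yp/= -[leLHS]ger0_norm// ltW.
rewrite -[leLHS]addr0 lerD// [leLHS]mulrC ler_pM// ?gauss_pdf_ge0 ?powR_ge0 ?normal_peak_ge0//.
rewrite /gauss_pdf ler_piMr ?normal_peak_ge0// -[leRHS]expR0 ler_expR.
by rewrite mulNr oppr_le0 divr_ge0// sqr_ge0.
exact: normal_peak_ge0.
Qed.

End gauss_negative_powers.

(** * Stein's identity and dilations of a normal variable *)

Section gauss_stein.
Context {R : realType}.
Implicit Types (H : R -> R) (M s e a : R).

Lemma Rintegral_gauss_cst (c : R) : \int[@gauss R]_z c = c.
Proof.
transitivity (c * fine (@gauss R setT)); first exact: Rintegral_cst.
by rewrite probability_setT mulr1.
Qed.

(** Smoothing a constant gives a constant, whose derivative 0 is also the mean of [z]. *)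
Lemma Rintegral_gauss_id : \int[@gauss R]_z z = 0.
Proof.
have H1 := @is_derive_smoothing0 R (cst 1) 1 (measurable_cst _) _ 0.
have {}H1 := H1 (fun _ => ltac:(by rewrite normr1)).
have : is_derive (0 : R) 1 (fun a => \int[@gauss R]_z (cst 1 (a + z) : R)) 0.
  apply: (@is_derive1_eq _ (cst 1)) => // a.
  by rewrite /= Rintegral_gauss_cst.
move=> H2; have := @derive_val _ _ _ _ _ _ _ H2.
rewrite (@derive_val _ _ _ _ _ _ _ H1) => <-.
by apply: eq_Rintegral => z _; rewrite mul1r.
Qed.

Lemma integrable_gauss_sqr : gauss.-integrable setT (EFin \o (fun v : R => v ^+ 2)).
Proof.
apply: (@integrable_gauss_poly _ _ 1); first exact: measurable_funX.
move=> v; rewrite ger0_norm ?sqr_ge0// mul1r.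
by have := sqr_ge0 v; move: (v ^+ 2) => w; rewrite expr2; nra.
Qed.

(** The same argument one order higher: the smoothed first moment of a constant does not depend on
    the centre. *)
Lemma Rintegral_gauss_hermite2 : \int[@gauss R]_z (z ^+ 2 - 1) = 0.
Proof.
have H1 := @is_derive_smoothing1 R (cst 1) 1 (measurable_cst _) _ 0.
have {}H1 := H1 (fun _ => ltac:(by rewrite normr1)).
have : is_derive (0 : R) 1 (fun a => \int[@gauss R]_z (cst 1 (a + z) * z : R)) 0.
  apply: (@is_derive1_eq _ (cst 0)) => // a.
  by rewrite /= -Rintegral_gauss_id; apply: eq_Rintegral => z _; rewrite mul1r.
move=> H2; have := @derive_val _ _ _ _ _ _ _ H2.
rewrite (@derive_val _ _ _ _ _ _ _ H1) => <-.
by apply: eq_Rintegral => z _; rewrite mul1r.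
Qed.

Lemma integrable_gauss_cst (c : R) : (@gauss R).-integrable setT (EFin \o cst c).
Proof. exact: finite_measure_integrable_cst. Qed.

Lemma Rintegral_gauss_sqr : \int[@gauss R]_z (z ^+ 2) = 1.
Proof.
have := Rintegral_gauss_hermite2.
rewrite RintegralB//; [|exact: integrable_gauss_sqr|exact: (integrable_gauss_cst 1)].
by rewrite Rintegral_gauss_cst => /eqP; rewrite subr_eq0 => /eqP.
Qed.

Section smoothing_scaled.
Variables (H : R -> R) (M s : R).
Hypothesis mH : measurable_fun setT H.
Hypothesis HM : forall y, `|H y| <= M.
Hypothesis s0 : s != 0.

Let Hs y := H (s * y).
Let mHs : measurable_fun setT Hs.
Proof. by apply: measurableT_comp => //; exact: measurable_funM. Qed.

Let scaled_arg e z : Hs (s^-1 * e + 0 + z) = H (e + s * z).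
Proof. by rewrite /Hs addr0 mulrDr mulrA divff// mul1r. Qed.

(** Replacing [H] by [y |-> H (s y)] turns the scale into a centre [e / s]; the chain rule returns
    the factor [s^-1]. *)
Lemma is_derive_smoothing_scaled0 e :
  is_derive e 1 (fun e => \int[gauss]_z H (e + s * z))
    (s^-1 * \int[gauss]_z (H (e + s * z) * z)).
Proof.
have D := @is_derive_smoothing0 _ Hs M mHs (fun y => HM _) (s^-1 * e + 0).
have := @is_derive1_comp _ _ (fun e => s^-1 * e + 0) e _ _ D (is_derive1_affine s^-1 0 e).
rewrite mulrC; under eq_Rintegral do rewrite scaled_arg.
move=> /is_derive1_eq; apply => b /=.
by apply: eq_Rintegral => z _; rewrite scaled_arg.
Qed.

Lemma is_derive_smoothing_scaled1 e :
  is_derive e 1 (fun e => \int[gauss]_z (H (e + s * z) * z))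
    (s^-1 * \int[gauss]_z (H (e + s * z) * (z ^+ 2 - 1))).
Proof.
have D := @is_derive_smoothing1 _ Hs M mHs (fun y => HM _) (s^-1 * e + 0).
have := @is_derive1_comp _ _ (fun e => s^-1 * e + 0) e _ _ D (is_derive1_affine s^-1 0 e).
rewrite mulrC; under eq_Rintegral do rewrite scaled_arg.
move=> /is_derive1_eq; apply => b /=.
by apply: eq_Rintegral => z _; rewrite scaled_arg.
Qed.

End smoothing_scaled.

(** The derivative of [a |-> E F(a + s z)] is computed twice, once on the kernel and once on [F];
    the identity is the equality of the two results. *)
Lemma gauss_stein (F F' : R -> R) (M M' a s : R) :
  (forall y : R, is_derive y 1 F (F' y)) -> measurable_fun setT F' ->
  (forall y, `|F y| <= M) -> (forall y, `|F' y| <= M') ->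
  \int[gauss]_z (F (a + s * z) * z) = s * \int[gauss]_z F' (a + s * z).
Proof.
move=> dF mF' FM FM'.
(* The kernel form degenerates at scale 0; there both sides vanish because [z] has mean 0. *)
have [->|s0] := eqVneq s 0.
  rewrite mul0r; under eq_Rintegral do rewrite mul0r addr0.
  rewrite RintegralZl//; first by rewrite Rintegral_gauss_id mulr0.
  apply: (@integrable_gauss_poly _ _ 1) => // v.
  by rewrite mul1r sqr_ge_norm.
have mF : measurable_fun setT F.
  apply: continuous_measurable_fun => y; apply: differentiable_continuous.
  exact/derivable1_diffP/(@ex_derive _ _ _ _ _ _ _ (dF y)).
have H1 := is_derive_smoothing_scaled0 mF FM s0 a.
have H2 : is_derive a 1 (fun e => \int[gauss]_z F (e + s * z)) (\int[gauss]_z F' (a + s * z)).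
  apply: (@is_derive_under_integral _ _ _ gauss (fun e z => F (e + s * z))
    (fun e z => F' (e + s * z)) a 1 (cst M')) => //.
  - move=> x _; apply: (@integrable_gauss_poly _ _ M).
      apply: measurableT_comp => //; apply: measurable_funD => //.
    move=> v; rewrite (le_trans (FM _))// ler_peMr//; first exact: le_trans (FM 0).
    by have := sqr_ge0 v; move: (v ^+ 2) => w; rewrite expr2; nra.
  - move=> x y _.
    have d1 : is_derive x 1 (fun a : R => 1 * a + s * y) 1 by exact: is_derive1_affine.
    rewrite -[F' _]mulr1; apply: (@is_derive1_eq _ (F \o (fun a : R => 1 * a + s * y))).
      by apply: is_derive1_comp; rewrite mul1r; exact: dF.
    by move=> b /=; rewrite mul1r.
  - exact: integrable_gauss_cst.
have := @derive_val _ _ _ _ _ _ _ H1.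
rewrite (@derive_val _ _ _ _ _ _ _ H2) => ->.
by rewrite mulrA divff// mul1r.
Qed.

(* Density of the law of [s * z] with respect to [gauss]. *)
Definition gauss_dilation (s z : R) : R := s^-1 * expR (2^-1 * (1 - s ^- 2) * z ^+ 2).

Lemma gauss_dilation_ge0 s z : 0 <= s -> 0 <= gauss_dilation s z.
Proof. by move=> s0; rewrite mulr_ge0 ?expR_ge0// invr_ge0. Qed.

Lemma measurable_gauss_dilation s : measurable_fun setT (gauss_dilation s).
Proof.
apply: measurable_funM => //; apply: measurableT_comp => //.
by apply: measurable_funM => //; exact: measurable_funX.
Qed.

Lemma ge0_integral_gauss_dilation (g : R -> \bar R) s : 0 < s ->
  measurable_fun setT g -> (forall y, 0 <= g y)%E ->
  (\int[gauss]_z g (s * z)%R = \int[gauss]_z (g z * (gauss_dilation s z)%:E))%E.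
Proof.
move=> s0 mg g0.
have ms : measurable_fun setT (fun z : R => g (s * z)).
  by apply: measurableT_comp => //; exact: measurable_funM.
have mL : measurable_fun setT (fun z => (gauss_dilation s z)%:E).
  by apply/measurable_EFinP; exact: measurable_gauss_dilation.
rewrite ge0_integral_gauss// ge0_integral_gauss//; last 2 first.
- exact: emeasurable_funM.
- by move=> y; rewrite mule_ge0// lee_fin gauss_dilation_ge0// ltW.
pose k y := (g y * (gauss_dilation s y)%:E * (gauss_pdf y)%:E)%E.
have mk : measurable_fun setT k.
  apply: emeasurable_funM; first exact: emeasurable_funM.
  by apply/measurable_EFinP; exact: measurable_gauss_pdf.
have k0 y : (0 <= k y)%E.
  apply: mule_ge0; last by rewrite lee_fin gauss_pdf_ge0.
  by apply: mule_ge0 => //; rewrite lee_fin gauss_dilation_ge0// ltW.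
rewrite [RHS](@ge0_integral_affine _ s 0 _ k)//.
- rewrite -ge0_integralZl//.
  + apply: eq_integral => z _; rewrite /k addr0 muleCA -!muleA; congr (_ * _)%E.
    rewrite -!EFinM gtr0_norm// /gauss_dilation /gauss_pdf; congr EFin.
    have sn0 : s != 0 by rewrite gt_eqF.
    have -> : expR (- z ^+ 2 / 2) =
        expR (2^-1 * (1 - s ^- 2) * (s * z) ^+ 2) * expR (- (s * z) ^+ 2 / 2).
      by rewrite -expRD; congr expR; field.
    by move: (expR _) (expR _) (normal_peak 1) => e1 e2 c; field.
  + apply: (@measurableT_comp _ _ _ _ _ _ k) => //.
    by apply: measurable_funD => //; exact: measurable_funM.
- by rewrite gt_eqF.
Qed.

End gauss_stein.

(** * Independent Gaussian coordinates *)

(** The identity [x^-1 = x (|x|^-1)^2] reduces the inverse to a real power of [|x|]; it holds at 0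
    because [0^-1 = 0]. *)
Lemma inv_measurable (R : realType) : measurable_fun setT (@GRing.inv R).
Proof.
have -> : @GRing.inv R = (fun x => x * (`|x| `^ (-1)) ^+ 2).
  apply/funext => x; rewrite powR_inv1// exprVn real_normK ?num_real//.
  have [->|x0] := eqVneq x 0; first by rewrite invr0 mul0r.
  by rewrite expr2 invfM mulrA divff// mul1r.
apply: measurable_funM => //; apply: measurable_funX.
by apply: (@measurableT_comp _ _ _ _ _ _ (@powR R ^~ (-1))).
Qed.

Lemma measurable_funV (R : realType) (dsp : measure_display)
    (T : measurableType dsp) (f : T -> R) :
  measurable_fun setT f -> measurable_fun setT (fun t => (f t)^-1).
Proof. by move=> mf; exact: (measurableT_comp (@inv_measurable R) mf). Qed.

Lemma measurable_fun_sqrt (R : realType) (dsp : measure_display)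
    (T : measurableType dsp) (f : T -> R) :
  measurable_fun setT f -> measurable_fun setT (fun t => Num.sqrt (f t)).
Proof.
have msqrt : measurable_fun setT (@Num.sqrt R).
  by apply: continuous_measurable_fun; exact: sqrt_continuous.
by move=> mf; exact: (measurableT_comp msqrt mf).
Qed.

(** These boxes generate the product sigma-algebra on a finite family of reals. *)
Definition rectangles (R : realType) (I : finType) : set (set (I -> R)) :=
  [set E | exists2 A : I -> set R, (forall i, measurable (A i)) &
     E = [set s | forall i, A i (s i)]].

Notation coords R I := (g_sigma_algebraType (@rectangles R I)).

Section coordinate_space.
Context {R : realType} {I : finType}.
Implicit Types (A : I -> set R).

Definition rect A : set (I -> R) := [set s | forall i, A i (s i)].

Lemma rect_setI_closed : setI_closed (@rectangles R I).
Proof.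
move=> _ _ [A mA ->] [B mB ->]; exists (fun i => A i `&` B i).
  by move=> i; exact: measurableI.
apply/seteqP; split => s /=; first by move=> [sA sB] i.
by move=> sAB; split => i; have [] := sAB i.
Qed.

Lemma measurable_coord (i : I) : measurable_fun setT (fun s : coords R I => s i : R).
Proof.
move=> _ B mB; rewrite setTI; apply: sub_sigma_algebra.
exists (fun j => if j == i then B else setT); first by move=> j; case: ifP.
apply/seteqP; split => s /=; first by move=> Bs j; case: eqP => // ->.
by move=> /(_ i); rewrite eqxx.
Qed.

Lemma measurable_fun_coords (dsp : measure_display) (T : measurableType dsp)
    (f : T -> coords R I) :
  (forall i, measurable_fun setT (fun t => f t i)) -> measurable_fun setT f.
Proof.
move=> mf; apply: (@measurability _ _ T (coords R I) setT f (@rectangles R I) erefl).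
move=> _ [_ [A mA ->] <-]; rewrite setTI.
rewrite (_ : _ @^-1` _ = \bigcap_(i in [set: I]) ((fun t => f t i) @^-1` A i)).
  apply: fin_bigcap_measurable; first exact: finite_finset.
  by move=> i _; rewrite -[X in measurable X]setTI; exact: mf.
by apply/seteqP; split => t /=; [move=> h i _; exact: h|move=> h i; exact: h].
Qed.

(** Boxes are stable under intersection and include the whole space, so they determine a finite
    measure. *)
Lemma coords_measure_unique (m1 m2 : {measure set (coords R I) -> \bar R}) :
  (forall A, (forall i, measurable (A i)) -> m1 (rect A) = m2 (rect A)) ->
  (m1 setT < +oo)%E ->
  forall X, measurable X -> m1 X = m2 X.
Proof.
move=> m12 m1T X mX.
have RT : @rectangles R I setT.
  by exists (fun=> setT) => //; apply/seteqP; split.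
apply: (@measure_unique _ _ (coords R I) (@rectangles R I) (fun=> setT) erefl
  rect_setI_closed (fun=> RT) _ m1 m2 _ (fun=> m1T) X mX).
- by rewrite bigcup_const.
- by move=> _ [A mA ->]; exact: m12.
Qed.

Definition upd (s : I -> R) (a : I) (z : R) : I -> R :=
  fun i => if i == a then z else s i.

Lemma upd_same s a z : upd s a z a = z. Proof. by rewrite /upd eqxx. Qed.

Lemma upd_other s a z i : i != a -> upd s a z i = s i.
Proof. by rewrite /upd => /negbTE ->. Qed.

Lemma upd_upd s a z w : upd (upd s a z) a w = upd s a w.
Proof. by apply/funext => i; rewrite /upd; case: eqP. Qed.

Lemma measurable_upd (dsp : measure_display) (T : measurableType dsp)
    (f : T -> coords R I) (g : T -> R) (a : I) :
  measurable_fun setT f -> measurable_fun setT g ->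
  measurable_fun setT (fun t => upd (f t) a (g t) : coords R I).
Proof.
move=> mf mg; apply: measurable_fun_coords => i.
rewrite /upd; case: eqP => // _.
exact: (measurableT_comp (measurable_coord i) mf).
Qed.

End coordinate_space.

(** * Integrating out one Gaussian coordinate at a time *)

Section gaussian_coords.
Context {R : realType} {I : finType}.
Variable G : probability (coords R I) R.
Hypothesis Grect : forall A, (forall i, measurable (A i)) ->
  G (rect A) = (\prod_i @gauss R (A i))%E.

Let resample (a : I) (sz : coords R I * R) : coords R I := upd sz.1 a sz.2.

Let mresample a : measurable_fun setT (resample a : (coords R I * measurableTypeR R)%type -> _).
Proof. exact: measurable_upd. Qed.

(** On a box, overwriting coordinate [a] by an independent normal draw replaces the factor of [a] by
    itself. Fubini for [G] and one extra normal variable then takes the place of splitting the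
    product space. *)
Let resample_measure a (X : set (coords R I)) : measurable X ->
  G X = pushforward (G \x @gauss R)%E (resample a) X.
Proof.
move=> mX.
pose m2 : {measure set (coords R I) -> \bar R} :=
  measure_function_pushforward__canonical__measure_function_Measure
    (G \x @gauss R)%E (mresample a).
have GT : (G setT < +oo)%E by rewrite probability_setT ltry.
apply: (@coords_measure_unique _ _ G m2 _ GT) => //.
move=> A mA; rewrite /m2 /= /pushforward.
pose A' i := if i == a then setT else A i.
have mA' i : measurable (A' i) by rewrite /A'; case: ifP.
rewrite (_ : resample a @^-1` rect A = rect A' `*` A a); last first.
  apply/seteqP; split => -[s z] /=.
    move=> h; split => [i|].
      by have := h i; rewrite /A' /resample /upd /=; case: ifP.
    by have := h a; rewrite /resample /upd /= eqxx.
  move=> [h ha] i; rewrite /resample /upd /=; case: eqP => [->//|/eqP ia].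
  by have := h i; rewrite /A' (negbTE ia).
have mrA' : measurable (rect A' : set (coords R I)).
  by apply: sub_sigma_algebra; exists A'.
transitivity (G (rect A') * @gauss R (A a))%E; last first.
  by apply/esym; exact: (@product_measure1E _ _ _ _ _ G (@gauss R) _ _ mrA' (mA a)).
rewrite !Grect// (bigD1 a)//= muleC; congr (_ * _)%E.
rewrite [RHS](bigD1 a)//= {1}/A' eqxx probability_setT mul1e.
by apply: eq_bigr => i ia; rewrite /A' (negbTE ia).
Qed.

Lemma ge0_integral_resample (a : I) (Phi : coords R I -> \bar R) :
  measurable_fun setT Phi -> (forall s, 0 <= Phi s)%E ->
  (\int[G]_s Phi s = \int[G]_s \int[@gauss R]_z Phi (upd s a z))%E.
Proof.
move=> mP P0.
rewrite (eq_measure_integral (pushforward (G \x @gauss R)%E (resample a))); last first.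
  by move=> X mX _; exact: resample_measure.
have mPr := measurableT_comp mP (mresample a).
rewrite (ge0_integral_pushforward (mresample a))//.
exact: (@fubini_tonelli1 _ _ _ _ _ G (@gauss R) _ mPr (fun sz => P0 (resample a sz))).
Qed.

Section resample_integrable.
Variables (a : I) (Phi : coords R I -> R).
Hypothesis iP : G.-integrable setT (EFin \o Phi).

Let mP : measurable_fun setT Phi.
Proof. by have /integrableP[/measurable_EFinP] := iP. Qed.

Let mPr : measurable_fun setT (fun sz : coords R I * measurableTypeR R => (Phi (resample a sz))%:E).
Proof. by apply/measurable_EFinP; exact: (measurableT_comp mP (mresample a)). Qed.

Let iPr : (G \x @gauss R)%E.-integrable setT
  (fun sz : coords R I * measurableTypeR R => (Phi (resample a sz))%:E).
Proof.
apply: (proj2 (@integrable12ltyP _ _ _ _ _ G (@gauss R) _ mPr)).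
have /integrableP[_] := iP.
rewrite (ge0_integral_resample a)//.
by apply: measurableT_comp => //; exact/measurable_EFinP.
Qed.

Lemma ae_integrable_resample : {ae G, forall s,
  (@gauss R).-integrable setT (fun z => (Phi (upd s a z))%:E)}.
Proof. exact: (ae_integrable1 iPr). Qed.

Lemma integrable_resample :
  G.-integrable setT (EFin \o (fun s => \int[@gauss R]_z Phi (upd s a z))).
Proof.
have iF := integrable_fubini_F iPr.
apply: le_integrable iF => //.
  apply/measurable_EFinP; apply: (@measurableT_comp _ _ _ _ _ _ fine) => //.
  exact: measurable_fubini_F iPr.
move=> s _ /=; rewrite /Rintegral /fubini_F /=.
by case: (\int[_]_z _)%E => [r| |] //=; rewrite ?normr0 ?lee_fin ?leey.
Qed.

Lemma Rintegral_resample :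
  \int[G]_s Phi s = \int[G]_s \int[@gauss R]_z Phi (upd s a z).
Proof.
have iF := integrable_fubini_F iPr.
rewrite /Rintegral; congr fine.
transitivity (\int[G]_s (fubini_F (@gauss R)
    (fun sz : coords R I * measurableTypeR R => (Phi (resample a sz))%:E) s))%E.
  rewrite (integral12_prod_meas1 iPr).
  rewrite (eq_measure_integral (pushforward (G \x @gauss R)%E (resample a))); last first.
    by move=> X mX _; exact: resample_measure.
  rewrite integral_pushforward//=; exact/measurable_EFinP.
(* [fine] alters the inner integral only where it is infinite, which is a null set. *)
apply: ae_eq_integral => //.
- exact: measurable_fubini_F iPr.
- by have /integrableP[] := integrable_resample.
- have := integrable_ae measurableT iF.
  by apply: filterS => s /= /(_ Logic.I) fs _; rewrite /= fineK.
Qed.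

End resample_integrable.

Lemma ge0_integral_prod_coords (g : I -> R -> R) (l : seq I) : uniq l ->
  (forall i, measurable_fun setT (g i)) -> (forall i z, 0 <= g i z) ->
  (forall i, (@gauss R).-integrable setT (EFin \o g i)) ->
  (\int[G]_s (\prod_(i <- l) g i (s i))%:E = (\prod_(i <- l) \int[@gauss R]_z g i z)%:E)%E.
Proof.
move=> + mg g0 ig; elim: l => [_|a l ih /= /andP[al ul]].
  under eq_integral do rewrite big_nil.
  rewrite big_nil; transitivity ((1 : R)%:E * G setT)%E; first exact: integral_cst.
  by rewrite probability_setT mule1.
have mprod (l' : seq I) : measurable_fun setT (fun s : coords R I => \prod_(i <- l') g i (s i)).
  apply: measurable_prod => b _.
  exact: (measurableT_comp (mg b) (measurable_coord b)).
have p0 (l' : seq I) s : 0 <= \prod_(i <- l') g i (s i) by exact: prodr_ge0.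
rewrite (ge0_integral_resample a); last 2 first.
- exact/measurable_EFinP.
- by move=> s; rewrite lee_fin.
rewrite big_cons EFinM -ih//.
have -> : ((\int[@gauss R]_z g a z)%:E = \int[@gauss R]_z (g a z)%:E)%E.
  by rewrite fineK//; exact: (integrable_fin_num measurableT (ig a)).
transitivity (\int[G]_s ((\prod_(i <- l) g i (s i))%:E * (\int[@gauss R]_z g a z)%:E))%E.
  apply: eq_integral => s _.
  under eq_integral => z _.
    rewrite big_cons upd_same mulrC EFinM.
    rewrite (eq_big_seq (fun i => g i (s i))); last first.
      move=> i il; rewrite upd_other//; apply: contra al => /eqP <-//.
    over.
  rewrite ge0_integralZl; [|by []| |by move=> z _; rewrite lee_fin|by rewrite lee_fin]; last first.
    by apply/measurable_EFinP; exact: mg.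
  by rewrite fineK//; exact: (integrable_fin_num measurableT (ig a)).
rewrite ge0_integralZr; [|by []| |by move=> s _; rewrite lee_fin|by rewrite lee_fin Rintegral_ge0].
- by rewrite muleC fineK//; exact: (integrable_fin_num measurableT (ig a)).
- exact/measurable_EFinP.
Qed.

Lemma integrable_prod_coords (g : I -> R -> R) :
  (forall i, measurable_fun setT (g i)) -> (forall i z, 0 <= g i z) ->
  (forall i, (@gauss R).-integrable setT (EFin \o g i)) ->
  G.-integrable setT (EFin \o (fun s : coords R I => \prod_i g i (s i))).
Proof.
move=> mg g0 ig; apply/integrableP; split.
  apply/measurable_EFinP; apply: measurable_prod => i _.
  exact: (measurableT_comp (mg i) (measurable_coord i)).
have := @ge0_integral_prod_coords g (index_enum I) (index_enum_uniq I) mg g0 ig.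
under [X in (X < _)%E]eq_integral do rewrite /= ger0_norm ?prodr_ge0//.
by move=> ->; rewrite ltry.
Qed.

(** * Random dilation of a block of coordinates *)

Section dilation.
Variables (sg : coords R I -> R) (K : pred I).
Hypothesis msg : measurable_fun setT sg.
Hypothesis sg_ge0 : forall s, 0 <= sg s.
Hypothesis sgK : forall s k z, K k -> sg (upd s k z) = sg s.

Definition dil (l : seq I) (s : I -> R) : I -> R :=
  fun i => if i \in l then sg s * s i else s i.

Let sg_dil l s : all K l -> sg (dil l s) = sg s.
Proof.
elim: l s => [|k l ih] s /=; first by move=> _; congr sg; apply/funext.
move=> /andP[Kk Kl].
rewrite -(sgK (dil (k :: l) s) (dil l s k) Kk) -[RHS](ih s Kl).
congr sg; apply/funext => i; rewrite /upd /dil in_cons.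
by case: (eqVneq i k) => [->|ik].
Qed.

(** Coordinates in [K] do not influence the scale, so they are dilated one after another with the
    scale held fixed, each contributing one density factor. At scale 0 there is no density, and
    [Psi] is required to vanish. *)
Lemma ge0_integral_dil (l : seq I) (Psi : coords R I -> \bar R) :
  uniq l -> all K l ->
  measurable_fun setT Psi -> (forall s, 0 <= Psi s)%E ->
  (forall s, sg s = 0 -> Psi s = 0%E) ->
  (\int[G]_s Psi (dil l s) =
   \int[G]_s (Psi s * (\prod_(i <- l) gauss_dilation (sg s) (s i))%:E))%E.
Proof.
elim: l Psi => [|k l ih] Psi.
  move=> _ _ mPsi P0 Psg; apply: eq_integral => s _.
  by rewrite big_nil mule1; congr Psi; apply/funext.
move=> /= /andP[kl ul] /andP[Kk Kl] mPsi P0 Psg.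
have mdl : measurable_fun setT (fun sz : R * R => gauss_dilation sz.1 sz.2).
  rewrite /gauss_dilation; apply: measurable_funM.
    exact: measurable_funV.
  apply: measurableT_comp => //; apply: measurable_funM; last exact: measurable_funX.
  apply: measurable_funM => //; apply: measurable_funB => //.
  by apply: measurable_funV; exact: measurable_funX.
have mprod (l' : seq I) : measurable_fun setT (fun s : coords R I =>
    (\prod_(i <- l') gauss_dilation (sg s) (s i))%:E).
  apply/measurable_EFinP; apply: measurable_prod => i _.
  exact: (measurableT_comp mdl (measurable_fun_pair msg (measurable_coord i))).
have p0 (l' : seq I) s : 0 <= \prod_(i <- l') gauss_dilation (sg s) (s i).
  by apply: prodr_ge0 => i _; exact: gauss_dilation_ge0.
pose Psik (s : coords R I) := Psi (upd s k (sg s * s k)).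
have mPsik : measurable_fun setT Psik.
  apply: (measurableT_comp mPsi); apply: measurable_upd => //.
  by apply: measurable_funM => //; exact: measurable_coord.
have -> : (fun s : coords R I => Psi (dil (k :: l) s)) = (fun s => Psik (dil l s)).
  apply/funext => s; rewrite /Psik; congr Psi; apply/funext => i.
  rewrite /upd sg_dil// /dil in_cons; case: (eqVneq i k) => [->|//].
  by rewrite (negbTE kl).
have Pk0 s : (0 <= Psik s)%E by exact: P0.
have Pksg s : sg s = 0 -> Psik s = 0%E by move=> s0; rewrite /Psik Psg// sgK.
rewrite (ih Psik)//.
rewrite (ge0_integral_resample k); last 2 first.
- by apply: emeasurable_funM; [exact: mPsik|exact: mprod].
- by move=> s; apply: mule_ge0 => //; rewrite lee_fin.
rewrite [RHS](ge0_integral_resample k); last 2 first.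
- by apply: emeasurable_funM; [exact: mPsi|exact: mprod].
- by move=> s; apply: mule_ge0 => //; rewrite lee_fin.
apply: eq_integral => s _.
have prodE z : \prod_(i <- l) gauss_dilation (sg (upd s k z)) (upd s k z i) =
    \prod_(i <- l) gauss_dilation (sg s) (s i).
  rewrite sgK//; apply: eq_big_seq => i il; rewrite upd_other//.
  by apply: contra kl => /eqP <-.
have [s0|s0] := eqVneq (sg s) 0.
  rewrite !integral0_eq// => z _.
    by rewrite Psg ?mul0e// sgK.
  by rewrite /Psik Psg ?mul0e// !sgK.
have sgt0 : 0 < sg s by rewrite lt_neqAle eq_sym s0 sg_ge0.
have mu' : measurable_fun setT (fun z : R => Psi (upd s k z)).
  apply: (measurableT_comp mPsi).
  by apply: measurable_upd => //; exact: measurable_cst.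
have mu'' : measurable_fun setT (fun z : R => Psi (upd s k (sg s * z))).
  apply: (measurableT_comp mPsi).
  by apply: measurable_upd => //; exact: measurable_cst.
under eq_integral => z _ do rewrite prodE /Psik upd_same sgK// upd_upd.
under [RHS]eq_integral => z _.
  rewrite big_cons prodE upd_same sgK// EFinM muleA.
  over.
rewrite ge0_integralZr; [|by []| |by []|by rewrite lee_fin]; last first.
  exact: mu''.
rewrite ge0_integralZr; [|by []| | |by rewrite lee_fin]; last 2 first.
- apply: emeasurable_funM; first exact: mu'.
  by apply/measurable_EFinP; exact: measurable_gauss_dilation.
- by move=> z _; apply: mule_ge0 => //; rewrite lee_fin gauss_dilation_ge0.
by congr (_ * _)%E; rewrite (ge0_integral_gauss_dilation sgt0 mu').
Qed.

End dilation.
End gaussian_coords.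

(** * Passage to Gaussian coordinates *)

Section discretization.
Context {R : realType}.
Implicit Types (m : nat) (y : R).

(* Rounding down to the grid of mesh 1/(m+1), truncated to [-(m+1), m+1]. *)
Definition dsc_index m y : nat :=
  minn (Num.truncn ((y + m.+1%:R) * m.+1%:R)) (2 * m.+1 * m.+1).

Definition dsc_point m (c : nat) : R := c%:R / m.+1%:R - m.+1%:R.

Definition dsc m y : R := dsc_point m (dsc_index m y).

Lemma dsc_index_lt m y : (dsc_index m y < (2 * m.+1 * m.+1).+1)%N.
Proof. by rewrite ltnS geq_minr. Qed.

(** 0 is itself a grid point, of index [(m + 1)^2], so rounding down never crosses it and rounded
    times stay in the orthant. *)
Lemma dsc_ge0 m y : 0 <= y -> 0 <= dsc m y.
Proof.
move=> y0; rewrite /dsc /dsc_point subr_ge0 ler_pdivlMr// -natrM ler_nat.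
rewrite leq_min; apply/andP; split; last by nia.
rewrite truncn_ge_nat ?mulr_ge0 ?addr_ge0// natrM ler_wpM2r//.
by rewrite lerDr.
Qed.

Lemma dsc_cvg y : dsc m y @[m --> \oo] --> y.
Proof.
apply/cvgrPdist_le => /= e e0; near=> m.
have ym : `|y| <= m.+1%:R.
  have mm : m%:R <= m.+1%:R :> R by rewrite ler_nat.
  by apply: le_trans mm; near: m; exact: nbhs_infty_ger.
have me : m.+1%:R^-1 <= e by apply: ltW; near: m; exact: near_infty_natSinv_lt (PosNum e0).
have m0 : 0 < m.+1%:R :> R by [].
set M : R := m.+1%:R in ym me m0 *.
have [ylo yhi] : - M <= y /\ y <= M by move: ym; rewrite ler_norml => /andP[].
have x0 : 0 <= (y + M) * M by apply: mulr_ge0; [lra|exact: ltW].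
have /andP[t1 t2] := truncn_itv x0.
rewrite /dsc /dsc_point /dsc_index -/M.
have -> : minn (Num.truncn ((y + M) * M)) (2 * m.+1 * m.+1) = Num.truncn ((y + M) * M).
  apply/minn_idPl; rewrite -(ler_nat R) (le_trans t1)// !natrM -/M.
  by apply: ler_wpM2r; [exact: ltW|lra].
set T : R := (Num.truncn _)%:R in t1 *.
rewrite -natr1 -/T in t2.
have h1 : T / M <= y + M by rewrite ler_pdivrMr.
have h2 : y + M - M^-1 <= T / M.
  rewrite ler_pdivlMr// mulrBl mulVf ?gt_eqF// lerBlDr ltW//.
move: (T / M) M^-1 h1 h2 me => q i h1 h2 me.
by rewrite ler_norml; apply/andP; split; lra.
Unshelve. all: by end_near. Qed.

Lemma dsc_index_le m : {homo dsc_index m : y y' / y <= y' >-> (y <= y')%N}.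
Proof.
move=> y y' yy'; rewrite /dsc_index leq_min geq_minr andbT.
rewrite (leq_trans (geq_minl _ _))// le_truncn// ler_wpM2r// lerD2r//.
Qed.

Lemma measurable_dsc_index m (c : nat) (dsp : measure_display)
    (T : measurableType dsp) (f : T -> R) : measurable_fun setT f ->
  measurable_fun setT (fun t => (dsc_index m (f t) == c)%:R : R).
Proof.
move=> mf.
have mi : measurable_fun setT (fun y : R => (dsc_index m y)%:R : R).
  apply: nondecreasing_measurable => // y y' yy'.
  by rewrite ler_nat dsc_index_le.
have -> : (fun t => (dsc_index m (f t) == c)%:R : R) =
    \1_((fun t => (dsc_index m (f t))%:R : R) @^-1` [set c%:R]).
  apply/funext => t; rewrite indicE; apply: (congr1 (fun b : bool => b%:R)); apply/idP/idP.
    by move=> /eqP <-; rewrite inE.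
  by rewrite inE/= => /eqP; rewrite eqr_nat.
apply: measurable_indic.
rewrite -[X in measurable X]setTI; apply: (measurableT_comp mi mf) => //.
Qed.

End discretization.

Section discretization_rV.
Context {R : realType} {n : nat}.
Implicit Types (m : nat) (v : 'rV[R]_n).

Definition gridT m := {ffun 'I_n -> 'I_(2 * m.+1 * m.+1).+1}.

Definition grid m (j : gridT m) : 'rV[R]_n := \row_i dsc_point m (j i).

Definition dscV m v : 'rV[R]_n := \row_i dsc m (v 0 i).

(** Indicator that [v] rounds to the grid point [j], as a product so that it is measurable factor by
    factor. *)
Definition gridw m (j : gridT m) v : R := \prod_i (dsc_index m (v 0 i) == j i)%:R.

Lemma gridw_ge0 m (j : gridT m) v : 0 <= gridw j v.
Proof. exact: prodr_ge0. Qed.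

Lemma gridw_eq m (j : gridT m) v : gridw j v != 0 -> dscV m v = grid j.
Proof.
move=> /prodf_neq0 h; apply/rowP => i; rewrite !mxE /dsc; congr dsc_point.
by have := h i isT; rewrite pnatr_eq0 eqb0 negbK => /eqP ->.
Qed.

Lemma sum_gridw m v (F : 'rV[R]_n -> R) :
  F (dscV m v) = \sum_(j : gridT m) gridw j v * F (grid j).
Proof.
pose j0 : gridT m := [ffun i => Ordinal (dsc_index_lt m (v 0 i))].
rewrite (bigD1 j0)//= [X in _ = _ + X]big1 ?addr0; last first.
  move=> j jj0; suff -> : gridw j v = 0 by rewrite mul0r.
  apply/eqP; apply: contraNT jj0 => /prodf_neq0 h; apply/eqP/ffunP => i.
  rewrite ffunE; apply/val_inj => /=.
  by have := h i isT; rewrite pnatr_eq0 eqb0 negbK => /eqP ->.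
suff w1 : gridw j0 v = 1.
  by rewrite w1 mul1r (@gridw_eq _ j0)// w1 oner_neq0.
by rewrite /gridw big1// => i _; rewrite ffunE eqxx.
Qed.

Lemma dscV_cvg v : dscV m v @[m --> \oo] --> v.
Proof.
apply/cvgrPdist_le => /= e e0.
have : \forall m \near \oo, forall i : 'I_n, `|v 0 i - dsc m (v 0 i)| <= e.
  apply: filter_forall => i.
  by have /cvgrPdist_le/(_ _ e0) := @dsc_cvg R (v 0 i).
apply: filterS => m h; apply: rV_norm_leP; first exact: ltW.
by move=> i; rewrite !mxE; exact: h.
Qed.

Lemma within_cvg_dscV (D : set 'rV[R]_n) (F : 'rV[R]_n -> R) v :
  {within D, continuous F} -> D v -> (forall m, D (dscV m v)) ->
  F (dscV m v) @[m --> \oo] --> F v.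
Proof.
move=> cF Dv Dd.
have cFv : F x @[x --> within D (nbhs v)] --> F v.
  by rewrite nbhs_subspace_in//; exact: (cF v).
have dw : dscV m v @[m --> \oo] --> within D (nbhs v).
  move=> U; rewrite /within/= => UW.
  have := @dscV_cvg v _ UW; rewrite /nbhs/=.
  by apply: filterS => m /= h; exact: h (Dd m).
exact: (cvg_comp _ _ dw cFv).
Qed.

Lemma measurable_gridw m (j : gridT m) (dsp : measure_display)
    (T : measurableType dsp) (V : T -> 'rV[R]_n) :
  (forall i, measurable_fun setT (fun t => V t 0 i)) ->
  measurable_fun setT (fun t => gridw j (V t)).
Proof.
move=> mV; apply: measurable_prod => i _; exact: measurable_dsc_index.
Qed.

(** Evaluation at a random point is the limit of evaluations at rounded points, which are finite
    sums over the grid. Grid points outside [D], where [Y] is not known to be measurable, have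
    weight 0 because rounding preserves [D]. *)
Lemma measurable_random_eval (dsp : measure_display) (T : measurableType dsp)
    (D : set 'rV[R]_n) (Y : 'rV[R]_n -> T -> R) (V : T -> 'rV[R]_n) :
  (forall v m, D v -> D (dscV m v)) ->
  (forall v, D v -> measurable_fun setT (Y v)) ->
  (forall t, {within D, continuous (Y ^~ t)}) ->
  (forall t, D (V t)) -> (forall i, measurable_fun setT (fun t => V t 0 i)) ->
  measurable_fun setT (fun t => Y (V t) t).
Proof.
move=> Dd mY cY DV mV.
apply: (@measurable_fun_cvg _ _ _ _ (fun m t => Y (dscV m (V t)) t)); last first.
  move=> t _; apply: (within_cvg_dscV (cY t)) => // m; exact: Dd.
move=> m.
have -> : (fun t => Y (dscV m (V t)) t) = (fun t => \sum_(j : gridT m) gridw j (V t) *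
    (if `[< D (grid j) >] then Y (grid j) t else 0)).
  apply/funext => t; rewrite (@sum_gridw m (V t) (Y ^~ t)).
  apply: eq_bigr => j _; have [->|w0] := eqVneq (gridw j (V t)) 0; first by rewrite !mul0r.
  by rewrite asboolT// -(gridw_eq w0); exact: Dd.
apply: measurable_sum => j; apply: measurable_funM; first exact: measurable_gridw.
by case: asboolP => [Dj|_]; [exact: mY|exact: measurable_cst].
Qed.

Lemma measurable_continuous_rV (dsp : measure_display) (T : measurableType dsp)
    (F : 'rV[R]_n -> R) (V : T -> 'rV[R]_n) : continuous F ->
  (forall i, measurable_fun setT (fun t => V t 0 i)) ->
  measurable_fun setT (fun t => F (V t)).
Proof.
move=> cF mV; apply: (@measurable_random_eval _ _ setT (fun v _ => F v)) => //.
by move=> _; exact: continuous_subspaceT.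
Qed.

End discretization_rV.

Lemma normal_prob_scale {R : realType} (c : R) (A : set R) : 0 < c -> measurable A ->
  normal_prob 0 c A = @gauss R ((fun z => c * z) @^-1` A).
Proof.
move=> c0 mA.
have cn0 : c != 0 by rewrite gt_eqF.
have mcA : measurable ((fun z : R => c * z) @^-1` A).
  by rewrite -[X in measurable X]setTI; exact: mulrl_measurable.
transitivity (\int[@gauss R]_z (\1_((fun z : R => c * z) @^-1` A) z)%:E)%E; last first.
  by rewrite integral_indic// setIT.
rewrite ge0_integral_gauss//; last first.
  by apply/measurable_EFinP; exact: measurable_indic.
rewrite /normal_prob integral_mkcond.
have mp : measurable_fun setT (fun y : R => (\1_A y * normal_pdf 0 c y)%:E).
  apply/measurable_EFinP; apply: measurable_funM; first exact: measurable_indic.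
  exact: measurable_normal_pdf.
transitivity (\int[@lebesgue_measure R]_y (\1_A y * normal_pdf 0 c y)%:E)%E.
  apply: eq_integral => y _; rewrite patchE indicE; case: ifP => _.
    by rewrite mul1r.
  by rewrite mul0r.
rewrite (ge0_integral_affine 0 cn0 mp); last first.
  by move=> y; rewrite lee_fin mulr_ge0 ?normal_pdf_ge0.
rewrite -ge0_integralZl//; last 2 first.
- apply: (measurableT_comp mp).
  by apply: measurable_funD => //; exact: measurable_funM.
- by move=> y _; rewrite lee_fin mulr_ge0 ?normal_pdf_ge0.
apply: eq_integral => y _; rewrite addr0 -!EFinM; congr EFin.
rewrite mulrCA; congr (_ * _).
rewrite normal_pdfE// /normal_fun subr0 /gauss_pdf mulrA gtr0_norm//; congr (_ * expR _).
  rewrite /normal_peak expr1n mul1r -mulrnAr sqrtrM ?sqr_ge0//.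
  by rewrite sqrtr_sqr gtr0_norm// invfM mulrA divff// mul1r.
by rewrite -mulr_natr; field.
Qed.

(** A one-element list with coefficient 1 isolates a single index. Zero variance gives the point
    mass at 0, which is again the law of [sqrt 0 * z]. *)
Lemma gaussian_marginal {R : realType} (dsp : measure_display)
    (Omega : measurableType dsp) (P : probability Omega R) (S : eqType)
    (D : set S) (K : S -> S -> R) (X : S -> Omega -> R) (t : S) (A : set R) :
  centered_gaussian_process P D K X -> D t -> 0 <= K t t -> measurable A ->
  P (X t @^-1` A) = @gauss R ((fun z => Num.sqrt (K t t) * z) @^-1` A).
Proof.
move=> [_ +] Dt K0 mA => /(_ [:: t] (fun=> 1)).
move=> /(_ _)/wrap[]; first by move=> s /=; rewrite inE => /eqP ->.
move=> /(_ _ mA); rewrite /= !big_seq1 !mul1r.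
have -> : (fun w => \sum_(t0 <- [:: t]) 1 * X t0 w) @^-1` A = X t @^-1` A.
  by apply/seteqP; split => w /=; rewrite big_seq1 mul1r.
move=> ->; case: eqP => [->|/eqP Kn0].
  rewrite sqrtr0 (_ : _ @^-1` A = if 0 \in A then setT else set0); last first.
    apply/seteqP; split => z /=; rewrite mul0r; case: ifPn => //.
      by rewrite notin_setE => + A0; exact.
    by rewrite inE.
  by rewrite diracE; case: ifP => _; rewrite ?probability_setT ?measure0.
rewrite normal_prob_scale// sqrtr_gt0 lt_neqAle eq_sym Kn0//.
Qed.

Lemma rV_cvg {R : realType} (n : nat) (u : nat -> 'I_n -> R) (l : 'I_n -> R) :
  (forall i, u m i @[m --> \oo] --> l i) ->
  \row_i u m i @[m --> \oo] --> (\row_i l i : 'rV[R]_n).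
Proof.
move=> ul; apply/cvgrPdist_le => /= e e0.
have : \forall m \near \oo, forall i : 'I_n, `|l i - u m i| <= e.
  apply: filter_forall => i.
  by have /cvgrPdist_le/(_ _ e0) := ul i.
apply: filterS => m h; apply: rV_norm_leP; first exact: ltW.
by move=> i; rewrite !mxE; exact: h.
Qed.

Lemma prod_cvg {R : realType} (I : finType) (u : nat -> I -> R) (l : I -> R) :
  (forall i, u m i @[m --> \oo] --> l i) ->
  \prod_i u m i @[m --> \oo] --> \prod_i l i.
Proof.
move=> ul; elim: (index_enum I) => [|i r ih].
  by rewrite big_nil; under eq_fun do rewrite big_nil; exact: cvg_cst.
by rewrite big_cons; under eq_fun do rewrite big_cons; exact: cvgM.
Qed.

(** * From sheets and motions to Gaussian coordinates *)

Section transfer.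
Context {R : realType} (dsp : measure_display) (Omega : measurableType dsp).
Variables (P : probability Omega R) (n d : nat).
Variables (W : 'I_d -> 'rV[R]_n -> Omega -> R) (B : 'I_n -> R -> Omega -> R).
Hypothesis HW : forall k : 'I_d, brownian_sheet1 P (W k).
Hypothesis HB : forall i : 'I_n, brownian_motion P (B i).
Hypothesis Hind : sheet_motions_independent P W B.

Local Notation I := ('I_d + 'I_n)%type.

(** The sheets are read at one deterministic parameter [v], which will be a value of the rounded
    random parameter, and each motion at its own time. *)
Definition fam (v t : 'rV[R]_n) (w : Omega) : I -> R := fun a =>
  match a with inl k => W k v w | inr i => B i (t 0 i) w end.

Definition famscale (v t : 'rV[R]_n) (a : I) : R :=
  match a with inl _ => Num.sqrt (\prod_i v 0 i) | inr i => Num.sqrt (t 0 i) end.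

Let orth_ge0 (v : 'rV[R]_n) i : orthant n v -> 0 <= v 0 i.
Proof. by move=> /(_ i). Qed.

Let mW k v : orthant n v -> measurable_fun setT (W k v).
Proof. by move=> ov; have [[h _] _] := HW k; exact: h. Qed.

Let mB i (r : R) : 0 <= r -> measurable_fun setT (B i r).
Proof. by move=> r0; have [[h _] _] := HB i; exact: h. Qed.

Lemma measurable_fam v t : orthant n v -> orthant n t ->
  measurable_fun setT (fam v t : Omega -> coords R I).
Proof.
move=> ov ot; apply: measurable_fun_coords => -[k|i] /=; first exact: mW.
exact/mB/orth_ge0.
Qed.

Lemma fam_law v t (A : I -> set R) : orthant n v -> orthant n t ->
  (forall a, measurable (A a)) ->
  P (fam v t @^-1` rect A) =
  (\prod_a @gauss R ((fun z => famscale v t a * z)%R @^-1` A a))%E.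
Proof.
move=> ov ot mA.
pose E (a : I) : set Omega := (fun w => fam v t w a) @^-1` A a.
have -> : fam v t @^-1` rect A = \bigcap_(a in [set a | a \in [set: I]%SET]) E a.
  apply/seteqP; split => w /=; first by move=> h a _; exact: h.
  by move=> h a; apply: (h a); rewrite /= finset.inE.
have -> : (\prod_a @gauss R ((fun z => famscale v t a * z)%R @^-1` A a) =
    \prod_(a in [set: I]%SET) P (E a))%E.
  apply: eq_big => [a|a _]; first by rewrite finset.inE.
  case: a => [k|i]; rewrite /E /=.
    have [gp _] := HW k.
    have Kvv : \prod_(i < n) Order.min (v ord0 i) (v ord0 i) = \prod_i v 0 i.
      by apply: eq_bigr => i _; rewrite minxx.
    rewrite (gaussian_marginal gp ov _ (mA (inl k))) Kvv//.
    by apply: prodr_ge0 => i _; exact: orth_ge0.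
  have [gp _] := HB i.
  have t0 : [set r : R | 0 <= r] (t 0 i) by exact: orth_ge0.
  by rewrite (gaussian_marginal gp t0 _ (mA (inr i))) minxx.
apply: Hind => -[k|i] _.
  exists [:: v], (fun=> A (inl k)); split.
    by move=> s /=; rewrite inE => /eqP ->.
  split; first by move=> _; exact: mA.
  apply/seteqP; split => w /=; first by move=> h s /=; rewrite inE => /eqP ->.
  by move=> /(_ v); apply; rewrite /= inE.
exists [:: t 0 i], (fun=> A (inr i)); split.
  by move=> s /=; rewrite inE => /eqP ->; exact: orth_ge0.
split; first by move=> _; exact: mA.
apply/seteqP; split => w /=; first by move=> h s /=; rewrite inE => /eqP ->.
by move=> /(_ (t 0 i)); apply; rewrite /= inE.
Qed.

Let ones : 'rV[R]_n := const_mx 1.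
Let ones_orth : orthant n ones. Proof. by move=> i; rewrite mxE. Qed.

(** At times all equal to 1 every standard deviation is 1, so the family living on [Omega] already
    has the product law. *)
Lemma exists_gaussian_coords : exists G : probability (coords R I) R,
  forall A, (forall i, measurable (A i)) -> G (rect A) = (\prod_i @gauss R (A i))%E.
Proof.
have mf := measurable_fam ones_orth ones_orth.
pose X : {mfun Omega >-> coords R I} :=
  HB.pack (fam ones ones : Omega -> coords R I)
    (isMeasurableFun.Build _ _ _ _ (fam ones ones : Omega -> coords R I) mf).
exists (distribution P X) => A mA.
transitivity (P (fam ones ones @^-1` rect A)); first by [].
rewrite fam_law//.
apply: eq_bigr => a _; congr (gauss _); apply/seteqP; split => z /=.
  rewrite (_ : famscale _ _ _ = 1) ?mul1r//.
  by case: a => [k|i] /=; rewrite ?big1 ?mxE ?sqrtr1// => i _; rewrite mxE.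
rewrite (_ : famscale _ _ _ = 1) ?mul1r//.
by case: a => [k|i] /=; rewrite ?big1 ?mxE ?sqrtr1// => i _; rewrite mxE.
Qed.

Variable G : probability (coords R I) R.
Hypothesis Grect : forall A, (forall i, measurable (A i)) ->
  G (rect A) = (\prod_i @gauss R (A i))%E.

Definition scaled (v t : 'rV[R]_n) (s : coords R I) : coords R I :=
  fun a => famscale v t a * s a.

Let mscaled v t : measurable_fun setT (scaled v t).
Proof.
apply: measurable_fun_coords => a; apply: measurable_funM => //.
exact: measurable_coord.
Qed.

Lemma ge0_law_transfer v t (Psi : coords R I -> \bar R) :
  orthant n v -> orthant n t ->
  measurable_fun setT Psi -> (forall s, 0 <= Psi s)%E ->
  (\int[P]_w Psi (fam v t w) = \int[G]_s Psi (scaled v t s))%E.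
Proof.
move=> ov ot mPsi P0.
have mf := measurable_fam ov ot.
pose m1 : {measure set (coords R I) -> \bar R} :=
  measure_function_pushforward__canonical__measure_function_Measure P mf.
pose m2 : {measure set (coords R I) -> \bar R} :=
  measure_function_pushforward__canonical__measure_function_Measure G (mscaled v t).
have m12 X : measurable X -> m1 X = m2 X.
  apply: coords_measure_unique; last first.
    have h : (P setT < +oo)%E by rewrite probability_setT ltry.
    exact: h.
  move=> A mA; rewrite /m1 /m2 /= /pushforward.
  transitivity (\prod_a @gauss R ((fun z => famscale v t a * z)%R @^-1` A a))%E.
    exact: fam_law.
  rewrite -Grect//.
  by move=> a; rewrite -[X in measurable X]setTI; exact: mulrl_measurable.
transitivity (\int[m1]_s Psi s)%E; first by rewrite (ge0_integral_pushforward mf).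
transitivity (\int[m2]_s Psi s)%E; last by rewrite (ge0_integral_pushforward (mscaled v t)).
by apply: eq_measure_integral => X mX _; exact: m12.
Qed.

Section transfer_random_time.
Variables (t : 'rV[R]_n) (g : 'rV[R]_d -> R) (M : R) (kap : 'rV[R]_n -> R).
Hypothesis ot : orthant n t.
Hypothesis cg : continuous g.
Hypothesis g0 : forall x, 0 <= g x.
Hypothesis gM : forall x, g x <= M.
Hypothesis kap0 : forall v, 0 <= kap v.
Hypothesis mkap : forall (dsp : measure_display) (T : measurableType dsp)
  (V : T -> 'rV[R]_n), (forall i, measurable_fun setT (fun t => V t 0 i)) ->
  measurable_fun setT (fun t => kap (V t)).

Let absB (w : Omega) : 'rV[R]_n := \row_i `|B i (t 0 i) w|.
Let absb (s : coords R I) : 'rV[R]_n := \row_i `|Num.sqrt (t 0 i) * s (inr i)|.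

Hypothesis ikap : G.-integrable setT (EFin \o (fun s => kap (absb s))).

Let mabsB i : measurable_fun setT (fun w => absB w 0 i).
Proof.
rewrite (_ : (fun w => _) = (fun w => `|B i (t 0 i) w|)); last first.
  by apply/funext => w; rewrite mxE.
by apply: measurableT_comp => //; exact/mB/orth_ge0.
Qed.

Let mabsb i : measurable_fun setT (fun s => absb s 0 i).
Proof.
rewrite (_ : (fun w => _) = (fun s => `|Num.sqrt (t 0 i) * s (inr i)|)); last first.
  by apply/funext => w; rewrite mxE.
apply: measurableT_comp => //; apply: measurable_funM => //.
exact: measurable_coord.
Qed.

Let oabsB w : orthant n (absB w).
Proof. by move=> i; rewrite mxE. Qed.

Let oabsb s : orthant n (absb s).
Proof. by move=> i; rewrite mxE. Qed.

Let orth_dsc m (v : 'rV[R]_n) : orthant n v -> orthant n (dscV m v).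
Proof. by move=> ov i; rewrite mxE; exact/dsc_ge0/orth_ge0. Qed.

Let mrow (dsp' : measure_display) (T : measurableType dsp') (h : 'I_d -> T -> R) :
  (forall k, measurable_fun setT (h k)) ->
  measurable_fun setT (fun t => g (\row_k h k t)).
Proof.
move=> mh; apply: measurable_continuous_rV => // k.
rewrite (_ : (fun t => _) = h k)//.
by apply/funext => u; rewrite mxE.
Qed.

Let mcoordrow i : measurable_fun setT
  (fun s : coords R I => (\row_i `|s (inr i)| : 'rV[R]_n) 0 i).
Proof.
rewrite (_ : (fun w => _) = (fun s => `|s (inr i)|)); last first.
  by apply/funext => w; rewrite mxE.
by apply: measurableT_comp => //; exact: measurable_coord.
Qed.

Let Wdsc (v : 'rV[R]_n) w : 'rV[R]_d := \row_k W k v w.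
Let Zdsc (v : 'rV[R]_n) (s : coords R I) : 'rV[R]_d := \row_k (Num.sqrt (\prod_i v 0 i) * s (inl k)).

Let term m (j : gridT m) (s : coords R I) : R :=
  gridw j (\row_i `|s (inr i)|) * (kap (\row_i `|s (inr i)|) * g (\row_k s (inl k))).

Let term_ge0 m (j : gridT m) s : 0 <= term j s.
Proof. by apply: mulr_ge0; [exact: gridw_ge0|exact: mulr_ge0]. Qed.

Let mterm m (j : gridT m) : measurable_fun setT (term j).
Proof.
apply: measurable_funM; first exact: measurable_gridw.
by apply: measurable_funM; [exact: mkap|apply: mrow => k; exact: measurable_coord].
Qed.

(** On one cell of the grid the rounded parameter is constant, so equality of laws at fixed times
    applies cell by cell. Only the argument of the sheet is rounded, not the weight [kap]. *)
Let dsc_eq m :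
  (\int[P]_w (kap (absB w) * g (Wdsc (dscV m (absB w)) w))%:E =
   \int[G]_s (kap (absb s) * g (Zdsc (dscV m (absb s)) s))%:E)%E.
Proof.
transitivity (\int[P]_w \sum_(j : gridT m) (gridw j (absB w) *
    (kap (absB w) * g (Wdsc (grid j) w)))%:E)%E.
  apply: eq_integral => w _; rewrite sumEFin; congr EFin.
  exact: (@sum_gridw _ _ m (absB w) (fun v => kap (absB w) * g (Wdsc v w))).
transitivity (\int[G]_s \sum_(j : gridT m) (gridw j (absb s) *
    (kap (absb s) * g (Zdsc (grid j) s)))%:E)%E; last first.
  apply: eq_integral => s _; rewrite sumEFin; congr EFin.
  exact/esym/(@sum_gridw _ _ m (absb s) (fun v => kap (absb s) * g (Zdsc v s))).
have bad (j : gridT m) (v : 'rV[R]_n) : orthant n v -> ~ orthant n (grid j : 'rV[R]_n) ->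
    gridw j v = 0.
  move=> ov nj; apply/eqP; apply: contra_notT nj => /gridw_eq <-.
  exact: orth_dsc.
have tP (j : gridT m) : orthant n (grid j : 'rV[R]_n) -> forall w,
    gridw j (absB w) * (kap (absB w) * g (Wdsc (grid j) w)) = term j (fam (grid j) t w).
  by [].
have tG (j : gridT m) : forall s,
    gridw j (absb s) * (kap (absb s) * g (Zdsc (grid j) s)) = term j (scaled (grid j) t s).
  by [].
rewrite ge0_integral_sum//; last 2 first.
- move=> j; have [oj|nj] := pselect (orthant n (grid j : 'rV[R]_n)).
    apply/measurable_EFinP.
    exact: (measurableT_comp (mterm j) (measurable_fam oj ot)).
  rewrite (_ : (fun w => _) = cst 0%E)//; apply/funext => w.
  by rewrite bad// mul0r.
- by move=> j w _; rewrite lee_fin mulr_ge0 ?gridw_ge0// mulr_ge0.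
rewrite ge0_integral_sum//; last 2 first.
- move=> j; apply/measurable_EFinP.
  exact: (measurableT_comp (mterm j) (mscaled (grid j) t)).
- by move=> j w _; rewrite lee_fin mulr_ge0 ?gridw_ge0// mulr_ge0.
apply: eq_bigr => j _.
have [oj|nj] := pselect (orthant n (grid j : 'rV[R]_n)); last first.
  by rewrite !integral0_eq// => s _; rewrite bad// mul0r.
apply: (@ge0_law_transfer (grid j) t (fun s => (term j s)%:E)) => //.
  exact/measurable_EFinP.
by move=> s; rewrite lee_fin.
Qed.

Let mWabs k : measurable_fun setT (fun w => W k (absB w) w).
Proof.
apply: (@measurable_random_eval _ _ _ _ (orthant n) (W k) absB) => //.
- by move=> v m; exact: orth_dsc.
- by move=> v; exact: mW.
- by move=> w; have [_] := HW k.
Qed.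

Let mWdsc m k : measurable_fun setT (fun w => W k (dscV m (absB w)) w).
Proof.
apply: (@measurable_random_eval _ _ _ _ (orthant n) (W k) (fun w => dscV m (absB w))) => //.
- by move=> v m'; exact: orth_dsc.
- by move=> v; exact: mW.
- by move=> w; have [_] := HW k.
- by move=> w; exact: orth_dsc.
- move=> i; have -> : (fun w => dscV m (absB w) 0 i) = (fun w => dsc m (absB w 0 i)).
    by apply/funext => w; rewrite mxE.
  have md : measurable_fun setT (dsc m : R -> R).
    apply: nondecreasing_measurable => // y y' yy'.
    by rewrite /dsc /dsc_point lerD2r ler_pM2r ?invr_gt0// ler_nat dsc_index_le.
  exact: (measurableT_comp md (mabsB i)).
Qed.

Let mZ v : (forall i, measurable_fun setT (fun s : coords R I => (v s : 'rV[R]_n) 0 i)) ->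
  forall k, measurable_fun setT
    (fun s : coords R I => Num.sqrt (\prod_i (v s) 0 i) * s (inl k)).
Proof.
move=> mv k; apply: measurable_funM; last exact: measurable_coord.
by apply: measurable_fun_sqrt; apply: measurable_prod => i _; exact: mv.
Qed.

Let mdscb m i : measurable_fun setT (fun s => dscV m (absb s) 0 i).
Proof.
have -> : (fun w => dscV m (absb w) 0 i) = (fun w => dsc m (absb w 0 i)).
  by apply/funext => w; rewrite mxE.
have md : measurable_fun setT (dsc m : R -> R).
  apply: nondecreasing_measurable => // y y' yy'.
  by rewrite /dsc /dsc_point lerD2r ler_pM2r ?invr_gt0// ler_nat dsc_index_le.
exact: (measurableT_comp md (mabsb i)).
Qed.

Lemma integrable_kap_abs : P.-integrable setT (EFin \o (fun w => kap (absB w))).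
Proof.
apply/integrableP; split; first by apply/measurable_EFinP; exact: mkap.
have /integrableP[_] := ikap.
have mk : measurable_fun setT (fun s : coords R I => (`|kap (\row_i `|s (inr i)|)|)%:E).
  by apply/measurable_EFinP; apply: measurableT_comp => //; exact: mkap.
(* [kap] reads the motions alone, so the sheets may be frozen at any parameter; [t] is a convenient
   one. *)
by rewrite -(ge0_law_transfer ot ot mk).
Qed.

Lemma ge0_transfer :
  (\int[P]_w (kap (absB w) * g (Wdsc (absB w) w))%:E =
   \int[G]_s (kap (absb s) * g (Zdsc (absb s) s))%:E)%E.
Proof.
have bd (v : 'rV[R]_n) (x : 'rV[R]_d) : `|kap v * g x| <= M * kap v.
  by rewrite ger0_norm ?mulr_ge0// mulrC ler_wpM2r.
have cvP : (\int[P]_w (kap (absB w) * g (Wdsc (dscV m (absB w)) w))%:E @[m --> \oo] -->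
    \int[P]_w (kap (absB w) * g (Wdsc (absB w) w))%:E)%E.
  apply: (@dominated_cvg _ _ _ P _ _ _ _ (fun w => (M * kap (absB w))%:E)) => //.
  - by move=> m; apply/measurable_EFinP; apply: measurable_funM; [exact: mkap|exact: mrow].
  - move=> w _; apply: cvg_EFin; first exact: nearW.
    apply: cvgM; first exact: cvg_cst.
    apply: (cvg_comp (fun m => Wdsc (dscV m (absB w)) w) g); last exact: cg.
    apply: rV_cvg => k; have [_ cW] := HW k.
    by apply: (within_cvg_dscV (cW w)) => // m; exact: orth_dsc.
  - by have := integrableZl measurableT M integrable_kap_abs.
  - by move=> m w _; rewrite lee_fin; exact: bd.
have cvG : (\int[G]_s (kap (absb s) * g (Zdsc (dscV m (absb s)) s))%:E @[m --> \oo] -->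
    \int[G]_s (kap (absb s) * g (Zdsc (absb s) s))%:E)%E.
  apply: (@dominated_cvg _ _ _ G _ _ _ _ (fun s => (M * kap (absb s))%:E)) => //.
  - move=> m; apply/measurable_EFinP; apply: measurable_funM; first exact: mkap.
    by apply: mrow; apply: mZ; exact: mdscb.
  - move=> s _; apply: cvg_EFin; first exact: nearW.
    apply: cvgM; first exact: cvg_cst.
    apply: (cvg_comp (fun m => Zdsc (dscV m (absb s)) s) g); last exact: cg.
    apply: rV_cvg => k; apply: cvgM; last exact: cvg_cst.
    apply: (cvg_comp (fun m => \prod_i dscV m (absb s) 0 i) Num.sqrt); last exact: sqrt_continuous.
    apply: prod_cvg => i; under eq_fun do rewrite mxE.
    exact: dsc_cvg.
  - by have := integrableZl measurableT M ikap.
  - by move=> m w _; rewrite lee_fin; exact: bd.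
rewrite (funext dsc_eq) in cvP.
exact: (cvg_unique (@ereal_hausdorff R) cvP cvG).
Qed.

End transfer_random_time.
End transfer.

(** * Derivatives of Gaussian means *)

Lemma lipschitz_continuous_rV {R : realType} (m : nat) (g : 'rV[R]_m -> R) (L : R) :
  (forall x y, `|g x - g y| <= L * `|x - y|) -> continuous g.
Proof.
move=> gL x; apply/(@cvgrPdist_le _ _ _ (nbhs (x : 'rV[R]_m))) => e e0.
near=> y; rewrite (le_trans (gL _ _))//.
rewrite (@le_trans _ _ ((`|L| + 1) * `|x - y|))//.
  by rewrite ler_wpM2r// (le_trans (ler_norm _))// lerDl.
rewrite -ler_pdivlMl ?ltr_wpDl// mulrC.
near: y; have /(@cvgrPdist_le _ _ _ (nbhs (x : 'rV[R]_m))) := @cvg_id _ (nbhs (x : 'rV[R]_m)); apply.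
by rewrite divr_gt0// ltr_wpDl.
Unshelve. all: by end_near. Qed.

Lemma holder_continuous_rV {R : realType} (m : nat) (g : 'rV[R]_m -> R) (C alpha : R) :
  0 < alpha -> (forall x y, `|g x - g y| <= C * `|x - y| `^ alpha) -> continuous g.
Proof.
move=> a0 gC x; apply/(@cvgrPdist_le _ _ _ (nbhs (x : 'rV[R]_m))) => e e0.
have C1 : 0 < `|C| + 1 by rewrite ltr_wpDl.
have ea : 0 < (e / (`|C| + 1)) `^ alpha^-1 by rewrite powR_gt0// divr_gt0.
near=> y; rewrite (le_trans (gC _ _))//.
rewrite (@le_trans _ _ ((`|C| + 1) * `|x - y| `^ alpha))//.
  by rewrite ler_wpM2r ?powR_ge0// (le_trans (ler_norm _))// lerDl.
rewrite -ler_pdivlMl// mulrC.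
rewrite (@le_trans _ _ (((e / (`|C| + 1)) `^ alpha^-1) `^ alpha))//.
  apply: ge0_ler_powR; [exact: ltW|by rewrite nnegrE|by rewrite nnegrE ltW|].
  near: y; have /(@cvgrPdist_le _ _ _ (nbhs (x : 'rV[R]_m))) h := @cvg_id _ (nbhs (x : 'rV[R]_m)).
  exact: (h _ ea).
by rewrite -powRrM mulVf ?gt_eqF// powRr1// divr_ge0 ?ltW.
Unshelve. all: by end_near. Qed.

(** * Uniform bounds for [f] and its derivatives *)

Section regularity.
Context {R : realType} {d : nat}.
Variables (f : 'rV[R]_d -> R) (alpha : R).
Hypothesis fb : bounded_fun_rV f.
Hypothesis al : 0 < alpha <= 1.
Hypothesis df : forall (k l : 'I_d) x, derivable f x (evec l) /\
                          derivable (partial l f) x (evec k).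
Hypothesis f2 : forall k l : 'I_d, bounded_fun_rV (partial k (partial l f)) /\
                      holder alpha (partial k (partial l f)).

(** A single nonnegative constant for all estimates, whereas the assumptions supply one constant per
    pair of indices, of unspecified sign. *)
Record regular_bounds (M : R) : Prop := {
  reg_M0 : 0 <= M;
  reg_f : forall x, `|f x| <= M;
  reg_df : forall k x, `|partial k f x| <= M;
  reg_d2f : forall k x, `|partial k (partial k f) x| <= M;
  reg_lap : forall x, `|laplacian f x| <= M;
  reg_hold : forall x y, `|laplacian f x - laplacian f y| <= M * `|x - y| `^ alpha;
  reg_lip : forall x y, `|f x - f y| <= M * `|x - y|;
  reg_dlip : forall k x y, `|partial k f x - partial k f y| <= M * `|x - y| }.

Lemma regularity : exists M, regular_bounds M.
Proof.
have [M0 fM] := fb.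
have /choice[M2 M2P] : forall kl : 'I_d * 'I_d, exists M,
    forall x, `|partial kl.1 (partial kl.2 f) x| <= M.
  by move=> kl; have [[M MP] _] := f2 kl.1 kl.2; exists M.
have /choice[C2 C2P] : forall kl : 'I_d * 'I_d, exists C, forall x y,
    `|partial kl.1 (partial kl.2 f) x - partial kl.1 (partial kl.2 f) y|
      <= C * `|x - y| `^ alpha.
  by move=> kl; have [_ [C CP]] := f2 kl.1 kl.2; exists C.
pose N := \sum_kl `|M2 kl|.
pose C := \sum_kl `|C2 kl|.
have N0 : 0 <= N by exact: sumr_ge0.
have C0 : 0 <= C by exact: sumr_ge0.
have NP k l x : `|partial k (partial l f) x| <= N.
  rewrite (le_trans (M2P (k, l) x))// (le_trans (ler_norm _))//.
  by rewrite /N (bigD1 (k, l))//= lerDl sumr_ge0.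
have CP k l x y : `|partial k (partial l f) x - partial k (partial l f) y|
    <= C * `|x - y| `^ alpha.
  rewrite (le_trans (C2P (k, l) x y))// ler_wpM2r ?powR_ge0//.
  rewrite (le_trans (ler_norm _))//.
  by rewrite /C (bigD1 (k, l))//= lerDl sumr_ge0.
have M00 : 0 <= M0 by exact: le_trans (fM 0).
have d1 k y : derivable f y (evec k) by have [] := df k k y.
have d2 l k y : derivable (partial l f) y (evec k) by have [] := df k l y.
(* Landau: a unit step of [f] controls its slope up to the oscillation of the slope. *)
have D1 k x : `|partial k f x| <= 2 * M0 + N.
  have [th th1 E] := MVT_line x 1 (d1 k).
  rewrite mulr1 in E.
  have [th' _ E'] := MVT_line x th (d2 k k).
  have -> : partial k f x = (f (x + 1 *: evec k) - f x) -
      partial k (partial k f) (x + th' *: evec k) * th by rewrite -E' E; ring.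
  rewrite (le_trans (ler_normB _ _))// lerD//.
    by rewrite (le_trans (ler_normB _ _))// mulr_natl mulr2n lerD.
  rewrite normrM -[leRHS]mulr1 ler_pM//.
  by rewrite normr1 in th1.
have lip1 := lipschitz_of_partials d1 D1.
have lip2 k := lipschitz_of_partials (d2 k) (NP ^~ k).
have D0 : 0 <= 2 * M0 + N by rewrite addr_ge0// mulr_ge0.
pose M := M0 + (2 * M0 + N) + d%:R * N + d%:R * C + d%:R * (2 * M0 + N) + N.
have p1 : 0 <= d%:R * N by rewrite mulr_ge0.
have p2 : 0 <= d%:R * C by rewrite mulr_ge0.
have p3 : 0 <= d%:R * (2 * M0 + N) by rewrite mulr_ge0.
exists M; split.
- by rewrite /M; lra.
- by move=> x; rewrite (le_trans (fM x))// /M; lra.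
- by move=> k x; rewrite (le_trans (D1 k x))// /M; lra.
- by move=> k x; rewrite (le_trans (NP k k x))// /M; lra.
- move=> x; rewrite (@le_trans _ _ (d%:R * N))//; last by rewrite /M; lra.
  rewrite /laplacian (le_trans (ler_norm_sum _ _ _))//.
  rewrite (le_trans (ler_sum _ (fun k _ => NP k k x)))//.
  by rewrite sumr_const card_ord mulr_natl.
- move=> x y; rewrite (@le_trans _ _ (d%:R * C * `|x - y| `^ alpha))//; last first.
    by rewrite ler_wpM2r ?powR_ge0// /M; lra.
  rewrite /laplacian -sumrB (le_trans (ler_norm_sum _ _ _))//.
  rewrite (le_trans (ler_sum _ (fun k _ => CP k k x y)))//.
  by rewrite sumr_const card_ord -[leLHS]mulr_natl mulrA.
- move=> x y; rewrite (le_trans (lip1 _ _))// ler_wpM2r// /M; lra.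
- move=> k x y; rewrite (le_trans (lip2 _ _ _))// ler_wpM2r// /M; lra.
Qed.

End regularity.

Lemma norm_le_1Dsqr {R : realType} (w : R) : `|w| <= 1 + w ^+ 2.
Proof.
rewrite -(real_normK (num_real w)); move: (normr_ge0 w); move: `|w| => v.
by rewrite expr2; nra.
Qed.

(** * Rows of normal variables *)

Section gaussian_rows.
Context {R : realType} {d n : nat}.
Local Notation I := ('I_d + 'I_n)%type.
Implicit Types s : coords R I.

Definition zrow (s : I -> R) : 'rV[R]_d := \row_k s (inl k).

(** One majorant for [1], [|z_k|], [|z_k^2 - 1|] and [|z|^alpha]; being a product over the
    coordinates, it and its square are integrable by independence. *)
Definition zpoly (s : I -> R) : R := \prod_k (1 + s (inl k) ^+ 2).

Lemma zrow_upd s k z : zrow (upd s (inl k) z) = zrow (upd s (inl k) 0) + z *: evec k.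
Proof.
apply/rowP => l; rewrite !mxE /upd eqxx andTb.
rewrite (_ : (inl l == inl k :> I) = (l == k))//.
by case: eqVneq => _; rewrite ?add0r ?mulr1// mulr0 addr0.
Qed.

(** Moving the base point along axis [k] and changing the [k]-th normal coordinate act on the same
    line; this is how a space derivative passes to the Gaussian kernel. *)
Lemma zrow_line (x : 'rV[R]_d) (e r : R) s k z :
  (x + e *: evec k) + r *: zrow (upd s (inl k) z) =
  (x + r *: zrow (upd s (inl k) 0)) + (e + r * z) *: evec k.
Proof.
rewrite zrow_upd scalerDr scalerA scalerDl -!addrA; congr (_ + _).
by rewrite addrCA.
Qed.

Lemma zpoly_coord s k : 1 + s (inl k) ^+ 2 <= zpoly s.
Proof.
rewrite /zpoly (bigD1 k)//= ler_peMr ?addr_ge0 ?sqr_ge0//.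
apply: (big_ind (fun x : R => 1 <= x)) => //.
  by move=> a b a1 b1; rewrite -[leLHS]mulr1 ler_pM.
by move=> i _; rewrite lerDl sqr_ge0.
Qed.

Lemma zpoly_ge1 s : 1 <= zpoly s.
Proof.
apply: (big_ind (fun x : R => 1 <= x)) => //.
  by move=> a b a1 b1; rewrite -[leLHS]mulr1 ler_pM.
by move=> i _; rewrite lerDl sqr_ge0.
Qed.

Lemma zpoly_norm s k : `|s (inl k)| <= zpoly s.
Proof.
by rewrite (le_trans _ (zpoly_coord s k))// norm_le_1Dsqr.
Qed.

Lemma zpoly_hermite s k : `|s (inl k) ^+ 2 - 1| <= zpoly s.
Proof.
rewrite (le_trans _ (zpoly_coord s k))// (le_trans (ler_normB _ _))//.
by rewrite normr1 ger0_norm ?sqr_ge0// addrC.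
Qed.

Lemma zrow_powR (alpha : R) s : 0 < alpha <= 1 -> `|zrow s| `^ alpha <= zpoly s.
Proof.
move=> /andP[a0 a1].
have h : `|zrow s| <= zpoly s.
  apply: rV_norm_leP; first exact: le_trans (zpoly_ge1 s).
  by move=> k; rewrite mxE; exact: zpoly_norm.
rewrite (@le_trans _ _ (zpoly s `^ alpha))//.
  apply: ge0_ler_powR => //; [exact: ltW|by rewrite nnegrE|].
  by rewrite nnegrE (le_trans _ (zpoly_ge1 s)).
by apply: ler1_powR => //; exact: zpoly_ge1.
Qed.

Lemma measurable_zpoly : measurable_fun setT (zpoly : coords R I -> R).
Proof.
apply: measurable_prod => k _; apply: measurable_funD => //.
by apply: measurable_funX; exact: measurable_coord.
Qed.

Lemma measurable_rV_shift (F : 'rV[R]_d -> R) (x : 'rV[R]_d) (r : coords R I -> R) :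
  continuous F -> measurable_fun setT r ->
  measurable_fun setT (fun s => F (x + r s *: zrow s)).
Proof.
move=> cF mr; apply: measurable_continuous_rV => // k.
rewrite (_ : (fun t => _) = (fun s => x 0 k + r s * s (inl k))); last first.
  by apply/funext => s; rewrite !mxE.
apply: measurable_funD => //; apply: measurable_funM => //.
exact: measurable_coord.
Qed.

End gaussian_rows.

Lemma continuous_line {R : realType} (m : nat) (F : 'rV[R]_m -> R) (x v : 'rV[R]_m) :
  continuous F -> continuous (fun y : R => F (x + y *: v)).
Proof.
move=> cF y; apply: (cvg_comp (fun y : R => x + y *: v) F); last exact: cF.
apply: cvgD; first exact: cvg_cst.
by apply: cvgZr_tmp => //; exact: cvg_id.
Qed.

(** * Space derivatives of weighted Gaussian means *)

Section weighted_smoothing.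
Context {R : realType} {d n : nat}.
Local Notation I := ('I_d + 'I_n)%type.
Variable G : probability (coords R I) R.
Hypothesis Grect : forall A, (forall i, measurable (A i)) ->
  G (rect A) = (\prod_i @gauss R (A i))%E.
Variables (kap rho : coords R I -> R).
Hypothesis mkap : measurable_fun setT kap.
Hypothesis mrho : measurable_fun setT rho.
Hypothesis kap0 : forall s, 0 <= kap s.
Hypothesis rho0 : forall s, 0 <= rho s.
Hypothesis kapU : forall s k z, kap (upd s (inl k) z) = kap s.
Hypothesis rhoU : forall s k z, rho (upd s (inl k) z) = rho s.
Hypothesis kap_rho : forall s, rho s = 0 -> kap s = 0.
Hypothesis ikap : G.-integrable setT (EFin \o kap).
Hypothesis ikap1 : G.-integrable setT
  (EFin \o (fun s => kap s * (Num.sqrt (rho s))^-1 * zpoly s)).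

Let sr s := Num.sqrt (rho s).
Let msr : measurable_fun setT sr.
Proof. exact: measurable_fun_sqrt. Qed.
Let srU s k z : sr (upd s (inl k) z) = sr s.
Proof. by rewrite /sr rhoU. Qed.
Let sr_ge0 s : 0 <= sr s. Proof. exact: sqrtr_ge0. Qed.
Let kap_sr s : sr s = 0 -> kap s = 0.
Proof.
move=> /eqP; rewrite sqrtr_eq0 => r0; apply: kap_rho.
by apply/le_anti/andP.
Qed.

Section smooth.
Variables (F : 'rV[R]_d -> R) (M : R) (k : 'I_d).
Hypothesis cF : continuous F.
Hypothesis dF : forall x, derivable F x (evec k).
Hypothesis FM : forall x, `|F x| <= M.
Hypothesis F'M : forall x, `|partial k F x| <= M.

Lemma is_derive_weighted_smooth x :
  is_derive x (evec k) (fun x => \int[G]_s (kap s * F (x + sr s *: zrow s)))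
    (\int[G]_s (kap s * partial k F (x + sr s *: zrow s))).
Proof.
apply/is_derive_line0.
have E (e : R) s : x + e *: evec k + sr s *: zrow s = (x + sr s *: zrow s) + e *: evec k.
  by rewrite addrAC.
have := @is_derive_under_integral _ _ _ G
  (fun (e : R) s => kap s * F (x + e *: evec k + sr s *: zrow s))
  (fun (e : R) s => kap s * partial k F (x + e *: evec k + sr s *: zrow s))
  0 1 (fun s => M * kap s) ltr01.
rewrite scale0r addr0; apply.
- move=> e _; have := integrableZl measurableT M ikap.
  apply: le_integrable => //.
    by apply/measurable_EFinP; apply: measurable_funM => //; exact: measurable_rV_shift.
  move=> s _ /=; rewrite lee_fin normrM (le_trans _ (ler_norm _))// mulrC.
  by rewrite (ger0_norm (kap0 s)) ler_wpM2r.
- move=> e s _; apply: is_derive1Z; rewrite E.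
  apply: (@is_derive1_eq _ (fun e : R => F ((x + sr s *: zrow s) + e *: evec k))).
    exact/is_derive_line/is_derive_partial.
  by move=> b; rewrite E.
- by have := integrableZl measurableT M ikap.
- move=> e s _; rewrite normrM mulrC (ger0_norm (kap0 s)).
  by rewrite ler_wpM2r.
Qed.

End smooth.

Section rough.
Variables (h : 'rV[R]_d -> R) (M : R) (k : 'I_d).
Hypothesis ch : continuous h.
Hypothesis hM : forall x, `|h x| <= M.

Let M0 : 0 <= M. Proof. exact: le_trans (hM 0). Qed.

Let H x s (y : R) := h ((x + sr s *: zrow (upd s (inl k) 0)) + y *: evec k).
Let mH x s : measurable_fun setT (H x s).
Proof. by apply: continuous_measurable_fun; exact: continuous_line. Qed.

Let i0 x : G.-integrable setT (EFin \o (fun s => kap s * h (x + sr s *: zrow s))).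
Proof.
have := integrableZl measurableT M ikap.
apply: le_integrable => //.
  by apply/measurable_EFinP; apply: measurable_funM => //; exact: measurable_rV_shift.
move=> s _ /=; rewrite lee_fin normrM (le_trans _ (ler_norm _))// mulrC.
by rewrite (ger0_norm (kap0 s)) ler_wpM2r.
Qed.

Let kap1 s := kap s * (sr s)^-1.
Let mkap1 : measurable_fun setT kap1.
Proof. by apply: measurable_funM => //; exact: measurable_funV. Qed.
Let kap1_ge0 s : 0 <= kap1 s. Proof. by rewrite mulr_ge0// invr_ge0. Qed.
Let kap1U s z : kap1 (upd s (inl k) z) = kap1 s.
Proof. by rewrite /kap1 kapU srU. Qed.

Let i1 x : G.-integrable setT
  (EFin \o (fun s => kap1 s * (h (x + sr s *: zrow s) * s (inl k)))).
Proof.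
have := integrableZl measurableT M ikap1.
apply: le_integrable => //.
  apply/measurable_EFinP; apply: measurable_funM => //.
  apply: measurable_funM; first exact: measurable_rV_shift.
  exact: measurable_coord.
move=> s _ /=; rewrite lee_fin (le_trans _ (ler_norm _))//.
rewrite normrM (ger0_norm (kap1_ge0 s)) normrM -/(sr s) -/(kap1 s) [leRHS]mulrCA.
by rewrite ler_wpM2l// ler_pM// zpoly_norm.
Qed.

(** With all coordinates but [z_k] frozen this is smoothing at scale [sqrt rho], whose derivative
    brings [z_k / sqrt rho]. A vanishing scale is harmless because [kap] vanishes with it. *)
Lemma is_derive_weighted_rough0 x :
  is_derive x (evec k) (fun x => \int[G]_s (kap s * h (x + sr s *: zrow s)))
    (\int[G]_s (kap1 s * (h (x + sr s *: zrow s) * s (inl k)))).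
Proof.
apply/is_derive_line0.
have E e : \int[G]_s (kap s * h (x + e *: evec k + sr s *: zrow s)) =
    \int[G]_s (kap s * \int[@gauss R]_z H x s (e + sr s * z)).
  rewrite (Rintegral_resample Grect (inl k) (i0 _)).
  apply: eq_Rintegral => s _; rewrite -RintegralZl//.
    by apply: eq_Rintegral => z _; rewrite kapU srU zrow_line.
  apply: (@integrable_gauss_poly _ _ M).
    apply: (measurableT_comp (mH x s)).
    by apply: measurable_funD => //; exact: measurable_funM.
  move=> v; rewrite (le_trans (hM _))// ler_peMr//.
  by have := sqr_ge0 v; move: (v ^+ 2) => w; rewrite expr2; nra.
have E' : \int[G]_s (kap1 s * (h (x + sr s *: zrow s) * s (inl k))) =
    \int[G]_s (kap s * ((sr s)^-1 * \int[@gauss R]_z (H x s (0 + sr s * z) * z))).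
  rewrite (Rintegral_resample Grect (inl k) (i1 _)).
  apply: eq_Rintegral => s _; rewrite mulrA -/(kap1 s) -RintegralZl//.
    apply: eq_Rintegral => z _; rewrite kap1U srU upd_same.
    by have := zrow_line x 0 (sr s) s k z; rewrite scale0r addr0 => ->.
  apply: (@integrable_gauss_poly _ _ M).
    apply: measurable_funM => //; apply: (measurableT_comp (mH x s)).
    by apply: measurable_funD => //; exact: measurable_funM.
  by move=> v; rewrite normrM; apply: ler_pM => //; [exact: hM|exact: sqr_ge_norm].
apply: (@is_derive1_eq _ (fun e : R =>
    \int[G]_s (kap s * \int[@gauss R]_z H x s (e + sr s * z)))) => //.
rewrite E'.
pose c1 : R := \int[@gauss R]_z `|z|.
apply: (@is_derive_under_integral _ _ _ G
  (fun (e : R) s => kap s * \int[@gauss R]_z H x s (e + sr s * z))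
  (fun (e : R) s => kap s * ((sr s)^-1 * \int[@gauss R]_z (H x s (e + sr s * z) * z)))
  0 1 (fun s => M * c1 * (kap s * (sr s)^-1 * zpoly s)) ltr01).
- move=> e _.
  have := integrable_resample Grect (inl k) (i0 (x + e *: evec k)).
  apply: eq_integrable => // s _ /=; congr EFin; rewrite -RintegralZl//.
    by apply: eq_Rintegral => z _; rewrite kapU srU zrow_line.
  apply: (@integrable_gauss_poly _ _ M).
    apply: (measurableT_comp (mH x s)).
    by apply: measurable_funD => //; exact: measurable_funM.
  move=> v; rewrite (le_trans (hM _))// ler_peMr//.
  by have := sqr_ge0 v; move: (v ^+ 2) => w; rewrite expr2; nra.
- move=> e s _; have [s0|s0] := eqVneq (sr s) 0.
    rewrite (kap_sr s0) mul0r; apply: (@is_derive1_eq _ (cst 0)) => // b.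
    by rewrite mul0r.
  apply: is_derive1Z.
  exact: (is_derive_smoothing_scaled0 (mH x s) (fun y => hM _) s0).
- by have := integrableZl measurableT (M * c1) ikap1.
- move=> e s _; rewrite [X in `|X|]mulrA -/(kap1 s) [X in X <= _](normrM (kap1 s)) (ger0_norm (kap1_ge0 s)).
  rewrite [leRHS]mulrCA ler_wpM2l//.
  have ii : (@gauss R).-integrable setT (EFin \o (fun z : R => H x s (e + sr s * z) * z)).
    apply: (@integrable_gauss_poly _ _ M).
      apply: measurable_funM => //; apply: (measurableT_comp (mH x s)).
      by apply: measurable_funD => //; exact: measurable_funM.
    by move=> v; rewrite normrM; apply: ler_pM => //; [exact: hM|exact: sqr_ge_norm].
  rewrite (le_trans (le_normr_Rintegral _ ii))//.
  rewrite (@le_trans _ _ (M * c1))//.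
    rewrite /c1 -RintegralZl//; last exact: integrable_gauss_norm.
    apply: le_Rintegral => //; first exact: integrable_norm.
      by have := integrableZl measurableT M (@integrable_gauss_norm R).
    by move=> z _; rewrite normrM; apply: ler_wpM2r => //; exact: hM.
  by rewrite ler_peMr ?zpoly_ge1// mulr_ge0// Rintegral_ge0.
Qed.

Section holder_case.
Variables (C alpha : R).
Hypothesis al : 0 < alpha <= 1.
Hypothesis C0 : 0 <= C.
Hypothesis hC : forall x y, `|h x - h y| <= C * `|x - y| `^ alpha.
Hypothesis ikap2 : G.-integrable setT
  (EFin \o (fun s => kap s * (rho s)^-1 * (sr s `^ alpha) * zpoly s ^+ 2)).

Let kap2 s := kap s * (rho s)^-1.
Let mkap2 : measurable_fun setT kap2.
Proof. by apply: measurable_funM => //; exact: measurable_funV. Qed.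
Let kap2_ge0 s : 0 <= kap2 s. Proof. by rewrite mulr_ge0// invr_ge0. Qed.
Let kap2U s z : kap2 (upd s (inl k) z) = kap2 s.
Proof. by rewrite /kap2 kapU rhoU. Qed.
Let kap12 s : kap1 s * (sr s)^-1 = kap2 s.
Proof.
rewrite /kap1 /kap2 -mulrA -invfM -expr2 sqr_sqrtr//.
Qed.

Lemma integrable_weighted_rough1 x : G.-integrable setT (EFin \o (fun s => kap2 s *
    ((h (x + sr s *: zrow s) - h x) * (s (inl k) ^+ 2 - 1)))).
Proof.
have := integrableZl measurableT C ikap2.
apply: le_integrable => //.
  apply/measurable_EFinP; apply: measurable_funM => //.
  apply: measurable_funM.
    by apply: measurable_funB => //; exact: measurable_rV_shift.
  by apply: measurable_funB => //; apply: measurable_funX; exact: measurable_coord.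
move=> s _ /=; rewrite lee_fin (le_trans _ (ler_norm _))//.
rewrite normrM (ger0_norm (kap2_ge0 s)) normrM -/(kap2 s).
rewrite (_ : C * _ = kap2 s * (C * (sr s `^ alpha) * zpoly s ^+ 2)); last first.
  by move: (kap2 s) (sr s `^ alpha) (zpoly s) => q1 q2 q3; ring.
rewrite ler_wpM2l// expr2 mulrA ler_pM//; last exact: zpoly_hermite.
rewrite (le_trans (hC _ _))// -mulrA ler_wpM2l//.
rewrite addrAC subrr add0r normrZ powRM// (ger0_norm (sr_ge0 s)).
by rewrite ler_wpM2l ?powR_ge0//; exact: zrow_powR.
Qed.

(** Since [z^2 - 1] has mean 0, any constant may be subtracted from [H], which gives the Hoelder
    bound a difference to act on. *)
Let hermite_shift x s e c :
  \int[@gauss R]_z (H x s (e + sr s * z) * (z ^+ 2 - 1)) =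
  \int[@gauss R]_z ((H x s (e + sr s * z) - c) * (z ^+ 2 - 1)).
Proof.
have ih2 : (@gauss R).-integrable setT (EFin \o (fun z : R => z ^+ 2 - 1)).
  apply: (@integrable_gauss_poly _ _ 1).
    by apply: measurable_funB => //; exact: measurable_funX.
  move=> v; rewrite (le_trans (ler_normB _ _))// normr1 ger0_norm ?sqr_ge0//.
  by have := sqr_ge0 v; move: (v ^+ 2) => w; rewrite expr2; nra.
have ih : (@gauss R).-integrable setT
    (EFin \o (fun z : R => H x s (e + sr s * z) * (z ^+ 2 - 1))).
  apply: (@integrable_gauss_poly _ _ M).
    apply: measurable_funM; last by apply: measurable_funB => //; exact: measurable_funX.
    apply: (measurableT_comp (mH x s)).
    by apply: measurable_funD => //; exact: measurable_funM.
  move=> v; rewrite normrM; apply: ler_pM => //; first exact: hM.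
  rewrite (le_trans (ler_normB _ _))// normr1 ger0_norm ?sqr_ge0//.
  by have := sqr_ge0 v; move: (v ^+ 2) => w; rewrite expr2; nra.
transitivity (\int[@gauss R]_z (H x s (e + sr s * z) * (z ^+ 2 - 1) - c * (z ^+ 2 - 1))).
  rewrite RintegralB//; last first.
    by have := integrableZl measurableT c ih2.
  by rewrite RintegralZl// Rintegral_gauss_hermite2 mulr0 subr0.
by apply: eq_Rintegral => z _; rewrite mulrBl.
Qed.

(** The second kernel derivative brings [(z_k^2 - 1) / rho]; the increment of [h] over a distance of
    order [sqrt rho] repays [rho^(alpha/2)]. *)
Lemma is_derive_weighted_rough1 x :
  is_derive x (evec k)
    (fun x => \int[G]_s (kap1 s * (h (x + sr s *: zrow s) * s (inl k))))
    (\int[G]_s (kap2 s * ((h (x + sr s *: zrow s) - h x) * (s (inl k) ^+ 2 - 1)))).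
Proof.
apply/is_derive_line0.
have iz e s : (@gauss R).-integrable setT (EFin \o (fun z : R => H x s (e + sr s * z) * z)).
  apply: (@integrable_gauss_poly _ _ M).
    apply: measurable_funM => //; apply: (measurableT_comp (mH x s)).
    by apply: measurable_funD => //; exact: measurable_funM.
  by move=> v; rewrite normrM; apply: ler_pM => //; [exact: hM|exact: sqr_ge_norm].
have E1 e s : \int[@gauss R]_z (kap1 (upd s (inl k) z) *
      (h (x + e *: evec k + sr (upd s (inl k) z) *: zrow (upd s (inl k) z)) *
        upd s (inl k) z (inl k))) =
    kap1 s * \int[@gauss R]_z (H x s (e + sr s * z) * z).
  rewrite -RintegralZl//.
  by apply: eq_Rintegral => z _; rewrite kap1U srU zrow_line upd_same.
have E e : \int[G]_s (kap1 s * (h (x + e *: evec k + sr s *: zrow s) * s (inl k))) =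
    \int[G]_s (kap1 s * \int[@gauss R]_z (H x s (e + sr s * z) * z)).
  rewrite (Rintegral_resample Grect (inl k) (i1 _)).
  by apply: eq_Rintegral => s _; exact: E1.
have mdiff e s c : measurable_fun setT (fun z : R => (H x s (e + sr s * z) - c) * (z ^+ 2 - 1)).
  apply: measurable_funM; last by apply: measurable_funB => //; exact: measurable_funX.
  apply: measurable_funB => //; apply: (measurableT_comp (mH x s)).
  by apply: measurable_funD => //; exact: measurable_funM.
have idiff e s c : (@gauss R).-integrable setT
    (EFin \o (fun z : R => (H x s (e + sr s * z) - c) * (z ^+ 2 - 1))).
  apply: (@integrable_gauss_poly _ _ (M + `|c|)) => //.
  move=> v; rewrite normrM ler_pM//.
    by rewrite (le_trans (ler_normB _ _))// lerD2r; exact: hM.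
  rewrite (le_trans (ler_normB _ _))// normr1 ger0_norm ?sqr_ge0//.
  by have := sqr_ge0 v; move: (v ^+ 2) => w; rewrite expr2; nra.
have E' : \int[G]_s (kap2 s * ((h (x + sr s *: zrow s) - h x) * (s (inl k) ^+ 2 - 1))) =
    \int[G]_s (kap1 s * ((sr s)^-1 *
        \int[@gauss R]_z (H x s (0 + sr s * z) * (z ^+ 2 - 1)))).
  rewrite (Rintegral_resample Grect (inl k) (integrable_weighted_rough1 _)).
  (* The subtracted value [h x] is the same for all [s], so it can be taken back inside the outer
     integral. *)
  apply: eq_Rintegral => s _; rewrite mulrA kap12 (hermite_shift x s 0 (h x)) -RintegralZl//.
  apply: eq_Rintegral => z _; rewrite kap2U srU upd_same.
  by have := zrow_line x 0 (sr s) s k z; rewrite scale0r addr0 => ->.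
apply: (@is_derive1_eq _ (fun e : R =>
    \int[G]_s (kap1 s * \int[@gauss R]_z (H x s (e + sr s * z) * z)))) => //.
rewrite E'.
pose c2 : R := \int[@gauss R]_z ((1 + z ^+ 2) ^+ 2).
have ic2 : (@gauss R).-integrable setT (EFin \o (fun z : R => (1 + z ^+ 2) ^+ 2)).
  apply: (@integrable_gauss_poly _ _ 1).
    by apply: measurable_funX; apply: measurable_funD => //; exact: measurable_funX.
  by move=> v; rewrite mul1r ger0_norm// exprn_ge0// addr_ge0// sqr_ge0.
apply: (@is_derive_under_integral _ _ _ G
  (fun (e : R) s => kap1 s * \int[@gauss R]_z (H x s (e + sr s * z) * z))
  (fun (e : R) s => kap1 s * ((sr s)^-1 *
      \int[@gauss R]_z (H x s (e + sr s * z) * (z ^+ 2 - 1))))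
  0 1 (fun s => C * c2 * (kap s * (rho s)^-1 * (sr s `^ alpha) * zpoly s ^+ 2)) ltr01).
- move=> e _.
  have := integrable_resample Grect (inl k) (i1 (x + e *: evec k)).
  by apply: eq_integrable => // s _ /=; congr EFin; exact: E1.
- move=> e s _; have [s0|s0] := eqVneq (sr s) 0.
    rewrite /kap1 (kap_sr s0) !mul0r; apply: (@is_derive1_eq _ (cst 0)) => // b.
    by rewrite mul0r.
  apply: is_derive1Z.
  exact: (is_derive_smoothing_scaled1 (mH x s) (fun y => hM _) s0).
- by have := integrableZl measurableT (C * c2) ikap2.
- move=> e s _; rewrite [X in `|X|]mulrA kap12 [X in X <= _](normrM (kap2 s)) (ger0_norm (kap2_ge0 s)).
  rewrite -/(kap2 s) (_ : C * c2 * _ = kap2 s * (C * (sr s `^ alpha) * (c2 * zpoly s ^+ 2)));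
    last first.
    by move: (kap2 s) (sr s `^ alpha) (zpoly s) c2 => q1 q2 q3 q4; ring.
  (* For the domination the constant is the value at [e] itself: the two points then differ by
     [sqrt rho * z] along one axis, uniformly in [e]. *)
  rewrite ler_wpM2l// (hermite_shift x s e (H x s e)).
  rewrite (le_trans (le_normr_Rintegral _ (idiff _ _ _)))//.
  have Ca : 0 <= C * sr s `^ alpha by rewrite mulr_ge0 ?powR_ge0.
  rewrite (@le_trans _ _ (C * sr s `^ alpha * c2))//; last first.
    rewrite ler_wpM2l// ler_peMr//.
      by apply: Rintegral_ge0 => z _; rewrite exprn_ge0// addr_ge0// sqr_ge0.
    by rewrite exprn_ege1// zpoly_ge1.
  rewrite /c2 -RintegralZl//; apply: le_Rintegral => //.
  + exact: integrable_norm.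
  + by have := integrableZl measurableT (C * sr s `^ alpha) ic2.
  move=> z _; rewrite normrM expr2 mulrA ler_pM//; last first.
    by rewrite (le_trans (ler_normB _ _))// normr1 ger0_norm ?sqr_ge0// addrC.
  rewrite (le_trans (hC _ _))// -mulrA ler_wpM2l//.
  rewrite opprD addrACA subrr add0r -scalerBl addrAC subrr add0r normrZ.
  rewrite powRM// normrM powRM// (ger0_norm (sr_ge0 s)) -mulrA ler_wpM2l ?powR_ge0//.
  have /andP[a0 a1] := al.
  have p1 : 1 `^ alpha = 1 :> R by rewrite powR1.
  rewrite -[leRHS]mulr1 ler_pM ?powR_ge0//; last first.
    rewrite -[leRHS]p1; apply: ge0_ler_powR; rewrite ?nnegrE//; first exact: ltW.
    exact: norm_evec_le1.
  have [z1|z1] := leP 1 `|z|.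
    by rewrite (le_trans (ler1_powR z1 a1))//; exact: norm_le_1Dsqr.
  rewrite (@le_trans _ _ 1)//; last by rewrite lerDl sqr_ge0.
  rewrite -[leRHS]p1; apply: ge0_ler_powR; rewrite ?nnegrE//; first exact: ltW.
  exact: ltW.
Qed.

End holder_case.
End rough.
End weighted_smoothing.

Lemma powR_prod {R : realType} (J : finType) (F : J -> R) (p : R) :
  (forall i, 0 <= F i) -> (\prod_i F i) `^ p = \prod_i (F i `^ p).
Proof.
move=> F0; elim: (index_enum J) => [|i r ih]; first by rewrite !big_nil powR1.
by rewrite !big_cons powRM ?ih// prodr_ge0.
Qed.

(** * Integrability of the weights *)

Section concrete_weights.
Context {R : realType} {d n : nat}.
Local Notation I := ('I_d + 'I_n)%type.
Variable G : probability (coords R I) R.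
Hypothesis Grect : forall A, (forall i, measurable (A i)) ->
  G (rect A) = (\prod_i @gauss R (A i))%E.

Lemma integrable_prod_zpoly (q : 'I_n -> R -> R) :
  (forall i, measurable_fun setT (q i)) -> (forall i z, 0 <= q i z) ->
  (forall i, (@gauss R).-integrable setT (EFin \o q i)) ->
  G.-integrable setT
    (EFin \o (fun s : coords R I => \prod_i q i (s (inr i)) * zpoly s ^+ 2)).
Proof.
move=> mq q0 iq.
pose g (a : I) : R -> R := match a with
  inl k => fun z => (1 + z ^+ 2) ^+ 2 | inr i => q i end.
have mz : measurable_fun setT (fun z : R => (1 + z ^+ 2) ^+ 2).
  by apply: measurable_funX; apply: measurable_funD => //; exact: measurable_funX.
have := @integrable_prod_coords _ _ _ Grect g _ _ _.
move=> /(_ _ _ _)/wrap[].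
- by case.
- by case=> [k z|i z] /=; [rewrite exprn_ge0// addr_ge0// sqr_ge0|exact: q0].
- case=> [k|i] /=; last exact: iq.
  apply: (@integrable_gauss_poly _ _ 1) => // v.
  by rewrite mul1r ger0_norm// exprn_ge0// addr_ge0// sqr_ge0.
apply: eq_integrable => // s _ /=; congr EFin.
by rewrite big_sumType/= mulrC -prodrXl.
Qed.

Lemma Rintegral_prod_coords (q : 'I_n -> R -> R) :
  (forall i, measurable_fun setT (q i)) -> (forall i z, 0 <= q i z) ->
  (forall i, (@gauss R).-integrable setT (EFin \o q i)) ->
  \int[G]_s (\prod_i q i (s (inr i))) = \prod_i \int[@gauss R]_z q i z.
Proof.
move=> mq q0 iq.
pose g (a : I) : R -> R := match a with inl k => cst 1 | inr i => q i end.
have := @ge0_integral_prod_coords _ _ _ Grect g (index_enum I) (index_enum_uniq _) _ _ _.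
move=> /(_ _ _ _)/wrap[].
- by case=> [k|i] /=.
- by case=> [k z|i z] //=.
- by case=> [k|i] /=; [exact: integrable_gauss_cst|exact: iq].
rewrite big_sumType/= [X in (X * _)%:E]big1 ?mul1r; last first.
  by move=> k _; exact: Rintegral_gauss_cst.
move=> E; rewrite /Rintegral.
have -> : (\int[G]_s (\prod_i q i (s (inr i)))%:E =
    \int[G]_s (\prod_(i <- index_enum I) g i (s i))%:E)%E.
  apply: eq_integral => s _; rewrite big_sumType/= [X in (_ = (X * _)%:E)%E]big1 ?mul1r//.
by rewrite E.
Qed.

Variables (t : 'rV[R]_n) (j : 'I_n).
Hypothesis ot : orthant_interior n t.

Definition rho (s : coords R I) : R := \prod_i `|Num.sqrt (t 0 i) * s (inr i)|.

(* Equals (prod_(i != j) sqrt(t_i) |s_i|)^2, except that it is 0 where s_j = 0. *)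
Definition kap (s : coords R I) : R := (t 0 j)^-1 * (rho s ^+ 2 * s (inr j) ^- 2).

Let t0 i : 0 < t 0 i. Proof. exact: ot. Qed.
Let tV : 0 <= (t 0 j)^-1. Proof. by rewrite invr_ge0 ltW. Qed.

Lemma rho_ge0 s : 0 <= rho s. Proof. exact: prodr_ge0. Qed.

Lemma measurable_rho : measurable_fun setT rho.
Proof.
apply: measurable_prod => i _; apply: measurableT_comp => //.
by apply: measurable_funM => //; exact: measurable_coord.
Qed.

Lemma kap_ge0 s : 0 <= kap s.
Proof.
apply: mulr_ge0; first by rewrite invr_ge0 ltW.
by apply: mulr_ge0; [rewrite exprn_ge0 ?rho_ge0|rewrite invr_ge0 sqr_ge0].
Qed.

Lemma measurable_kap : measurable_fun setT kap.
Proof.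
apply: measurable_funM => //; apply: measurable_funM.
  by apply: measurable_funX; exact: measurable_rho.
by apply: measurable_funV; apply: measurable_funX; exact: measurable_coord.
Qed.

Lemma rho_updl s k z : rho (upd s (inl k) z) = rho s. Proof. by []. Qed.

Lemma kap_updl s k z : kap (upd s (inl k) z) = kap s. Proof. by []. Qed.

Lemma rho_split s : rho s =
  Num.sqrt (t 0 j) * `|s (inr j)| * \prod_(i | i != j) `|Num.sqrt (t 0 i) * s (inr i)|.
Proof.
by rewrite /rho (bigD1 j)//= normrM (ger0_norm (sqrtr_ge0 _)).
Qed.

Lemma kapE s : s (inr j) != 0 ->
  kap s = (\prod_(i | i != j) `|Num.sqrt (t 0 i) * s (inr i)|) ^+ 2.
Proof.
move=> sj; rewrite /kap rho_split !exprMn sqr_sqrtr ?ltW//.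
rewrite real_normK ?num_real//.
have tj : t 0 j != 0 by rewrite gt_eqF.
by move: (t 0 j) (s (inr j)) tj sj (\prod_(_ | _) _) => a b a0 b0 c; field; rewrite a0 b0.
Qed.

Lemma kap_rho s : rho s = 0 -> kap s = 0.
Proof. by move=> r0; rewrite /kap r0 expr0n mul0r mulr0. Qed.

Let pw (p : R) (i : 'I_n) (z : R) : R := `|Num.sqrt (t 0 i) * z| `^ p.

Let pwE p i z : pw p i z = (Num.sqrt (t 0 i)) `^ p * `|z| `^ p.
Proof. by rewrite /pw normrM powRM// (ger0_norm (sqrtr_ge0 _)). Qed.

Let mpow p : measurable_fun setT (fun z : R => `|z| `^ p).
Proof.
rewrite [X in measurable_fun _ X](_ : _ = (@powR R ^~ p) \o Num.norm)//.
by apply: measurableT_comp.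
Qed.

Let mpw p i : measurable_fun setT (pw p i).
Proof.
rewrite (_ : pw p i = fun z => (Num.sqrt (t 0 i)) `^ p * `|z| `^ p); last exact/funext/pwE.
by apply: measurable_funM => //; exact: mpow.
Qed.

Let ipw p i : -1 < p -> p <= 2 -> (@gauss R).-integrable setT (EFin \o pw p i).
Proof.
move=> p1 p2.
have := integrableZl measurableT (Num.sqrt (t 0 i) `^ p) (integrable_gauss_powR p1 p2).
by apply: eq_integrable => // z _ /=; rewrite pwE.
Qed.

Lemma integrable_rho_zpoly : G.-integrable setT (EFin \o (fun s => rho s * zpoly s ^+ 2)).
Proof.
have := @integrable_prod_zpoly (pw 1) (mpw 1) _ _.
move=> /(_ _ _)/wrap[].
- by move=> i z; exact: powR_ge0.
- by move=> i; apply: ipw; [lra|lra].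
apply: eq_integrable => // s _ /=; congr (_ * _)%:E.
by apply: eq_bigr => i _; rewrite /pw powRr1.
Qed.

Lemma integrable_zpoly : G.-integrable setT (EFin \o (fun s => zpoly s ^+ 2)).
Proof.
have := @integrable_prod_zpoly (fun=> cst 1) _ _ _.
move=> /(_ _ _ _)/wrap[] //.
- by move=> i; exact: integrable_gauss_cst.
by apply: eq_integrable => // s _ /=; rewrite big1 ?mul1r.
Qed.

Lemma Rintegral_rho : \int[G]_s rho s = \prod_i (Num.sqrt (t 0 i) * Num.sqrt (2 / pi)).
Proof.
have -> : \int[G]_s rho s = \int[G]_s \prod_i pw 1 i (s (inr i)).
  by apply: eq_Rintegral => s _; apply: eq_bigr => i _; rewrite /pw powRr1.
rewrite Rintegral_prod_coords//; last 2 first.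
- by move=> i z; exact: powR_ge0.
- by move=> i; apply: ipw; lra.
apply: eq_bigr => i _; rewrite -Rintegral_gauss_norm -RintegralZl//; last first.
  exact: integrable_gauss_norm.
by apply: eq_Rintegral => z _; rewrite pwE !powRr1 ?sqrtr_ge0.
Qed.

(** In [s_j] the integrand has order [|s_j|^(p - 2)] near 0, which is integrable because [p > 1].
    The derivatives of the weighted mean call for [p = 2], [p = 3/2] and [p = 1 + alpha/2]. *)
Lemma integrable_rho_pow (p : R) : 1 < p -> p <= 2 ->
  G.-integrable setT (EFin \o (fun s => rho s `^ p * s (inr j) ^- 2 * zpoly s ^+ 2)).
Proof.
move=> p1 p2.
pose q i (z : R) : R := if i == j then pw p i z * z ^- 2 else pw p i z.
have mV2 : measurable_fun setT (fun z : R => z ^- 2).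
  by apply: measurable_funV; exact: measurable_funX.
have := @integrable_prod_zpoly q _ _ _.
move=> /(_ _ _ _)/wrap[].
- by move=> i; rewrite /q; case: (i == j); [exact: measurable_funM|exact: mpw].
- move=> i z; rewrite /q; case: ifP => _; last exact: powR_ge0.
  by rewrite mulr_ge0 ?powR_ge0// invr_ge0 sqr_ge0.
- move=> i; rewrite /q; case: (i == j); last by apply: ipw => //; lra.
  have ip2 : (@gauss R).-integrable setT (EFin \o (fun z : R => `|z| `^ (p - 2))).
    by apply: integrable_gauss_powR; lra.
  have := integrableZl measurableT (Num.sqrt (t 0 i) `^ p) ip2.
  apply: le_integrable => //.
    by apply/measurable_EFinP; exact: measurable_funM (mpw p i) mV2.
  move=> z _ /=; rewrite lee_fin pwE (le_trans _ (ler_norm _))//.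
  rewrite ger0_norm; last by rewrite !mulr_ge0 ?powR_ge0// invr_ge0 sqr_ge0.
  rewrite -mulrA ler_wpM2l ?powR_ge0//.
  (* At 0 the convention [0^-1 = 0] makes the left side vanish. *)
  have [->|z0] := eqVneq z 0.
    by rewrite expr0n invr0 mulr0 powR_ge0.
  rewrite powRB ?normr_eq0 ?z0 ?implybT// powR_mulrn// real_normK ?num_real//.
apply: eq_integrable => // s _ /=; congr (_ * _)%:E.
rewrite powR_prod// (bigD1 j)//= [in RHS](bigD1 j)//= {1}/q eqxx /pw mulrAC; congr (_ * _ * _).
by apply: eq_bigr => i ij; rewrite /q (negbTE ij).
Qed.

Let rho_pow_div (p q : R) s : 0 < p -> 0 < q -> rho s `^ (p + q) / rho s `^ q = rho s `^ p.
Proof.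
move=> p0 q0; have [->|r0] := eqVneq (rho s) 0.
  by rewrite !powR0 ?mul0r// gt_eqF// addr_gt0.
by rewrite powRD ?r0 ?implybT// mulfK// powR_eq0 negb_and r0.
Qed.

Let zpoly_ge0 (s : I -> R) : 0 <= zpoly s. Proof. exact: le_trans (zpoly_ge1 s). Qed.
Let zpoly2_ge1 (s : I -> R) : 1 <= zpoly s ^+ 2. Proof. by rewrite exprn_ege1// zpoly_ge1. Qed.
Let zpoly2_le (s : I -> R) : zpoly s <= zpoly s ^+ 2.
Proof. by rewrite expr2 ler_peMr// zpoly_ge1. Qed.

Lemma integrable_kap : G.-integrable setT (EFin \o kap).
Proof.
have := integrableZl measurableT (t 0 j)^-1 (@integrable_rho_pow 2 _ (lexx _)).
move=> /(_ _)/wrap[]; first by lra.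
apply: le_integrable => //; first by apply/measurable_EFinP; exact: measurable_kap.
move=> s _ /=; rewrite lee_fin (ger0_norm (kap_ge0 s)) (le_trans _ (ler_norm _))//.
rewrite /kap ler_wpM2l// powR_mulrn ?rho_ge0// ler_peMr//.
by rewrite mulr_ge0 ?exprn_ge0 ?rho_ge0// invr_ge0 sqr_ge0.
Qed.

Lemma integrable_kap1 : G.-integrable setT
  (EFin \o (fun s => kap s * (Num.sqrt (rho s))^-1 * zpoly s)).
Proof.
have h : 1 < 2^-1 + 1 :> R by lra.
have h' : 2^-1 + 1 <= 2 :> R by lra.
have := integrableZl measurableT (t 0 j)^-1 (@integrable_rho_pow (1 + 2^-1) _ _).
move=> /(_ _ _)/wrap[]; [by lra|by lra|].
apply: le_integrable => //.
  apply/measurable_EFinP; apply: measurable_funM; last exact: measurable_zpoly.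
  apply: measurable_funM; first exact: measurable_kap.
  by apply: measurable_funV; apply: measurable_fun_sqrt; exact: measurable_rho.
move=> s _ /=; rewrite lee_fin (le_trans _ (ler_norm _))//.
rewrite ger0_norm; last first.
  apply: mulr_ge0; last exact: zpoly_ge0.
  by apply: mulr_ge0; [exact: kap_ge0|rewrite invr_ge0 sqrtr_ge0].
have -> : kap s * (Num.sqrt (rho s))^-1 =
    (t 0 j)^-1 * (rho s `^ (1 + 2^-1) * s (inr j) ^- 2).
  rewrite -(@rho_pow_div (1 + 2^-1) 2^-1) ?addr_gt0 ?invr_gt0//.
  rewrite powR12_sqrt ?rho_ge0// (_ : 1 + 2^-1 + 2^-1 = 2); last by lra.
  rewrite powR_mulrn ?rho_ge0// /kap.
  by move: (t 0 j)^-1 (rho s ^+ 2) (s (inr j) ^- 2) (Num.sqrt (rho s))^-1 => a b c e; ring.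
rewrite -[leLHS]mulrA ler_wpM2l// ler_wpM2l//.
by rewrite mulr_ge0 ?powR_ge0// invr_ge0 sqr_ge0.
Qed.

Lemma kap_div_rho s : kap s * (rho s)^-1 = (t 0 j)^-1 * (rho s * s (inr j) ^- 2).
Proof.
have [r0|r0] := eqVneq (rho s) 0; first by rewrite (kap_rho r0) r0 !mul0r mulr0.
rewrite /kap; move: (t 0 j)^-1 (s (inr j) ^- 2) (rho s) r0 => a b c c0; by field.
Qed.

Lemma integrable_kap2 (alpha : R) : 0 < alpha <= 1 -> G.-integrable setT
  (EFin \o (fun s => kap s * (rho s)^-1 * (Num.sqrt (rho s) `^ alpha) * zpoly s ^+ 2)).
Proof.
move=> /andP[a0 a1].
have := integrableZl measurableT (t 0 j)^-1 (@integrable_rho_pow (1 + 2^-1 * alpha) _ _).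
move=> /(_ _ _)/wrap[]; [by lra|by lra|].
apply: eq_integrable => // s _ /=; congr EFin; rewrite mulrA; congr (_ * _).
rewrite kap_div_rho -!mulrA; congr (_ * _).
rewrite -powR12_sqrt ?rho_ge0// -powRrM.
have [r0|r0] := eqVneq (rho s) 0.
  by rewrite r0 powR0 ?mul0r// gt_eqF// addr_gt0// mulr_gt0.
rewrite powRD ?r0 ?implybT// powRr1 ?rho_ge0// -mulrA; congr (_ * _).
by rewrite mulrC.
Qed.

End concrete_weights.

(** * The scaling identity *)

Section radial_kernel.
Context {R : realType}.
Local Notation mu := (@lebesgue_measure R).
Variables (d : nat) (a A : R).
Hypothesis A0 : 0 < A.
Hypothesis ad : 0 <= a <= d%:R.

(** Used with [a = d / 2] and [A = |z|^2 / (2 c)], where [rho = c y]: the normal weight of [y] times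
    the part depending on [y] of the density of [sqrt rho * z] relative to the normal law. *)
Definition radial (y : R) : R := gauss_pdf y * (y `^ (- a) * expR (- A / y)).
Definition radial' (y : R) : R := radial y * (- y - a / y + A / y ^+ 2).

Lemma is_derive_radial (y : R) : 0 < y -> is_derive y 1 radial (radial' y).
Proof.
move=> y0.
have yn0 : y != 0 by rewrite gt_eqF.
have d1 : is_derive y 1 (fun y : R => - A / y) (A / y ^+ 2).
  apply: (@is_derive_eq _ _ _ _ _ _ _ (- A * (- y ^- 2 * 1))); last by field.
  by apply: is_derive1Z; apply: is_deriveV.
have d2 : is_derive y 1 (fun y => expR (- A / y)) (expR (- A / y) * (A / y ^+ 2)).
  by apply: is_derive1_comp.
have d3 := is_derive1_powR (- a) y0.
have := is_derive1M (is_derive_gauss_pdf y) (is_derive1M d3 d2).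
move=> /is_derive_eq; apply.
rewrite /radial' /radial.
have -> : y `^ (- a - 1) = y `^ (- a) / y.
  by rewrite powRB ?powRr1 ?ltW// yn0 implybT.
move: (gauss_pdf y) (y `^ (- a)) (expR (- A / y)) => p1 p2 p3.
by field.
Qed.

Lemma continuous_radial' (y : R) : 0 < y -> {for y, continuous radial'}.
Proof.
move=> y0.
have yn0 : y != 0 by rewrite gt_eqF.
have cr : {for y, continuous radial}.
  apply: differentiable_continuous; apply/derivable1_diffP.
  exact: (@ex_derive _ _ _ _ _ _ _ (is_derive_radial y0)).
have cV : {for y, continuous (fun y : R => y^-1)} by exact: inv_continuous.
rewrite /radial'; apply: cvgM; first exact: cr.
apply: cvgD; last first.
  apply: cvgM; first exact: cvg_cst.
  apply: cvgV; first by rewrite expf_neq0.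
  exact: exprn_continuous.
apply: cvgB; first by apply: cvgN; exact: cvg_id.
by apply: cvgM; [exact: cvg_cst|exact: cV].
Qed.

Lemma radial_cvgy : radial m.+2%:R @[m --> \oo] --> 0.
Proof.
have gp : gauss_pdf (m.+2%:R : R) @[m --> \oo] --> (0 : R).
  apply: (cvg_comp (fun m => m.+2%:R : R) gauss_pdf); last exact: gauss_pdf_cvg0.
  have := @cvgr_idn R; rewrite -(cvg_shiftn 2).
  by under eq_fun do rewrite addn2.
apply: (squeeze_cvgr _ (cvg_cst 0) gp).
near=> m; have /andP[a0 _] := ad; apply/andP; split.
  by rewrite mulr_ge0 ?gauss_pdf_ge0// mulr_ge0 ?powR_ge0 ?expR_ge0.
rewrite /radial ler_piMr ?gauss_pdf_ge0//.
rewrite mulr_ile1 ?powR_ge0 ?expR_ge0//.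
  rewrite powRN invf_le1 ?powR_gt0//.
  rewrite -[leLHS](powRr0 m.+2%:R); apply: ler_powR => //.
  by rewrite ler1n.
by rewrite -expR0 ler_expR mulNr oppr_le0 divr_ge0// ltW.
Unshelve. all: by end_near. Qed.

(** With [N = 1 / y] the singular power is at most [N^d], while one term of the exponential series
    gives [exp(- A N) <= (d+1)! / (A N)^(d+1)]; a factor [1 / N] is left over. *)
Lemma radial_cvg0 : radial m.+2%:R^-1 @[m --> \oo] --> 0.
Proof.
have /andP[a0 ad'] := ad.
pose C := normal_peak 1 * (d.+1`!%:R / A ^+ d.+1) : R.
have cC : C / m.+2%:R @[m --> \oo] --> (0 : R).
  rewrite -(mulr0 C); apply: cvgM; first exact: cvg_cst.
  have := @cvg_harmonic R; rewrite -(cvg_shiftS) /harmonic/=.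
  by [].
apply: (squeeze_cvgr _ (cvg_cst 0) cC).
near=> m; apply/andP; split.
  by rewrite mulr_ge0 ?gauss_pdf_ge0// mulr_ge0 ?powR_ge0 ?expR_ge0.
set N : R := m.+2%:R.
have N1 : 1 <= N by rewrite /N ler1n.
have N0 : 0 < N by exact: lt_le_trans N1.
rewrite /radial invrK.
have pdfle : gauss_pdf N^-1 <= normal_peak 1.
  rewrite /gauss_pdf ler_piMr ?normal_peak_ge0// -[leRHS]expR0 ler_expR.
  by rewrite mulNr oppr_le0 divr_ge0// sqr_ge0.
rewrite /C -[leRHS]mulrA; apply: ler_pM; [exact: gauss_pdf_ge0| |exact: pdfle|].
  by apply: mulr_ge0; [exact: powR_ge0|exact: expR_ge0].
have h1 : N^-1 `^ (- a) <= N ^+ d.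
  rewrite -[N^-1](powR_inv1 (ltW N0)) -powRrM mulN1r opprK.
  by rewrite -(powR_mulrn _ (ltW N0)) ler_powR.
have h2 : expR (- A * N) <= d.+1`!%:R / (A * N) ^+ d.+1.
  have AN : 0 < A * N by exact: mulr_gt0.
  rewrite mulNr expRN -[leRHS]invrK lef_pV2 ?posrE ?expR_gt0//; last first.
    by rewrite invr_gt0 divr_gt0 ?exprn_gt0// ltr0n fact_gt0.
  rewrite invf_div (le_trans _ (expR_ge1Dxn d (ltW AN)))//.
  by rewrite ler_wpDl.
rewrite (@le_trans _ _ (N ^+ d * (d.+1`!%:R / (A * N) ^+ d.+1)))//.
  by apply: ler_pM; [exact: powR_ge0|exact: expR_ge0|exact: h1|exact: h2].
clearbody N; rewrite exprMn (exprS N) le_eqVlt; apply/orP; left; apply/eqP.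
have : N ^+ d != 0 by rewrite expf_neq0// gt_eqF.
have : N != 0 by rewrite gt_eqF.
have : A ^+ d.+1 != 0 by rewrite expf_neq0// gt_eqF.
move: (N ^+ d) (A ^+ d.+1) (d.+1`!%:R) => q1 q2 q3 n2 n3 n1.
by field; do ?[apply/andP; split].
Unshelve. all: by end_near. Qed.

Lemma Rintegral_radial'_eq0 :
  mu.-integrable setT (EFin \o (fun y : R => radial' `|y|)) ->
  \int[mu]_y radial' `|y| = 0.
Proof.
apply: Rintegral_even_eq0.
- exact: is_derive_radial.
- exact: continuous_radial'.
- exact: radial_cvgy.
- exact: radial_cvg0.
Qed.

End radial_kernel.

Section finite_sums.
Context {R : realType} {dsp : measure_display} {T : measurableType dsp}.
Variables (mu : {measure set T -> \bar R}) (J : Type) (F : J -> T -> R).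
Hypothesis iF : forall i, mu.-integrable setT (EFin \o F i).

Lemma integrable_Rsum (r : seq J) :
  mu.-integrable setT (EFin \o (fun s => \sum_(i <- r) F i s)).
Proof.
have := @integrable_sum _ _ _ mu setT measurableT J r xpredT (fun i => EFin \o F i)
  (fun i _ => iF i).
by apply: eq_integrable => // s _ /=; rewrite sumEFin.
Qed.

Lemma Rintegral_sum (r : seq J) :
  \int[mu]_s (\sum_(i <- r) F i s) = \sum_(i <- r) \int[mu]_s F i s.
Proof.
elim: r => [|a r ih].
  rewrite big_nil; under eq_Rintegral do rewrite big_nil.
  by rewrite /Rintegral integral0.
rewrite big_cons -ih -RintegralD//; last exact: integrable_Rsum.
by apply: eq_Rintegral => s _; rewrite big_cons.
Qed.

End finite_sums.

(** * The derivative in one time parameter *)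

Section time_derivative.
Context {R : realType} {d n : nat}.
Local Notation I := ('I_d + 'I_n)%type.
Variable G : probability (coords R I) R.
Hypothesis Grect : forall A, (forall i, measurable (A i)) ->
  G (rect A) = (\prod_i @gauss R (A i))%E.
Variables (f : 'rV[R]_d -> R) (alpha M : R).
Hypothesis df : forall (k l : 'I_d) x, derivable f x (evec l) /\
                          derivable (partial l f) x (evec k).
Hypothesis fM : regular_bounds f alpha M.
Hypothesis cf2 : forall k, continuous (partial k (partial k f)).

Let cf : continuous f.
Proof. exact: lipschitz_continuous_rV (reg_lip fM). Qed.
Let cdf k : continuous (partial k f).
Proof. exact: lipschitz_continuous_rV (reg_dlip fM k). Qed.

Variables (t : 'rV[R]_n) (j : 'I_n).
Hypothesis ot : orthant_interior n t.

Let t0 i : 0 < t 0 i. Proof. exact: ot. Qed.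
Let mrho (u : 'rV[R]_n) : measurable_fun setT (fun s : coords R I => Num.sqrt (rho u s)).
Proof. by apply: measurable_fun_sqrt; exact: measurable_rho. Qed.
Let zpoly_ge0 (s : I -> R) : 0 <= zpoly s. Proof. exact: le_trans (zpoly_ge1 s). Qed.
Let zpoly2_le (s : I -> R) : zpoly s <= zpoly s ^+ 2.
Proof. by rewrite expr2 ler_peMr// zpoly_ge1. Qed.

(** [rho] without its factor [sqrt t_j], so that [e] enters [sqrt rho] only through the fourth root
    of [t_j + e], whose derivative is [psi']. *)
Let r1 (s : coords R I) : R :=
  `|s (inr j)| * \prod_(i | i != j) `|Num.sqrt (t 0 i) * s (inr i)|.
Let r1_ge0 s : 0 <= r1 s. Proof. by rewrite mulr_ge0// prodr_ge0. Qed.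

Let rho_r1 (e : R) s : rho (t + e *: evec j) s = Num.sqrt (t 0 j + e) * r1 s.
Proof.
rewrite (rho_split _ j) /r1 !mxE !eqxx mulr1 -mulrA; congr (_ * (_ * _)).
by apply: eq_bigr => i ij; rewrite !mxE eqxx (negbTE ij) mulr0 addr0.
Qed.

Let sqrt_rho (e : R) s : Num.sqrt (rho (t + e *: evec j) s) =
  Num.sqrt (Num.sqrt (t 0 j + e)) * Num.sqrt (r1 s).
Proof. by rewrite rho_r1 sqrtrM// sqrtr_ge0. Qed.

Let psi' (e : R) : R :=
  (2 * Num.sqrt (Num.sqrt (t 0 j + e)))^-1 * (2 * Num.sqrt (t 0 j + e))^-1.

Let is_derive_psi (e : R) : 0 < t 0 j + e ->
  is_derive e 1 (fun e : R => Num.sqrt (Num.sqrt (t 0 j + e))) (psi' e).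
Proof.
move=> p.
have d1 : is_derive e 1 (fun e : R => t 0 j + e) 1.
  by apply: (is_derive1_eq (is_derive1_affine 1 (t 0 j) e)) => b; rewrite mul1r addrC.
have d2 : is_derive e 1 (fun e : R => Num.sqrt (t 0 j + e)) ((2 * Num.sqrt (t 0 j + e))^-1).
  have := @is_derive1_comp _ (@Num.sqrt R) (fun e : R => t 0 j + e) e _ _ (is_derive1_sqrt p) d1.
  by rewrite mulr1.
have p' : 0 < Num.sqrt (t 0 j + e) by rewrite sqrtr_gt0.
exact: (@is_derive1_comp _ (@Num.sqrt R) (fun e : R => Num.sqrt (t 0 j + e)) e _ _
  (is_derive1_sqrt p') d2).
Qed.

(** [psi'] decreases, so its value at the left end of the window bounds it there. *)
Let psi'_le (e : R) : `|e - 0| < t 0 j / 2 -> 0 <= psi' e <= psi' (- (t 0 j / 2)).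
Proof.
rewrite subr0 ltr_norml => /andP[e1 e2].
have tj := t0 j.
rewrite /psi' mulr_ge0 ?invr_ge0 ?mulr_ge0 ?sqrtr_ge0//=.
have h : 0 < t 0 j + - (t 0 j / 2) by lra.
have h' : t 0 j + - (t 0 j / 2) <= t 0 j + e by lra.
have hp : 0 < t 0 j + e by exact: lt_le_trans h'.
apply: ler_pM; rewrite ?invr_ge0 ?mulr_ge0 ?sqrtr_ge0//.
  rewrite lef_pV2 ?posrE ?mulr_gt0 ?sqrtr_gt0//.
  by rewrite ler_wpM2l// ler_wsqrtr// ler_wsqrtr.
rewrite lef_pV2 ?posrE ?mulr_gt0 ?sqrtr_gt0//.
by rewrite ler_wpM2l// ler_wsqrtr.
Qed.

Let sqrt_r1_le s : Num.sqrt (r1 s) <= 1 + (Num.sqrt (t 0 j))^-1 * rho t s.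
Proof.
have -> : (Num.sqrt (t 0 j))^-1 * rho t s = r1 s.
  have := rho_r1 0 s; rewrite scale0r !addr0 => ->.
  by rewrite mulrA mulVf ?mul1r// gt_eqF// sqrtr_gt0.
have [h|h] := leP (r1 s) 1.
  by rewrite (@le_trans _ _ 1)// ?lerDl// -[leRHS]sqrtr1 ler_wsqrtr.
rewrite (@le_trans _ _ (r1 s))// ?lerDr//.
rewrite -[leRHS](sqr_sqrtr (r1_ge0 s)) expr2 ler_peMr ?sqrtr_ge0//.
by rewrite -[leLHS]sqrtr1 ler_wsqrtr// ltW.
Qed.

Let Fx (x : 'rV[R]_d) s := x + Num.sqrt (rho t s) *: zrow s.

Let iflux x k : G.-integrable setT
  (EFin \o (fun s => Num.sqrt (rho t s) * s (inl k) * partial k f (Fx x s))).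
Proof.
have i1 := integrableD measurableT (integrable_zpoly Grect) (integrable_rho_zpoly Grect t).
have := integrableZl measurableT M i1.
apply: le_integrable => //.
  apply/measurable_EFinP; apply: measurable_funM; last exact: measurable_rV_shift.
  by apply: measurable_funM => //; exact: measurable_coord.
move=> s _ /=; rewrite lee_fin (le_trans _ (ler_norm _))// normrM normrM.
rewrite mulrC; apply: ler_pM => //; first exact: reg_df fM _ _.
rewrite -[X in _ <= X + _]mul1r -mulrDl (ger0_norm (sqrtr_ge0 _)); apply: ler_pM => //.
  have [h|h] := leP (rho t s) 1.
    rewrite (@le_trans _ _ 1)// ?lerDl ?rho_ge0// -[leRHS]sqrtr1 ler_wsqrtr//.
  rewrite (@le_trans _ _ (rho t s))// ?lerDr//.
  rewrite -[leRHS](sqr_sqrtr (rho_ge0 t s)) expr2 ler_peMr ?sqrtr_ge0//.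
  by rewrite -[leLHS]sqrtr1 ler_wsqrtr// ltW.
by rewrite (le_trans (zpoly_norm s k)).
Qed.

(** For frozen coordinates the argument of [f] moves along the direction [z], at speed
    [sqrt rho / (4 t_j)] when [e = 0]. *)
Let is_derive_time_flux x :
  is_derive t (evec j) (fun u => \int[G]_s f (x + Num.sqrt (rho u s) *: zrow s))
    ((4 * t 0 j)^-1 * \int[G]_s (\sum_k Num.sqrt (rho t s) * s (inl k) * partial k f (Fx x s))).
Proof.
apply/is_derive_line0.
have tj := t0 j.
have isum := integrable_Rsum (iflux x) (index_enum 'I_d).
have -> : (4 * t 0 j)^-1 * \int[G]_s (\sum_k Num.sqrt (rho t s) * s (inl k) *
        partial k f (Fx x s)) =
    \int[G]_s ((\sum_k (Num.sqrt (r1 s) *: zrow s) 0 k *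
      partial k f (x + Num.sqrt (Num.sqrt (t 0 j + 0)) *: (Num.sqrt (r1 s) *: zrow s))) * psi' 0).
  rewrite -RintegralZl//; apply: eq_Rintegral => s _.
  rewrite mulr_sumr mulr_suml; apply: eq_bigr => k _.
  rewrite /Fx; have := sqrt_rho 0 s; rewrite scale0r addr0 => ->.
  rewrite scalerA !mxE /psi' !addr0; set q1 := partial k f _; move: q1 (Num.sqrt (r1 s)) (s (inl k)) => q1 q2 q3.
  set a := Num.sqrt (t 0 j).
  have a0 : 0 < a by rewrite sqrtr_gt0.
  have b0 : 0 < Num.sqrt a by rewrite sqrtr_gt0.
  have Ea : a = Num.sqrt a ^+ 2 by rewrite sqr_sqrtr// ltW.
  have -> : t 0 j = (Num.sqrt a ^+ 2) ^+ 2 by rewrite -Ea sqr_sqrtr// ltW.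
  rewrite (_ : (2 * a)^-1 = (2 * Num.sqrt a ^+ 2)^-1); last by rewrite -Ea.
  move: (Num.sqrt a) b0 => b b0; by field; rewrite gt_eqF.
apply: (@is_derive_under_integral _ _ _ G
  (fun (e : R) s => f (x + Num.sqrt (rho (t + e *: evec j) s) *: zrow s))
  (fun (e : R) s => (\sum_k (Num.sqrt (r1 s) *: zrow s) 0 k *
      partial k f (x + Num.sqrt (Num.sqrt (t 0 j + e)) *: (Num.sqrt (r1 s) *: zrow s))) * psi' e)
  0 (t 0 j / 2)
  (fun s => d%:R * M * psi' (- (t 0 j / 2)) *
     (zpoly s ^+ 2 + (Num.sqrt (t 0 j))^-1 * (rho t s * zpoly s ^+ 2)))).
- by rewrite divr_gt0.
- move=> e _.
  have := integrableZl measurableT M (integrable_zpoly Grect).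
  apply: le_integrable => //.
    by apply/measurable_EFinP; exact: measurable_rV_shift.
  move=> s _ /=; rewrite lee_fin (le_trans _ (ler_norm _))//.
  rewrite (le_trans (reg_f fM _))// ler_peMr ?(reg_M0 fM)//.
  by rewrite exprn_ege1// zpoly_ge1.
- move=> e s; rewrite subr0 ltr_norml => /andP[e1 e2].
  have p : 0 < t 0 j + e by lra.
  apply: (@is_derive1_eq _ (fun e : R =>
      f (x + Num.sqrt (Num.sqrt (t 0 j + e)) *: (Num.sqrt (r1 s) *: zrow s)))); last first.
    by move=> b; rewrite sqrt_rho scalerA.
  apply: (@is_derive1_comp _ (fun a : R => f (x + a *: (Num.sqrt (r1 s) *: zrow s)))
    (fun e : R => Num.sqrt (Num.sqrt (t 0 j + e)))); last exact: is_derive_psi.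
  apply: (@is_derive_along_line _ _ _ M); first by move=> k y; have [] := df k k y.
  by move=> k y z; exact: (reg_dlip fM k z y).
- have i2 := integrableZl measurableT (Num.sqrt (t 0 j))^-1 (integrable_rho_zpoly Grect t).
  have i1 := integrableD measurableT (integrable_zpoly Grect) i2.
  by have := integrableZl measurableT (d%:R * M * psi' (- (t 0 j / 2))) i1.
- move=> e s he; have /andP[p0 ple] := psi'_le he.
  rewrite normrM (ger0_norm p0) [leRHS]mulrAC.
  apply: ler_pM => //.
  rewrite (le_trans (ler_norm_sum _ _ _))//.
  rewrite (@le_trans _ _ (\sum_(k < d) (M * (zpoly s ^+ 2 +
      (Num.sqrt (t 0 j))^-1 * (rho t s * zpoly s ^+ 2)))))//; last first.
    by rewrite sumr_const card_ord -[leLHS]mulr_natl -[leRHS]mulrA.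
  apply: ler_sum => k _; rewrite !mxE normrM mulrC; apply: ler_pM => //.
    exact: reg_df fM _ _.
  rewrite mulrA -[X in _ <= X + _]mul1r -mulrDl normrM (ger0_norm (sqrtr_ge0 _)).
  by apply: ler_pM => //; rewrite (le_trans (zpoly_norm s k)).
Qed.

Let irho_d2 x k : G.-integrable setT
  (EFin \o (fun s => rho t s * partial k (partial k f) (Fx x s))).
Proof.
have := integrableZl measurableT M (integrable_rho_zpoly Grect t).
apply: le_integrable => //.
  apply/measurable_EFinP; apply: measurable_funM; first exact: measurable_rho.
  exact: measurable_rV_shift.
move=> s _ /=; rewrite lee_fin (le_trans _ (ler_norm _))// normrM mulrC.
rewrite (ger0_norm (rho_ge0 t s)) mulrCA [leLHS]mulrC; apply: ler_pM => //; first exact: rho_ge0.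
rewrite (le_trans (reg_d2f fM _ _))// ler_peMr ?(reg_M0 fM)//.
by rewrite exprn_ege1// zpoly_ge1.
Qed.

(** Stein's identity in [z_k] at scale [sqrt rho] trades the factor [z_k] for a second [sqrt rho]
    and one more derivative. *)
Let stein_flux x k :
  \int[G]_s (Num.sqrt (rho t s) * s (inl k) * partial k f (Fx x s)) =
  \int[G]_s (rho t s * partial k (partial k f) (Fx x s)).
Proof.
rewrite (Rintegral_resample Grect (inl k) (iflux x k)).
rewrite [RHS](Rintegral_resample Grect (inl k) (irho_d2 x k)).
apply: eq_Rintegral => s _.
pose p := x + Num.sqrt (rho t s) *: zrow (upd s (inl k) 0).
have E z : Fx x (upd s (inl k) z) = p + (0 + Num.sqrt (rho t s) * z) *: evec k.
  by have := zrow_line x 0 (Num.sqrt (rho t s)) s k z; rewrite scale0r addr0 => <-.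
pose F (y : R) := partial k f (p + y *: evec k).
pose F' (y : R) := partial k (partial k f) (p + y *: evec k).
have mF : measurable_fun setT F.
  by apply: continuous_measurable_fun; exact: continuous_line.
have mF' : measurable_fun setT F'.
  by apply: continuous_measurable_fun; exact: continuous_line.
have FM y : `|F y| <= M by exact: reg_df fM _ _.
have FM' y : `|F' y| <= M by exact: reg_d2f fM _ _.
have sq v : 1 <= (1 + v ^+ 2) ^+ 2 :> R.
  by have := sqr_ge0 v; move: (v ^+ 2) => w; rewrite expr2; nra.
have := @gauss_stein _ F F' M M 0 (Num.sqrt (rho t s)) _ mF' FM FM'.
move=> /(_ _)/wrap[].
  by move=> y; apply/is_derive_line/is_derive_partial; have [] := df k k (p + y *: evec k).
move=> st.
transitivity (Num.sqrt (rho t s) *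
    \int[@gauss R]_z (F (0 + Num.sqrt (rho t s) * z) * z)).
  rewrite -RintegralZl//; last first.
    apply: (@integrable_gauss_poly _ _ M).
      apply: measurable_funM => //; apply: (measurableT_comp mF).
      by apply: measurable_funD => //; exact: measurable_funM.
    by move=> v; rewrite normrM; apply: ler_pM => //; exact: sqr_ge_norm.
  by apply: eq_Rintegral => z _; rewrite E rho_updl upd_same -mulrA [z * _]mulrC.
have sq2 (q : R) : Num.sqrt (rho t s) * (Num.sqrt (rho t s) * q) = rho t s * q.
  by rewrite mulrA -expr2 sqr_sqrtr ?rho_ge0.
have iF' : (@gauss R).-integrable setT (EFin \o (fun z : R => F' (0 + Num.sqrt (rho t s) * z))).
  apply: (@integrable_gauss_poly _ _ M).
    apply: (measurableT_comp mF').
    by apply: measurable_funD => //; exact: measurable_funM.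
  by move=> v; rewrite (le_trans (FM' _))// ler_peMr// (reg_M0 fM).
rewrite st sq2.
transitivity (\int[@gauss R]_z (rho t s * F' (0 + Num.sqrt (rho t s) * z))).
  by rewrite RintegralZl.
by apply: eq_Rintegral => z _; rewrite E rho_updl.
Qed.

Lemma is_derive_time x :
  is_derive t (evec j) (fun u => \int[G]_s f (x + Num.sqrt (rho u s) *: zrow s))
    ((4 * t 0 j)^-1 * \int[G]_s (rho t s * laplacian f (x + Num.sqrt (rho t s) *: zrow s))).
Proof.
have := is_derive_time_flux x.
rewrite (Rintegral_sum (iflux x)) (eq_bigr _ (fun k _ => stein_flux x k)).
rewrite -(Rintegral_sum (irho_d2 x)) => /is_derive_eq; apply; congr (_ * _).
by apply: eq_Rintegral => s _; rewrite /laplacian mulr_sumr.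
Qed.

End time_derivative.

(** * Random dilation for signed integrands *)

Section dilation_integral.
Context {R : realType} {I : finType}.
Variable G : probability (coords R I) R.
Hypothesis Grect : forall A, (forall i, measurable (A i)) ->
  G (rect A) = (\prod_i @gauss R (A i))%E.
Variables (sg : coords R I -> R) (K : pred I) (l : seq I) (Psi : coords R I -> R).
Hypothesis msg : measurable_fun setT sg.
Hypothesis sg_ge0 : forall s, 0 <= sg s.
Hypothesis sgK : forall s k z, K k -> sg (upd s k z) = sg s.
Hypothesis ul : uniq l.
Hypothesis Kl : all K l.
Hypothesis mPsi : measurable_fun setT Psi.
Hypothesis Psg : forall s, sg s = 0 -> Psi s = 0.
Hypothesis iD : G.-integrable setT (EFin \o (fun s => Psi (dil sg l s))).

Let L (s : coords R I) := \prod_(i <- l) gauss_dilation (sg s) (s i).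
Let L0 s : 0 <= L s.
Proof. by apply: prodr_ge0 => i _; exact: gauss_dilation_ge0. Qed.
Let mL : measurable_fun setT L.
Proof.
apply: measurable_prod => i _; rewrite /gauss_dilation.
apply: measurable_funM; first exact: measurable_funV.
apply: measurableT_comp => //; apply: measurable_funM; last first.
  by apply: measurable_funX; exact: measurable_coord.
apply: measurable_funM => //; apply: measurable_funB => //.
by apply: measurable_funV; exact: measurable_funX.
Qed.

Lemma integrable_dil : G.-integrable setT (EFin \o (fun s => Psi s * L s)).
Proof.
apply/integrableP; split; first by apply/measurable_EFinP; exact: measurable_funM.
have /integrableP[_] := iD.
have mn : measurable_fun setT (fun s : coords R I => `|Psi s|%:E).
  by apply/measurable_EFinP; exact: measurableT_comp.
have := @ge0_integral_dil _ _ _ Grect sg K msg sg_ge0 sgK l (fun s => `|Psi s|%:E) ul Kl mn.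
move=> /(_ _ _)/wrap[].
- by move=> s; rewrite lee_fin.
- by move=> s s0; rewrite Psg// normr0.
move=> -> ; congr (_ < _)%E; apply: eq_integral => s _ /=.
by rewrite normrM (ger0_norm (L0 s)).
Qed.

Lemma Rintegral_dil : \int[G]_s Psi (dil sg l s) = \int[G]_s (Psi s * L s).
Proof.
rewrite /Rintegral; congr fine; rewrite integralE [RHS]integralE; congr (_ - _)%E.
  have mn : measurable_fun setT (fun s : coords R I => (Order.max (Psi s) 0)%:E).
    by apply/measurable_EFinP; exact: measurable_maxr.
  have := @ge0_integral_dil _ _ _ Grect sg K msg sg_ge0 sgK l _ ul Kl mn.
  move=> /(_ _ _)/wrap[].
  - by move=> s; rewrite lee_fin le_max lexx orbT.
  - by move=> s s0; rewrite Psg// maxxx.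
  move=> E; transitivity (\int[G]_s (Order.max (Psi (dil sg l s)) 0)%:E)%E.
    by apply: eq_integral => s _; rewrite funeposE -EFin_max.
  rewrite E; apply: eq_integral => s _.
  by rewrite funeposE -EFin_max -EFinM (maxr_pMl _ _ (L0 s)) mul0r.
have mn : measurable_fun setT (fun s : coords R I => (Order.max (- Psi s) 0)%:E).
  by apply/measurable_EFinP; apply: measurable_maxr => //; exact: measurableT_comp.
have := @ge0_integral_dil _ _ _ Grect sg K msg sg_ge0 sgK l _ ul Kl mn.
move=> /(_ _ _)/wrap[].
- by move=> s; rewrite lee_fin le_max lexx orbT.
- by move=> s s0; rewrite Psg// oppr0 maxxx.
move=> E; transitivity (\int[G]_s (Order.max (- Psi (dil sg l s)) 0)%:E)%E.
  by apply: eq_integral => s _; rewrite funenegE -EFin_max.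
rewrite E; apply: eq_integral => s _.
by rewrite funenegE -EFin_max -EFinM (maxr_pMl _ _ (L0 s)) mul0r mulNr.
Qed.

End dilation_integral.

(** * Cancellation in the variable [b_j] *)

Section scaling_identity.
Context {R : realType} {d n : nat}.
Local Notation I := ('I_d + 'I_n)%type.
Local Notation mu := (@lebesgue_measure R).
Variable G : probability (coords R I) R.
Hypothesis Grect : forall A, (forall i, measurable (A i)) ->
  G (rect A) = (\prod_i @gauss R (A i))%E.
Variables (t : 'rV[R]_n) (j : 'I_n).
Hypothesis ot : orthant_interior n t.
Hypothesis d0 : (0 < d)%N.
Variables (h : 'rV[R]_d -> R) (alpha M : R).
Hypothesis al : 0 < alpha <= 1.
Hypothesis M0 : 0 <= M.
Hypothesis ch : continuous h.
Hypothesis hM : forall x, `|h x| <= M.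
Hypothesis hC : forall x y, `|h x - h y| <= M * `|x - y| `^ alpha.
Variable x : 'rV[R]_d.

Let t0 i : 0 < t 0 i. Proof. exact: ot. Qed.
Let rh (s : coords R I) := rho t s.
Let sr (s : coords R I) := Num.sqrt (rh s).
Let sr_ge0 s : 0 <= sr s. Proof. exact: sqrtr_ge0. Qed.
Let mrh : measurable_fun setT rh. Proof. exact: measurable_rho. Qed.
Let msr : measurable_fun setT sr. Proof. exact: measurable_fun_sqrt. Qed.
Let zsq (s : coords R I) : R := \sum_k s (inl k) ^+ 2.
Let mzsq : measurable_fun setT zsq.
Proof.
by apply: measurable_sum => k; apply: measurable_funX; exact: measurable_coord.
Qed.
Let hh (v : 'rV[R]_d) := h (x + v) - h x.
Let hermite (s : coords R I) : R := \sum_k (s (inl k) ^+ 2 - 1).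
Let hermiteE s : hermite s = zsq s - d%:R.
Proof. by rewrite /hermite sumrB sumr_const card_ord. Qed.
Let zpoly_ge0 (s : I -> R) : 0 <= zpoly s. Proof. exact: le_trans (zpoly_ge1 s). Qed.
Let mhh : measurable_fun setT (fun s => hh (sr s *: zrow s)).
Proof. by apply: measurable_funB => //; exact: measurable_rV_shift. Qed.
Let mcoord_inv : measurable_fun setT (fun s : coords R I => s (inr j) ^- 2 : R).
Proof. by apply: measurable_funV; apply: measurable_funX; exact: measurable_coord. Qed.

Lemma integrable_rho_diff : G.-integrable setT
  (EFin \o (fun s => rho t s * (h (x + Num.sqrt (rho t s) *: zrow s) - h x))).
Proof.
have := integrableZl measurableT (M + M) (integrable_rho_zpoly Grect t).
apply: le_integrable => //.
  by apply/measurable_EFinP; apply: measurable_funM.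
move=> s _ /=; rewrite lee_fin (le_trans _ (ler_norm _))// normrM.
rewrite (ger0_norm (rho_ge0 t s)) [leRHS]mulrCA; apply: ler_wpM2l; first exact: rho_ge0.
rewrite (@le_trans _ _ (M + M))//.
  by rewrite (le_trans (ler_normB _ _))// lerD.
by rewrite ler_peMr ?addr_ge0// exprn_ege1// zpoly_ge1.
Qed.

Lemma integrable_rho_hermite : G.-integrable setT (EFin \o (fun s =>
  rho t s * s (inr j) ^- 2 * ((h (x + Num.sqrt (rho t s) *: zrow s) - h x) *
    \sum_k (s (inl k) ^+ 2 - 1)))).
Proof.
have := integrableZl measurableT (t 0 j * (M * d%:R)) (integrable_kap2 Grect t j al).
apply: le_integrable => //.
  apply/measurable_EFinP; apply: measurable_funM; first exact: measurable_funM.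
  apply: measurable_funM; first exact: mhh.
  apply: measurable_sum => k; apply: measurable_funB => //.
  by apply: measurable_funX; exact: measurable_coord.
move=> s _ /=; rewrite lee_fin (le_trans _ (ler_norm _))// kap_div_rho.
have w0 : 0 <= rho t s * s (inr j) ^- 2.
  by rewrite mulr_ge0 ?rho_ge0// invr_ge0 sqr_ge0.
rewrite normrM (ger0_norm w0) [leRHS](_ : _ = rho t s * s (inr j) ^- 2 *
  ((M * (sr s `^ alpha * zpoly s)) * (d%:R * zpoly s))); last first.
  have := t0 j; rewrite /sr /rh; move: (rho t s * s (inr j) ^- 2) (t 0 j) => w tj tj0.
  move: (_ `^ _) (zpoly s) => q1 q2; field; by rewrite gt_eqF.
rewrite ler_wpM2l// normrM; apply: ler_pM => //.
  rewrite (le_trans (hC _ _))// ler_wpM2l//.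
  rewrite addrAC subrr add0r normrZ powRM// (ger0_norm (sr_ge0 s)).
  by rewrite ler_wpM2l ?powR_ge0//; exact: zrow_powR.
rewrite (le_trans (ler_norm_sum _ _ _))//.
rewrite (le_trans (ler_sum _ (fun k _ => zpoly_hermite s k)))//.
by rewrite sumr_const card_ord mulr_natl.
Qed.

(** The difference of the two integrands in the variable [sqrt rho * z]: the increment [hh] no
    longer involves [b_j], so the unknown function leaves the integral in [b_j] as a constant. *)
Let Psi (s : coords R I) : R :=
  rh s * (hh (zrow s) * (1 - 2^-1 * (s (inr j) ^- 2 * (zsq s / rh s - d%:R)))).

Let ls := [seq inl k : I | k <- index_enum 'I_d].

Let in_ls k : (inl k : I) \in ls.
Proof. by apply/mapP; exists k; rewrite ?mem_index_enum. Qed.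
Let notin_ls i : (inr i : I) \in ls = false.
Proof. by apply/negbTE/negP => /mapP[]. Qed.

Let D (s : coords R I) : R := rh s * (hh (sr s *: zrow s) *
  (1 - 2^-1 * (s (inr j) ^- 2 * hermite s))).

Let Psi_dil s : Psi (dil sr ls s) = D s.
Proof.
rewrite /Psi /D.
have -> : rh (dil sr ls s) = rh s.
  by apply: eq_bigr => i _; rewrite /dil notin_ls.
have -> : zrow (dil sr ls s) = sr s *: zrow s.
  by apply/rowP => k; rewrite !mxE /dil in_ls.
have -> : dil sr ls s (inr j) = s (inr j) by rewrite /dil notin_ls.
have -> : zsq (dil sr ls s) = rh s * zsq s.
  rewrite /zsq mulr_sumr; apply: eq_bigr => k _.
  by rewrite /dil in_ls exprMn sqr_sqrtr// rho_ge0.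
have [->|r0] := eqVneq (rh s) 0; first by rewrite !mul0r.
by rewrite (mulrC (rh s) (zsq s)) mulfK// hermiteE.
Qed.

Let iD : G.-integrable setT (EFin \o D).
Proof.
have := integrableB measurableT integrable_rho_diff
  (integrableZl measurableT 2^-1 integrable_rho_hermite).
apply: eq_integrable => // s _ /=; congr EFin.
rewrite /D /hh /hermite /sr /rh.
move: (rho t s) (h _ - h x) (s (inr j) ^- 2) (\sum_k _) => q1 q2 q3 q4; ring.
Qed.

Let mPsi : measurable_fun setT Psi.
Proof.
apply: measurable_funM => //; apply: measurable_funM.
  apply: measurable_funB => //.
  have := @measurable_rV_shift _ d n h x (cst 1) ch (@measurable_cst _ _ _ _ _ _).
  by apply: eq_measurable_fun => s _; rewrite scale1r.
apply: measurable_funB => //; apply: measurable_funM => //.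
apply: measurable_funM => //; apply: measurable_funB => //.
by apply: measurable_funM => //; exact: measurable_funV.
Qed.

Let a : R := d%:R / 2.

Let L (s : coords R I) := \prod_(i <- ls) gauss_dilation (sr s) (s i).

Let LE s : L s = rh s `^ (- a) * expR (2^-1 * (1 - (rh s)^-1) * zsq s).
Proof.
rewrite /L big_map big_split/=; congr (_ * _).
  have E : rh s `^ (d%:R / 2) = sr s ^+ d.
    by rewrite mulrC powRrM powR12_sqrt ?rho_ge0// powR_mulrn// sqrtr_ge0.
  by rewrite prodr_const card_ord exprVn powRN E.
rewrite -expR_sum; congr expR; rewrite /zsq mulr_sumr; apply: eq_bigr => k _.
by rewrite /sr sqr_sqrtr ?rho_ge0.
Qed.

(** With [z] and the other motions frozen, [rho = c |y|] and the integrand against Lebesgue measure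
    is [K1] times [radial'] at [|y|]. *)
Let inner_eq0 s : (@gauss R).-integrable setT
    (fun y => (Psi (upd s (inr j) y) * L (upd s (inr j) y))%:E) ->
  \int[@gauss R]_y (Psi (upd s (inr j) y) * L (upd s (inr j) y)) = 0.
Proof.
pose c := Num.sqrt (t 0 j) * \prod_(i | i != j) `|Num.sqrt (t 0 i) * s (inr i)|.
have c_ge0 : 0 <= c by rewrite mulr_ge0 ?sqrtr_ge0// prodr_ge0.
have rE y : rh (upd s (inr j) y) = c * `|y|.
  rewrite /rh (rho_split _ j) upd_same mulrAC; congr (_ * _ * _).
  by apply: eq_bigr => i ij; rewrite upd_other.
have zE y : zrow (upd s (inr j) y) = zrow s by apply/rowP => k; rewrite !mxE.
have zqE y : zsq (upd s (inr j) y) = zsq s by [].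
(* If this product vanishes, so does the integrand. Otherwise [z] is nonzero, since [hh] vanishes at
   0, and therefore [A > 0]. *)
have [ch0|] := eqVneq (c * hh (zrow s)) 0.
  move=> _; transitivity (\int[@gauss R]_y (0 : R)); last exact: Rintegral_gauss_cst.
  apply: eq_Rintegral => y _; rewrite /Psi rE zE.
  rewrite mulrA [X in X * _ * _](_ : _ = 0) ?mul0r//.
  by rewrite mulrAC ch0 mul0r.
rewrite mulf_eq0 negb_or => /andP[cn0 hn0].
have c0 : 0 < c by rewrite lt_neqAle eq_sym cn0.
have Z0 : 0 < zsq s.
  rewrite lt_neqAle sumr_ge0 ?andbT//; last by move=> k _; exact: sqr_ge0.
  apply: contra hn0; rewrite eq_sym psumr_eq0; last by move=> k _; exact: sqr_ge0.
  move=> /allP zk; rewrite /hh (_ : zrow s = 0) ?addr0 ?subrr//.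
  apply/rowP => k; rewrite !mxE.
  by have := zk k (mem_index_enum _); rewrite sqrf_eq0 => /eqP.
pose A := zsq s / (2 * c).
have A0 : 0 < A by rewrite divr_gt0// mulr_gt0.
have ad : 0 <= a <= d%:R.
  by rewrite /a divr_ge0//= ler_pdivrMr// ler_peMr// ler1n.
have a0 : 0 < a by rewrite /a divr_gt0// ltr0n.
pose K1 := - (c * hh (zrow s) * (c `^ (- a) * expR (2^-1 * zsq s))).
have K1n0 : K1 != 0.
  rewrite oppr_eq0; apply: mulf_neq0; first exact: mulf_neq0.
  by rewrite gt_eqF// mulr_gt0 ?powR_gt0 ?expR_gt0.
have expo_id (w q c' : R) : w != 0 -> c' != 0 ->
    2^-1 * (1 - (c' * w)^-1) * q = 2^-1 * q + - (q / (2 * c')) / w.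
  by move=> w0 c'0; field; rewrite w0 c'0.
have key_id (w q c' p1 p2 p3 e1 e2 e3 d' : R) : w != 0 -> c' != 0 ->
    c' * w * (p3 * (1 - 2^-1 * (w ^- 2 * (q / (c' * w) - d')))) * (p1 * p2 * (e1 * e2)) * e3 =
    - (c' * p3 * (p1 * e1)) * (e3 * (p2 * e2) * (- w - (d' / 2) / w + q / (2 * c') / w ^+ 2)).
  by move=> w0 c'0; field; rewrite w0 c'0.
have key (y : R) : Psi (upd s (inr j) y) * L (upd s (inr j) y) * gauss_pdf y =
    K1 * radial' a A `|y|.
  rewrite LE /Psi rE zE zqE upd_same /radial' /radial gauss_pdf_norm.
  (* At 0 the left side has the factor [rho = 0], and on the right 0 raised to the nonzero power
     [- a] is 0. *)
  have [->|y0] := eqVneq y 0.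
    rewrite normr0 mulr0 !mul0r powR0 ?oppr_eq0 ?gt_eqF//.
    by rewrite mul0r mulr0 mul0r mulr0.
  have ny0 : `|y| != 0 by rewrite normr_eq0.
  have y2 : y ^- 2 = `|y| ^- 2 by rewrite real_normK ?num_real.
  rewrite y2 powRM//.
  have -> : expR (2^-1 * (1 - (c * `|y|)^-1) * zsq s) =
      expR (2^-1 * zsq s) * expR (- A / `|y|).
    by rewrite -expRD; congr expR; exact: expo_id.
  by rewrite /K1 /a; exact: key_id.
have mPL : measurable_fun setT (fun y : R => Psi (upd s (inr j) y) * L (upd s (inr j) y)).
  have mu1 : measurable_fun setT (fun y : R => upd s (inr j) y : coords R I).
    by apply: measurable_upd => //; exact: measurable_cst.
  apply: measurable_funM; first exact: measurableT_comp mPsi mu1.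
  have mL : measurable_fun setT L.
    rewrite (_ : L = fun s => rh s `^ (- a) * expR (2^-1 * (1 - (rh s)^-1) * zsq s)); last exact/funext/LE.
    apply: measurable_funM.
      by apply: (@measurableT_comp _ _ _ _ _ _ (@powR R ^~ (- a))).
    apply: measurableT_comp => //; apply: measurable_funM => //.
    apply: measurable_funM => //; apply: measurable_funB => //.
    exact: measurable_funV.
  exact: measurableT_comp mL mu1.
move=> /(proj1 (integrable_gauss mPL)) i1.
have i2 : mu.-integrable setT (EFin \o (fun y : R => radial' a A `|y|)).
  have := integrableZl measurableT K1^-1 i1.
  apply: eq_integrable => // y _ /=; rewrite -EFinM key.
  by rewrite mulrA mulVf// mul1r.
rewrite (Rintegral_gauss mPL).
transitivity (\int[mu]_y (K1 * radial' a A `|y|)).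
  by apply: eq_Rintegral => y _; exact: key.
by rewrite RintegralZl// (Rintegral_radial'_eq0 A0 ad i2) mulr0.
Qed.

Let ID : \int[G]_s D s = 0.
Proof.
pose K (i : I) := if i is inl _ then true else false.
have srK s k z : K k -> sr (upd s k z) = sr s by case: k => // k _.
have uls : uniq ls by rewrite map_inj_uniq ?index_enum_uniq// => k l [].
have Kls : all K ls by apply/allP => i /mapP[k _ ->].
have Psg s : sr s = 0 -> Psi s = 0.
  move=> /eqP; rewrite sqrtr_eq0 => r0; rewrite /Psi (_ : rh s = 0) ?mul0r//.
  by apply/le_anti; rewrite r0 rho_ge0.
have iPD : G.-integrable setT (EFin \o (fun s => Psi (dil sr ls s))).
  by apply: eq_integrable iD => // s _; rewrite /= Psi_dil.
transitivity (\int[G]_s Psi (dil sr ls s)).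
  by apply: eq_Rintegral => s _; rewrite Psi_dil.
rewrite (Rintegral_dil Grect msr sr_ge0 srK uls Kls mPsi Psg).
have iPL := integrable_dil Grect msr sr_ge0 srK uls Kls mPsi Psg iPD.
rewrite (Rintegral_resample Grect (inr j) iPL).
have iR := integrable_resample Grect (inr j) iPL.
transitivity (\int[G]_s (0 : R)); last by rewrite /Rintegral integral0.
(* The inner integral is known to vanish only where it converges, which is almost everywhere. *)
apply: (@negligible_eq_Rintegral _ _ _ G _ _ _ _ _
  (ae_integrable_resample Grect (inr j) iPL)).
- by have /integrableP[/measurable_EFinP] := iR.
- exact: measurable_cst.
- by move=> s /contrapT; exact: inner_eq0.
Qed.

Lemma Rintegral_rho_diff :
  \int[G]_s (rho t s * (h (x + Num.sqrt (rho t s) *: zrow s) - h x)) =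
  2^-1 * \int[G]_s (rho t s * s (inr j) ^- 2 *
    ((h (x + Num.sqrt (rho t s) *: zrow s) - h x) * \sum_k (s (inl k) ^+ 2 - 1))).
Proof.
apply/eqP; rewrite -subr_eq0 -RintegralZl//; last exact: integrable_rho_hermite.
rewrite -RintegralB//; last 2 first.
- exact: integrable_rho_diff.
- exact: (integrableZl measurableT 2^-1 integrable_rho_hermite).
apply/eqP; transitivity (\int[G]_s D s); last exact: ID.
apply: eq_Rintegral => s _.
rewrite /D /hh /hermite /sr /rh.
move: (rho t s) (h _ - h x) (s (inr j) ^- 2) (\sum_k _) => q1 q2 q3 q4; ring.
Qed.

End scaling_identity.

(** * Representation of u and U *)

Lemma gauss_set1 {R : realType} (a : R) : @gauss R [set a] = 0%E.
Proof.
have /null_content_dominatesP := normal_prob_dominates (0 : R) 1.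
by apply => //; exact: lebesgue_measure_set1.
Qed.

(** Discards the set on which [kap] may differ from the squared product in the definition of
    [U_fun]. *)
Lemma negligible_coord_eq0 {R : realType} (I : finType) (G : probability (coords R I) R)
    (a : I) : (forall A, (forall i, measurable (A i)) ->
    G (rect A) = (\prod_i @gauss R (A i))%E) ->
  G.-negligible [set s | s a = 0].
Proof.
move=> Grect; pose A i := if i == a then [set (0 : R)] else setT.
have mA i : measurable (A i) by rewrite /A; case: ifP.
exists (rect A); split.
- by apply: sub_sigma_algebra; exists A.
- rewrite Grect// (bigD1 a)//= {1}/A eqxx; transitivity (0 * \prod_(i | i != a) @gauss R (A i))%E.
    by congr (_ * _)%E; exact: gauss_set1.
  by rewrite mul0e.
- by move=> s /= sa i; rewrite /A; case: eqP => // ->.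
Qed.

Section signed_transfer.
Context {R : realType} (dsp : measure_display) (Omega : measurableType dsp).
Variables (P : probability Omega R) (n d : nat).
Variables (W : 'I_d -> 'rV[R]_n -> Omega -> R) (B : 'I_n -> R -> Omega -> R).
Hypothesis HW : forall k : 'I_d, brownian_sheet1 P (W k).
Hypothesis HB : forall i : 'I_n, brownian_motion P (B i).
Hypothesis Hind : sheet_motions_independent P W B.
Local Notation I := ('I_d + 'I_n)%type.
Variable G : probability (coords R I) R.
Hypothesis Grect : forall A, (forall i, measurable (A i)) ->
  G (rect A) = (\prod_i @gauss R (A i))%E.

Section transfer.
Variables (t : 'rV[R]_n) (g : 'rV[R]_d -> R) (M : R) (kap : 'rV[R]_n -> R).
Hypothesis ot : orthant n t.
Hypothesis cg : continuous g.
Hypothesis gM : forall x, `|g x| <= M.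
Hypothesis kap0 : forall v, 0 <= kap v.
Hypothesis mkap : forall (dsp : measure_display) (T : measurableType dsp)
  (V : T -> 'rV[R]_n), (forall i, measurable_fun setT (fun t => V t 0 i)) ->
  measurable_fun setT (fun t => kap (V t)).

Let absB (w : Omega) : 'rV[R]_n := \row_i `|B i (t 0 i) w|.
Let absb (s : coords R I) : 'rV[R]_n := \row_i `|Num.sqrt (t 0 i) * s (inr i)|.

Hypothesis ikap : G.-integrable setT (EFin \o (fun s => kap (absb s))).

Let rowE s : \row_k (Num.sqrt (\prod_i absb s 0 i) * s (inl k)) =
  Num.sqrt (rho t s) *: zrow s.
Proof.
apply/rowP => k; rewrite !mxE; congr (Num.sqrt _ * _).
by apply: eq_bigr => i _; rewrite mxE.
Qed.

Let part (q : 'rV[R]_d -> R) : continuous q -> (forall x, 0 <= q x) -> (forall x, q x <= M) ->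
  (\int[P]_w (kap (absB w) * q (\row_k W k (absB w) w))%:E =
   \int[G]_s (kap (absb s) * q (Num.sqrt (rho t s) *: zrow s))%:E)%E.
Proof.
move=> cq q0 qM.
have := @ge0_transfer _ _ _ P n d W B HW HB Hind G Grect t q M kap ot cq q0 qM kap0 mkap ikap.
move=> ->; apply: eq_integral => s _.
by rewrite -/(absb s) rowE.
Qed.

(** The nonnegative case applies to the positive and negative parts of [g], which are still
    continuous and bounded. *)
Lemma transfer :
  \int[P]_w (kap (absB w) * g (\row_k W k (absB w) w)) =
  \int[G]_s (kap (absb s) * g (Num.sqrt (rho t s) *: zrow s)).
Proof.
rewrite /Rintegral; congr fine; rewrite integralE [RHS]integralE; congr (_ - _)%E.
  have := @part (fun y => Order.max (g y) 0) _ _ _.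
  move=> /(_ _ _ _)/wrap[].
  - by move=> y; apply: (@continuous_max _ _ g (cst 0)); [exact: cg|exact: cst_continuous].
  - by move=> y; rewrite le_max lexx orbT.
  - move=> y; rewrite ge_max (le_trans _ (gM y)) ?ler_norm//=.
    exact: le_trans (gM y).
  move=> E; transitivity (\int[P]_w (kap (absB w) * Order.max (g (\row_k W k (absB w) w)) 0)%:E)%E.
    by apply: eq_integral => w _; rewrite funeposE -EFin_max maxr_pMr// mulr0.
  rewrite E; apply: eq_integral => s _.
  by rewrite funeposE -EFin_max maxr_pMr// mulr0.
have := @part (fun y => Order.max (- g y) 0) _ _ _.
move=> /(_ _ _ _)/wrap[].
- move=> y; apply: (@continuous_max _ _ (\- g) (cst 0)); last exact: cst_continuous.
  by apply: continuousN; exact: cg.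
- by move=> y; rewrite le_max lexx orbT.
- move=> y; rewrite ge_max (le_trans _ (gM y)) ?(le_trans _ (gM y))//.
  by rewrite -normrN ler_norm.
move=> E; transitivity (\int[P]_w (kap (absB w) * Order.max (- g (\row_k W k (absB w) w)) 0)%:E)%E.
  by apply: eq_integral => w _; rewrite funenegE -EFin_max maxr_pMr// mulr0 mulrN.
rewrite E; apply: eq_integral => s _.
by rewrite funenegE -EFin_max maxr_pMr// mulr0 mulrN.
Qed.

End transfer.

Section representation.
Variables (f : 'rV[R]_d -> R) (M : R).
Hypothesis cf : continuous f.
Hypothesis fM : forall x, `|f x| <= M.

Let cfx (x : 'rV[R]_d) : continuous (fun y : 'rV[R]_d => f (y + x)).
Proof.
move=> y; apply: (cvg_comp (fun y : 'rV[R]_d => y + x) f); last exact: cf.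
exact: (@cvgD _ _ _ (nbhs y) _ id (cst x) y x (@cvg_id _ (nbhs y)) (@cvg_cst _ _ _ _ _)).
Qed.

Lemma u_funE t x : orthant n t ->
  u_fun P W B f t x = \int[G]_s f (x + Num.sqrt (rho t s) *: zrow s).
Proof.
move=> ot; rewrite /u_fun unlock.
have := @transfer t (fun y => f (y + x)) M (cst 1) ot (@cfx x) (fun y => fM _) (fun=> ler01).
move=> /(_ _ _)/wrap[].
- by move=> *; exact: measurable_cst.
- have := finite_measure_integrable_cst G (1 : R); exact.
move=> E; transitivity (\int[P]_w (1 * f (BTBS W B x t w))).
  by rewrite /Rintegral; congr fine; apply: eq_integral => w _; rewrite mul1r.
rewrite [LHS]E; apply: eq_Rintegral => s _.
by rewrite mul1r addrC.
Qed.

Variable j : 'I_n.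
(** The weight exactly as in [U_fun]. Unlike [kap], it still makes sense at [t_j = 0]. *)
Let wt (v : 'rV[R]_n) : R := (\prod_(i | i != j) v 0 i) ^+ 2.
Let wt0 v : 0 <= wt v. Proof. exact: sqr_ge0. Qed.
Let mwt (dsp' : measure_display) (T : measurableType dsp') (V : T -> 'rV[R]_n) :
  (forall i, measurable_fun setT (fun t => V t 0 i)) ->
  measurable_fun setT (fun t => wt (V t)).
Proof.
move=> mV; rewrite (_ : (fun t => wt (V t)) =
    fun t => (\prod_i (if i != j then V t 0 i else 1)) ^+ 2); last first.
  by apply/funext => t; rewrite /wt big_mkcond.
apply: measurable_funX; apply: measurable_prod => i _.
by case: (i != j); [exact: mV|exact: measurable_cst].
Qed.

Let q (t : 'rV[R]_n) (i : 'I_n) (z : R) : R := if i == j then 1 else (Num.sqrt (t 0 i) * z) ^+ 2.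
Let mq (t : 'rV[R]_n) i : measurable_fun setT (q t i).
Proof.
rewrite /q; case: (i == j); first exact: measurable_cst.
by apply: measurable_funX; exact: measurable_funM.
Qed.
Let q0 (t : 'rV[R]_n) i z : 0 <= q t i z.
Proof. by rewrite /q; case: (i == j) => //; exact: sqr_ge0. Qed.
Let iq (t : 'rV[R]_n) i : (@gauss R).-integrable setT (EFin \o q t i).
Proof.
rewrite /q; case: (i == j); first exact: integrable_gauss_cst.
have := integrableZl measurableT (Num.sqrt (t 0 i) ^+ 2) (@integrable_gauss_sqr R).
by apply: eq_integrable => // z _ /=; rewrite exprMn.
Qed.
Let wtE (t : 'rV[R]_n) (s : coords R I) :
  wt (\row_i `|Num.sqrt (t 0 i) * s (inr i)|) = \prod_i q t i (s (inr i)).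
Proof.
rewrite /wt [RHS](bigD1 j)//= {1}/q eqxx mul1r -prodrXl; apply: eq_bigr => i ij.
by rewrite mxE /q (negbTE ij) real_normK ?num_real.
Qed.
Let iwt (t : 'rV[R]_n) : G.-integrable setT
  (EFin \o (fun s : coords R I => wt (\row_i `|Num.sqrt (t 0 i) * s (inr i)|))).
Proof.
have := @integrable_prod_zpoly _ _ _ G Grect (q t) (mq t) (q0 t) (iq t).
apply: le_integrable => //.
  apply/measurable_EFinP; apply: mwt => i.
  rewrite (_ : (fun s => _) = (fun s : coords R I => `|Num.sqrt (t 0 i) * s (inr i)|)); last first.
    by apply/funext => s; rewrite mxE.
  apply: measurableT_comp => //; apply: measurable_funM => //; exact: measurable_coord.
move=> s _ /=; rewrite lee_fin wtE !normrM [`|zpoly s|]ger0_norm; last first.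
  exact: le_trans (zpoly_ge1 s).
by rewrite ler_peMr// -expr2 exprn_ege1// zpoly_ge1.
Qed.

Lemma U_funE (t : 'rV[R]_n) x : orthant_interior n t ->
  U_fun P W B f j t x = \int[G]_s (kap t j s * f (x + Num.sqrt (rho t s) *: zrow s)).
Proof.
move=> it; have ot : orthant n t by move=> i; exact/ltW/it.
rewrite /U_fun unlock.
have E := @transfer t (fun y => f (y + x)) M wt ot (@cfx x) (fun y => fM _) wt0 mwt (iwt t).
transitivity (\int[P]_w (wt (\row_i `|B i (t 0 i) w|) * f (BTBS W B x t w))).
  rewrite /Rintegral; congr fine; apply: eq_integral => w _; congr ((_ ^+ 2) * _)%:E.
  by apply: eq_bigr => i _; rewrite mxE.
rewrite [LHS]E.
have msh : measurable_fun setT (fun s : coords R I => f (x + Num.sqrt (rho t s) *: zrow s)).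
  by apply: measurable_rV_shift => //; apply: measurable_fun_sqrt; exact: measurable_rho.
apply: (@negligible_eq_Rintegral _ _ _ G _ _ _ _ _ (negligible_coord_eq0 (inr j) Grect)).
- apply: measurable_funM; first by have /integrableP[/measurable_EFinP] := iwt t.
  by apply: eq_measurable_fun msh => s _; rewrite addrC.
- by apply: measurable_funM => //; exact: measurable_kap.
- move=> s /eqP sj; rewrite addrC; congr (_ * _); rewrite (kapE it sj) /wt.
  by congr (_ ^+ 2); apply: eq_bigr => i _; rewrite mxE.
Qed.

(** The sheet stays at [x], so only the weight is averaged, and each remaining motion contributes
    its variance [t_i]. *)
Lemma U_fun_t0 (t : 'rV[R]_n) x : orthant n t -> (forall w, BTBS W B x t w = x) ->
  U_fun P W B f j t x = (\prod_(i | i != j) t 0 i) * f x.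
Proof.
move=> ot bx; rewrite /U_fun unlock.
have E := @transfer t (cst (f x)) M wt ot (@cst_continuous _ _ (f x)) (fun=> fM x) wt0 mwt (iwt t).
transitivity (\int[P]_w (wt (\row_i `|B i (t 0 i) w|) * f x)).
  rewrite /Rintegral; congr fine; apply: eq_integral => w _; rewrite bx; congr ((_ ^+ 2) * _)%:E.
  by apply: eq_bigr => i _; rewrite mxE.
rewrite [LHS]E RintegralZr//; congr (_ * _).
transitivity (\int[G]_s \prod_i q t i (s (inr i))); first by apply: eq_Rintegral => s _; rewrite wtE.
rewrite (Rintegral_prod_coords Grect (mq t) (q0 t) (iq t)) (bigD1 j)//= {1}/q eqxx.
rewrite Rintegral_gauss_cst mul1r; apply: eq_bigr => i ij; rewrite /q (negbTE ij).
transitivity (\int[@gauss R]_z (t 0 i * z ^+ 2)).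
  by apply: eq_Rintegral => z _; rewrite exprMn sqr_sqrtr//; exact: ot.
rewrite RintegralZl//; last exact: integrable_gauss_sqr.
by rewrite Rintegral_gauss_sqr mulr1.
Qed.

End representation.
End signed_transfer.

(** * The two systems *)

Section bilaplacian_of_weighted_mean.
Context {R : realType} {d n : nat}.
Local Notation I := ('I_d + 'I_n)%type.
Variable G : probability (coords R I) R.
Hypothesis Grect : forall A, (forall i, measurable (A i)) ->
  G (rect A) = (\prod_i @gauss R (A i))%E.
Variables (f : 'rV[R]_d -> R) (alpha M : R).
Hypothesis al : 0 < alpha <= 1.
Hypothesis df : forall (k l : 'I_d) x, derivable f x (evec l) /\
                          derivable (partial l f) x (evec k).
Hypothesis fM : regular_bounds f alpha M.
Hypothesis cf2 : forall k, continuous (partial k (partial k f)).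
Variables (t : 'rV[R]_n) (j : 'I_n).
Hypothesis ot : orthant_interior n t.

Let cf : continuous f.
Proof. exact: lipschitz_continuous_rV (reg_lip fM). Qed.
Let cdf k : continuous (partial k f).
Proof. exact: lipschitz_continuous_rV (reg_dlip fM k). Qed.
Let ch : continuous (laplacian f).
Proof.
have /andP[a0 _] := al.
exact: holder_continuous_rV a0 (reg_hold fM).
Qed.

Let sh (x : 'rV[R]_d) (s : coords R I) := x + Num.sqrt (rho t s) *: zrow s.
Let V (x : 'rV[R]_d) : R := \int[G]_s (kap t j s * f (sh x s)).

Let smooth := @is_derive_weighted_smooth R d n G (kap t j) (rho t)
  (@measurable_kap _ _ _ t j) (@measurable_rho _ _ _ t) (kap_ge0 j ot)
  (integrable_kap Grect j ot).

Let dV k x : is_derive x (evec k) V (\int[G]_s (kap t j s * partial k f (sh x s))).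
Proof.
apply: (@smooth f M k cf) => [y|y|y]; [by have [] := df k k y|exact: reg_f fM _|exact: reg_df fM _ _].
Qed.

Let partialV k : partial k V = fun x => \int[G]_s (kap t j s * partial k f (sh x s)).
Proof. by apply/funext => x; apply: derive_val; exact: dV. Qed.

Let d2V k x : is_derive x (evec k) (partial k V)
  (\int[G]_s (kap t j s * partial k (partial k f) (sh x s))).
Proof.
rewrite partialV.
apply: (@smooth (partial k f) M k (@cdf k)) => [y|y|y].
- by have [] := df k k y.
- exact: reg_df fM _ _.
- exact: reg_d2f fM _ _.
Qed.

Let ikd2 x k : G.-integrable setT
  (EFin \o (fun s => kap t j s * partial k (partial k f) (sh x s))).
Proof.
have := integrableZl measurableT M (integrable_kap Grect j ot).
apply: le_integrable => //.
  apply/measurable_EFinP; apply: measurable_funM; first exact: measurable_kap.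
  by apply: measurable_rV_shift => //; apply: measurable_fun_sqrt; exact: measurable_rho.
move=> s _ /=; rewrite lee_fin (le_trans _ (ler_norm _))// normrM mulrC.
rewrite (ger0_norm (kap_ge0 j ot s)); apply: ler_wpM2r; first exact: kap_ge0.
exact: reg_d2f fM _ _.
Qed.

Let lapV : laplacian V = fun x => \int[G]_s (kap t j s * laplacian f (sh x s)).
Proof.
apply/funext => x; rewrite /laplacian.
transitivity (\sum_k \int[G]_s (kap t j s * partial k (partial k f) (sh x s))).
  by apply: eq_bigr => k _; apply: derive_val; exact: d2V.
rewrite -(Rintegral_sum (ikd2 x)); apply: eq_Rintegral => s _.
by rewrite mulr_sumr.
Qed.

Let rough0 := @is_derive_weighted_rough0 R d n G Grect (kap t j) (rho t)
  (@measurable_kap _ _ _ t j) (@measurable_rho _ _ _ t) (kap_ge0 j ot) (rho_ge0 t)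
  (@kap_updl _ _ _ t j) (@rho_updl _ _ _ t) (@kap_rho _ _ _ t j)
  (integrable_kap Grect j ot) (integrable_kap1 Grect j ot).

Let d3V k x : is_derive x (evec k) (laplacian V)
  (\int[G]_s (kap t j s * (Num.sqrt (rho t s))^-1 * (laplacian f (sh x s) * s (inl k)))).
Proof. by rewrite lapV; apply: (@rough0 _ M k ch); exact: reg_lap fM. Qed.

Let partial_lapV k : partial k (laplacian V) = fun x =>
  \int[G]_s (kap t j s * (Num.sqrt (rho t s))^-1 * (laplacian f (sh x s) * s (inl k))).
Proof. by apply/funext => x; apply: derive_val; exact: d3V. Qed.

Let rough1 := @is_derive_weighted_rough1 R d n G Grect (kap t j) (rho t)
  (@measurable_kap _ _ _ t j) (@measurable_rho _ _ _ t) (kap_ge0 j ot) (rho_ge0 t)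
  (@kap_updl _ _ _ t j) (@rho_updl _ _ _ t) (@kap_rho _ _ _ t j)
  (integrable_kap1 Grect j ot).

Let term k x (s : coords R I) : R := kap t j s * (rho t s)^-1 *
  ((laplacian f (sh x s) - laplacian f x) * (s (inl k) ^+ 2 - 1)).

Let d4V k x : is_derive x (evec k) (partial k (laplacian V)) (\int[G]_s term k x s).
Proof.
rewrite partial_lapV.
apply: (@rough1 (laplacian f) M k ch (reg_lap fM) M alpha al (reg_M0 fM) (reg_hold fM)).
exact: integrable_kap2.
Qed.

Lemma bilaplacian_exists_weighted : bilaplacian_exists V.
Proof.
by move=> k x; split; [|split; [|split]]; apply: ex_derive;
  [exact: dV|exact: d2V|exact: d3V|exact: d4V].
Qed.

Let iterm x k : G.-integrable setT (EFin \o term k x).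
Proof.
apply: (@integrable_weighted_rough1 R d n G (kap t j) (rho t)
  (@measurable_kap _ _ _ t j) (@measurable_rho _ _ _ t) (kap_ge0 j ot) (rho_ge0 t)
  (laplacian f) k ch M alpha al (reg_M0 fM) (reg_hold fM)).
exact: integrable_kap2.
Qed.

(** The factor 1/8 splits into the 1/4 of the time derivative and the 1/2 of the scaling
    identity. *)
Lemma bilaplacian_weighted x : (0 < d)%N ->
  8^-1 * bilaplacian V x = (4 * t 0 j)^-1 *
    \int[G]_s (rho t s * (laplacian f (sh x s) - laplacian f x)).
Proof.
move=> d0.
rewrite (Rintegral_rho_diff Grect j ot d0 al (reg_M0 fM) ch (reg_lap fM) (reg_hold fM) x).
rewrite /bilaplacian {1}/laplacian.
transitivity (8^-1 * \sum_k \int[G]_s term k x s).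
  by congr (_ * _); apply: eq_bigr => k _; apply: derive_val; exact: d4V.
rewrite -(Rintegral_sum (iterm x)).
transitivity (8^-1 * ((t 0 j)^-1 * \int[G]_s (rho t s * s (inr j) ^- 2 *
    ((laplacian f (sh x s) - laplacian f x) * \sum_k (s (inl k) ^+ 2 - 1))))).
  congr (_ * _); rewrite -RintegralZl//; last first.
    exact: (integrable_rho_hermite Grect j ot al (reg_M0 fM) ch (reg_hold fM) x).
  apply: eq_Rintegral => s _; rewrite /term -mulr_sumr -mulr_sumr kap_div_rho.
  exact/esym/mulrA.
have tj : t 0 j != 0 by rewrite gt_eqF//; exact: ot.
by move: (\int[_]_s _) (t 0 j) tj => q a a0; field.
Qed.

(** Each [|B^(i)(t_i)|] has mean [sqrt (2 t_i / pi)]. The coefficients are nonnegative and are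
    compared after squaring, where [4^2 (pi / 2)^n] becomes [2^(4-n) pi^n]. *)
Lemma T1E x : T1 f j t x = (4 * t 0 j)^-1 * (\int[G]_s rho t s) * laplacian f x.
Proof.
rewrite /T1 (Rintegral_rho Grect); congr (_ * _).
have t0 i : 0 < t 0 i by exact: ot.
set L := RHS.
have L0 : 0 <= L.
  rewrite mulr_ge0 ?invr_ge0 ?mulr_ge0// ?(ltW (t0 j))//.
  by apply: prodr_ge0 => i _; rewrite mulr_ge0 ?sqrtr_ge0.
rewrite -[RHS](ger0_norm L0) -sqrtr_sqr; congr Num.sqrt.
rewrite /L exprMn -prodrXl.
have -> : \prod_i (Num.sqrt (t 0 i) * Num.sqrt (2 / pi)) ^+ 2 =
    (t 0 j * \prod_(i | i != j) t 0 i) * (2 / pi) ^+ n.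
  under eq_bigr => i _ do rewrite exprMn !sqr_sqrtr ?divr_ge0 ?pi_ge0 ?(ltW (t0 i))//.
  by rewrite big_split/= prodr_const card_ord (bigD1 j).
have -> : (2 : R) `^ (4 - n%:R) = 16 / 2 ^+ n.
  rewrite powRB ?pnatr_eq0 ?implybT// !powR_mulrn// ; congr (_ / _); ring.
rewrite expr_div_n.
have tj : t 0 j != 0 by rewrite gt_eqF.
have p2 : (2 : R) ^+ n != 0 by rewrite expf_neq0.
have pn : (pi : R) ^+ n != 0 by rewrite expf_neq0// gt_eqF// pi_gt0.
move: (t 0 j) tj (2 ^+ n) p2 (pi ^+ n) pn (\prod_(_ | _) _) => a a0 b b0 c c0 e.
by field; rewrite a0 b0 c0.
Qed.

End bilaplacian_of_weighted_mean.

(** * Expansion of the product over the time parameters *)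

Section product_expansion.
Context {R : realType} {n : nat}.

(** Distributivity gives one term per choice function. As ['I_2] starts at 0, the index [k_j] is
    [(k j).+1]; the sum of indices is [n] only for the choice of all [a j] and [2 n] only for all
    [b j], the two choices that the range excludes. *)
Lemma prod_T_expand (a b : 'I_n -> R) : (0 < n)%N ->
  \prod_j (a j + b j) = \prod_j a j + \prod_j b j +
    \sum_(k : {ffun 'I_n -> 'I_2} | (n.+1 <= \sum_(j < n) (k j).+1 <= 2 * n - 1)%N)
      \prod_(j < n) (if k j == ord0 then a j else b j).
Proof.
move=> n0.
pose F j (i : 'I_2) := if i == ord0 then a j else b j.
transitivity (\prod_j \sum_(i < 2) F j i).
  by apply: eq_bigr => j _; rewrite !big_ord_recl big_ord0 addr0.
rewrite bigA_distr_bigA/=.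
pose k0 : {ffun 'I_n -> 'I_2} := [ffun=> ord0].
pose k1 : {ffun 'I_n -> 'I_2} := [ffun=> ord_max].
have k10 : k1 != k0.
  apply/eqP => /ffunP/(_ (Ordinal n0)); rewrite !ffunE => /(congr1 val).
  by [].
rewrite (bigD1 k0)//= (bigD1 k1)//= addrA; congr (_ + _ + _).
- by apply: eq_bigr => j _; rewrite /F ffunE eqxx.
- by apply: eq_bigr => j _; rewrite /F ffunE.
apply: eq_bigl => k.
have S1 : (\sum_(j < n) (k j).+1 = n + \sum_(j < n) k j)%N.
  under eq_bigr => j _ do rewrite -add1n.
  by rewrite big_split/= sum1_card card_ord.
have kle j : (k j <= 1)%N by have := ltn_ord (k j); lia.
have Q0 : (k == k0) = (\sum_(j < n) k j == 0)%N.
  rewrite sum_nat_eq0; apply/eqP/forallP => [-> j|h] /=; first by rewrite ffunE.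
  by apply/ffunP => i; rewrite ffunE; apply/val_inj => /=; apply/eqP; exact: h.
have S2 : (\sum_(j < n) k j + \sum_(j < n) (1 - k j) = n)%N.
  rewrite -big_split/= -[RHS](card_ord n) -sum1_card; apply: eq_bigr => j _.
  by rewrite subnKC.
have Q1 : (k == k1) = (\sum_(j < n) (1 - k j) == 0)%N.
  rewrite sum_nat_eq0; apply/eqP/forallP => [-> j|h] /=; first by rewrite ffunE.
  apply/ffunP => i; rewrite ffunE; apply/val_inj => /=.
  by have := h i; have := kle i; rewrite subn_eq0/=; lia.
rewrite Q0 Q1 S1; move: S2 n0.
move: (\sum_(j < n) k j)%N (\sum_(j < n) (1 - k j))%N => p q.
lia.
Qed.

(** With [tau] the product of all times, the [j]-th radicand is [(tau / c) / t_j^2], so the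
    radicands multiply to [tau^n / (c^n tau^2)]. *)
Lemma prod_T1 (t : 'rV[R]_n) (h : R) : orthant_interior n t ->
  \prod_(j < n) (Num.sqrt ((\prod_(i < n | i != j) t ord0 i) /
            ((2 : R) `^ (4 - n%:R) * pi ^+ n * t ord0 j)) * h) =
  Num.sqrt ((\prod_(i < n) t ord0 i) `^ (n%:R - 2) /
                 ((2 : R) `^ (4 * n%:R - n%:R ^+ 2) * pi ^+ (n * n))) * h ^+ n.
Proof.
move=> ot; have t0 i : 0 < t 0 i by exact: ot.
rewrite big_split/= prodr_const card_ord; congr (_ * _).
pose tau := \prod_i t 0 i.
have tau0 : 0 < tau by apply: prodr_gt0 => i _; exact: t0.
pose c : R := 2 `^ (4 - n%:R) * pi ^+ n.
have c0 : 0 < c by rewrite mulr_gt0 ?powR_gt0// exprn_gt0// pi_gt0.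
have E j : (\prod_(i < n | i != j) t ord0 i) / (c * t ord0 j) = (tau / c) / t 0 j ^+ 2.
  rewrite /tau [in RHS](bigD1 j)//=.
  have tj : t 0 j != 0 by rewrite gt_eqF.
  have cn0 : c != 0 by rewrite gt_eqF.
  move: (\prod_(_ | _) _) => q; by field; rewrite tj cn0.
have S (r : seq 'I_n) (F : 'I_n -> R) : (forall i, 0 <= F i) ->
    \prod_(i <- r) Num.sqrt (F i) = Num.sqrt (\prod_(i <- r) F i).
  move=> F0; elim: r => [|i r ih]; first by rewrite !big_nil sqrtr1.
  by rewrite !big_cons ih sqrtrM.
rewrite S; last first.
  move=> j; rewrite -/c E divr_ge0 ?sqr_ge0// divr_ge0 ?ltW//.
congr Num.sqrt; rewrite -/c (eq_bigr _ (fun j _ => E j)) big_split/= prodr_const card_ord.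
rewrite prodfV prodrXl -/tau.
have -> : tau `^ (n%:R - 2) = tau ^+ n / tau ^+ 2.
  have taun0 : tau != 0 by rewrite gt_eqF.
  by rewrite powRB ?taun0 ?implybT// !powR_mulrn// ltW.
have -> : (2 : R) `^ (4 * n%:R - n%:R ^+ 2) * pi ^+ (n * n) = c ^+ n.
  rewrite /c exprMn -exprM; congr (_ * _).
  by rewrite -[RHS]powR_mulrn ?powR_ge0// -powRrM; congr (_ `^ _); ring.
by rewrite expr_div_n mulrAC.
Qed.

End product_expansion.

Theorem mainTheorem1 (R : realType) (disp : measure_display)
  (Omega : measurableType disp) (P : probability Omega R) (n d : nat)
  (W : 'I_d -> 'rV[R]_n -> Omega -> R) (B : 'I_n -> R -> Omega -> R)
  (f : 'rV[R]_d -> R) (alpha : R) :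
  (0 < n)%N -> (0 < d)%N ->
  (forall k : 'I_d, brownian_sheet1 P (W k)) ->
  (forall (k : 'I_d) t w, orthant_boundary n t -> W k t w = 0) ->
  (forall i : 'I_n, brownian_motion P (B i)) ->
  sheet_motions_independent P W B ->
  bounded_fun_rV f -> borel_measurable_rV f ->
  0 < alpha <= 1 ->
  (forall (k l : 'I_d) x, derivable f x (evec l) /\
                          derivable (partial l f) x (evec k)) ->
  (forall k l : 'I_d, bounded_fun_rV (partial k (partial l f)) /\
                      holder alpha (partial k (partial l f))) ->
  let u := u_fun P W B f in
  let U := U_fun P W B f in
  (* (i) the linear system *)
  (forall j : 'I_n,
     (* (a) *)
     (forall t, orthant_interior n t ->
        bilaplacian_exists (U j t) /\
        forall x, is_derive t (evec j) (fun s => u s x)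
                    (T1 f j t x + T2 U j t x)) /\
     (* (b) *)
     (forall t x, orthant_boundary n t -> u t x = f x) /\
     (* (c) *)
     (forall t x, orthant n t -> (exists i : 'I_n, i != j /\ t ord0 i = 0) ->
        U j t x = 0) /\
     (* (d) *)
     (forall t x, orthant n t -> t ord0 j = 0 ->
        U j t x = (\prod_(i < n | i != j) t ord0 i) * f x)) /\
  (* (ii) the nonlinear interacting PDE (boundary conditions as above) *)
  (forall t x, orthant_interior n t ->
     \prod_(j < n) 'D_(evec j) (fun s => u s x) t =
       Num.sqrt ((\prod_(i < n) t ord0 i) `^ (n%:R - 2) /
                 ((2 : R) `^ (4 * n%:R - n%:R ^+ 2) * pi ^+ (n * n)))
         * (laplacian f x) ^+ n
       + (8 ^+ n)^-1 * \prod_(j < n) bilaplacian (U j t) x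
       + \sum_(k : {ffun 'I_n -> 'I_2} |
                 (n.+1 <= \sum_(j < n) (k j).+1 <= 2 * n - 1)%N)
           \prod_(j < n) (if k j == ord0 then T1 f j t x else T2 U j t x)).
Proof.
move=> n0 d0 HW Wb HB Hind fb _ al df f2 u U.
have [G Grect] := exists_gaussian_coords HW HB Hind.
have [M fM] := regularity fb df f2.
have cf : continuous f by exact: lipschitz_continuous_rV (reg_lip fM).
have cf2 k : continuous (partial k (partial k f)).
  have [_ [C CP]] := f2 k k; have /andP[a0 _] := al.
  exact: holder_continuous_rV a0 CP.
have uE := @u_funE _ _ _ P n d W B HW HB Hind G Grect f M cf (reg_f fM).
have UE j t (it : orthant_interior n t) :
    U j t = fun x => \int[G]_s (kap t j s * f (x + Num.sqrt (rho t s) *: zrow s)).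
  by apply/funext => x; exact: (U_funE HW HB Hind Grect cf (reg_f fM)).
have main j t x : orthant_interior n t ->
    is_derive t (evec j) (fun s => u s x) (T1 f j t x + T2 U j t x).
  move=> it; have t0 i : 0 < t 0 i by exact: it.
  have D := is_derive_time Grect df fM cf2 j it x.
  have E : (4 * t 0 j)^-1 * \int[G]_s (rho t s *
      laplacian f (x + Num.sqrt (rho t s) *: zrow s)) = T1 f j t x + T2 U j t x.
    rewrite (T1E Grect f j it) /T2 (UE j t it) (bilaplacian_weighted Grect al df fM cf2 j it)//.
    have irho : G.-integrable setT (EFin \o rho t).
      have := integrable_rho_zpoly Grect t; apply: le_integrable => //.
        by apply/measurable_EFinP; exact: measurable_rho.
      move=> s _ /=; rewrite lee_fin normrM ler_peMr// ger0_norm ?sqr_ge0//.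
      by rewrite exprn_ege1// zpoly_ge1.
    have ch : continuous (laplacian f).
      have /andP[a0 _] := al; exact: holder_continuous_rV a0 (reg_hold fM).
    have ihx := integrableZl measurableT (laplacian f x) irho.
    have idf := integrable_rho_diff Grect t (reg_M0 fM) ch (reg_lap fM) x.
    (* The part [h(x) E[rho]] and the increment part recombine under one integral. *)
    rewrite -[_^-1 * _ * _]mulrA -mulrDr; congr (_ * _).
    rewrite [X in X + _]mulrC -RintegralZl// -RintegralD//.
    apply: eq_Rintegral => s _.
    by move: (rho t s) (laplacian f _) (laplacian f x) => q1 q2 q3; ring.
  rewrite -E; apply/is_derive_line0.
  (* The Gaussian representation of [u] holds on the orthant only; at an interior point it is needed
     just for small [e]. *)
  move/is_derive_line0 : D; apply: near_eq_is_derive.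
  near=> e; apply/esym/uE => i; rewrite !mxE eqxx /=.
  have [->|ij] := eqVneq i j; last by rewrite mulr0 addr0 ltW.
  rewrite mulr1.
  suff : `|e| < t 0 j by rewrite ltr_norml => /andP[h _]; have := t0 j; lra.
  near: e; exists (t 0 j); first exact: t0.
  by move=> e; rewrite /= sub0r normrN.
(* A zero time puts the corresponding motion at 0, hence the parameter of the sheet on the boundary,
   where the sheet vanishes. *)
have Bx t x w : orthant_boundary n t -> BTBS W B x t w = x.
  move=> [ot [i ti]]; rewrite /BTBS; apply/rowP => k; rewrite !mxE Wb ?add0r//.
  split; first by move=> l; rewrite mxE.
  by exists i; rewrite mxE ti; have [_ [_ ->]] := HB i; rewrite normr0.
split; last first.
  move=> t x it.
  transitivity (\prod_(j < n) (T1 f j t x + T2 U j t x)).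
    by apply: eq_bigr => j _; apply: derive_val; exact: main.
  rewrite prod_T_expand//; congr (_ + _ + _); first exact: prod_T1.
  by rewrite /T2 big_split/= prodr_const card_ord exprVn.
move=> j; split; [|split; [|split]].
- move=> t it; split; last by move=> x; exact: main.
  by rewrite (UE j t it); exact: (bilaplacian_exists_weighted Grect al df fM cf2 j it).
- move=> t x bt; rewrite /u /u_fun.
  rewrite (_ : (fun w => _) = cst (f x)); last by apply/funext => w; rewrite Bx.
  by rewrite expectation_cst.
- move=> t x ot [i [ij ti]]; rewrite /U /U_fun.
  rewrite (_ : (fun w => _) = cst 0); first by rewrite expectation_cst.
  apply/funext => w; rewrite (bigD1 i)//= ti; have [_ [_ ->]] := HB i.
  by rewrite normr0 mul0r expr0n mul0r.
- move=> t x ot tj; apply: (U_fun_t0 HW HB Hind Grect (reg_f fM)) => // w.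
  by apply: Bx; split => //; exists j.
Unshelve. all: by end_near. Qed.
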